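(* Let $n\ge 1$, let $F$ be a Minkowski norm on $\mathbb{R}^{n+1}$ with dual norm $F^0$, Wulff shape $\mathcal{W}$, and let $L$ be the domain enclosed by $\mathcal{W}$. Let $\Sigma=\partial\Omega\subset\mathbb{R}^{n+1}$ be a smooth closed hypersurface enclosing the bounded domain $\Omega$, which is star-shaped with respect to the origin and $F$-mean convex (i.e. its anisotropic mean curvature satisfies $H_F\ge 0$). Then for any point $P\in\mathbb{R}^{n+1}$, $$\int_{\Sigma}F^0(x-P)\,d\mu_F\ \ge\ \frac{n}{(n+1)^{1+\frac1n}}\,\mathrm{Vol}(L)^{-\frac1n}\,|\Sigma|_F^{1+\frac1n}+\mathrm{Vol}(\Omega).$$ Moreover, equality is attained if and only if $\Sigma$ is a rescaling of $\mathcal{W}$ centered at $P$, i.e. $\Sigma=a\mathcal{W}+P$ for some $a>0$.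
   Context: Minkowski norm: a function $F:\mathbb{R}^{n+1}\to[0,\infty)$ that is convex, 1-homogeneous ($F(\lambda x)=\lambda F(x)$ for $\lambda>0$; evenness is not required), positive on $\mathbb{R}^{n+1}\setminus\{0\}$, $F(0)=0$, smooth on $\mathbb{R}^{n+1}\setminus\{0\}$, with $D^2(\tfrac12F^2)$ positive definite on $\mathbb{R}^{n+1}\setminus\{0\}$. Dual norm: $F^0(x)=\sup_{y\ne0}\frac{x\cdot y}{F(y)}$. Wulff shape: $\mathcal{W}=\{x:F^0(x)=1\}=\{DF(\xi):\xi\in\mathbb{S}^n\}$, a smooth closed strictly convex hypersurface with support function $F|_{\mathbb{S}^n}$; it bounds $L=\{x:F^0(x)<1\}$. For a smooth closed embedded hypersurface $\Sigma$ with outward unit normal $\nu$ and Euclidean area element $d\mu$: the anisotropic area element is $d\mu_F=F(\nu)\,d\mu$ and the anisotropic perimeter is $|\Sigma|_F=\int_\Sigma d\mu_F$. The anisotropic Gauss map is $\nu_F:\Sigma\to\mathcal{W}$, $\nu_F(x)=DF(\nu(x))$. Since $T_x\Sigma$ and $T_{\nu_F(x)}\mathcal{W}$ are the same linear subspace $\nu(x)^\perp$, $d\nu_F$ is an endomorphism of $T_x\Sigma$; its eigenvalues are the anisotropic principal curvatures and its trace is the anisotropic mean curvature $H_F$ (so $H_F=n$ on $\mathcal{W}$). Star-shaped with respect to a point $O$: $\Sigma$ is a radial graph $\{O+r(\theta)\theta:\theta\in\mathbb{S}^n\}$ with $r:\mathbb{S}^n\to(0,\infty)$ smooth. $\mathrm{Vol}$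 denotes Lebesgue measure on $\mathbb{R}^{n+1}$. *)

(* Defs.v *)
From HB Require Import structures.
From mathcomp Require Import all_boot all_order all_algebra.
From mathcomp Require Import all_classical all_reals all_analysis.

Set Implicit Arguments.
Unset Strict Implicit.
Unset Printing Implicit Defensive.

Import Order.TTheory GRing.Theory Num.Theory.
Import numFieldNormedType.Exports.

Local Open Scope classical_set_scope.
Local Open Scope ring_scope.

(* The library norm on 'rV[R]_m is the sup norm: it is used below only through
   the topology; Euclidean lengths and angles go through [dot]. *)

Definition dot (R : realType) m (u v : 'rV[R]_m) : R := (u *m v^T) 0 0.

Definition enorm (R : realType) m (u : 'rV[R]_m) : R := Num.sqrt (dot u u).

Definition unit_sphere (R : realType) m : set 'rV[R]_m := [set x | enorm x = 1].

Fixpoint Ck_on (R : realType) (V W : normedModType R) (k : nat) (U : set V)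
    (f : V -> W) : Prop :=
  (forall x, U x -> {for x, continuous f}) /\
  (if k is k'.+1 then
     forall v, (forall x, U x -> derivable f x v) /\ Ck_on k' U ('D_v f)
   else True).

Definition smooth_on (R : realType) (V W : normedModType R) (U : set V)
    (f : V -> W) : Prop := forall k, Ck_on k U f.

(* Smoothness on an arbitrary subset, e.g. a submanifold: local existence of
   smooth extensions. *)
Definition smooth_on_subset (R : realType) (V W : normedModType R) (S : set V)
    (f : V -> W) : Prop :=
  forall x, S x -> exists (U : set V) (g : V -> W),
    [/\ open U, U x, smooth_on U g & forall y, U y -> S y -> f y = g y].

Definition grad (R : realType) m (f : 'rV[R]_m -> R) (x : 'rV[R]_m) : 'rV[R]_m :=
  \row_i 'D_(delta_mx 0 i) f x.

Definition hessian (R : realType) m (f : 'rV[R]_m -> R) (x : 'rV[R]_m) : 'M[R]_m :=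
  \matrix_(i, j) 'D_(delta_mx 0 i) ('D_(delta_mx 0 j) f) x.

Definition rV_display : measure_display.
Proof. exact: default_measure_display. Qed.

Section measurable_rV.
Context (R : realType) (m : nat).

Let coord : 'I_m -> 'rV[R]_m -> measurableTypeR R := fun i x => x 0 i.

Let rV_set0 : g_sigma_preimage coord set0.
Proof. exact: sigma_algebra0. Qed.

Let rV_setC A : g_sigma_preimage coord A -> g_sigma_preimage coord (~` A).
Proof. exact: sigma_algebraC. Qed.

Let rV_bigcup (A : (set _)^nat) : (forall i, g_sigma_preimage coord (A i)) ->
  g_sigma_preimage coord (\bigcup_i A i).
Proof. exact: sigma_algebra_bigcup. Qed.

(* The product sigma-algebra, that is, the Borel sets of R^m. *)
HB.instance Definition _ := @isMeasurable.Build rV_display 'rV[R]_m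
  (g_sigma_preimage coord) rV_set0 rV_setC rV_bigcup.

Lemma measurable_coord (i : 'I_m) :
  measurable_fun [set: 'rV[R]_m] (fun x : 'rV[R]_m => x 0 i : measurableTypeR R).
Proof.
move=> _ Y mY; rewrite setTI; apply: sub_sigma_algebra => /=.
rewrite -bigcup_seq/=; exists i => /=; first by rewrite mem_index_enum.
by exists Y => //; rewrite setTI.
Qed.

Lemma measurable_fun_rV d (T : measurableType d) (f : T -> 'rV[R]_m) :
  (forall i, measurable_fun [set: T] (fun t => f t 0 i : measurableTypeR R)) ->
  measurable_fun [set: T] f.
Proof.
move=> mf _ A mA.
have -> : [set: T] `&` f @^-1` A = f @^-1` A by rewrite setTI.
move: A mA; rewrite /measurable/= => A mA.
suff : g_sigma_preimage coord `<=` image_set_system setT f measurable.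
  by move=> /(_ _ mA); rewrite /image_set_system/= setTI.
apply: smallest_sub.
  by apply: sigma_algebra_image; exact: sigma_algebra_measurable.
rewrite -bigcup_seq => B [i _ [C mC <-]].
by rewrite /image_set_system/= !setTI; have := mf i measurableT _ mC; rewrite setTI.
Qed.

End measurable_rV.

Section lebesgue_step.
Context (R : realType) (m : nat).
Variable mu : {sigma_finite_measure set 'rV[R]_m -> \bar R}.

Definition rV_cons (p : measurableTypeR R * 'rV[R]_m) : 'rV[R]_m.+1 :=
  row_mx (p.1 : R)%:M p.2.

Definition rV_uncons (x : 'rV[R]_m.+1) : measurableTypeR R * 'rV[R]_m :=
  (x 0 0, rsubmx (x : 'rV[R]_(1 + m))).

Lemma rV_consK : cancel rV_cons rV_uncons.
Proof.
move=> [a v]; rewrite /rV_uncons /rV_cons; congr pair; last exact: row_mxKr.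
transitivity ((row_mx (a : R)%:M v : 'rV[R]_(1 + m)) 0 (lshift m 0)).
  by congr (_ _ _); exact/val_inj.
by rewrite row_mxEl mxE eqxx mulr1n.
Qed.

Lemma measurable_rV_cons : measurable_fun [set: _] rV_cons.
Proof.
apply: measurable_fun_rV => i; rewrite /rV_cons.
case: (@split_ordP 1 m i) => j ->.
  rewrite (_ : (fun _ => _) = fst) ?measurable_fst//.
  apply/funext => p /=; rewrite ord1; apply: etrans (row_mxEl _ _ _ _) _.
  by rewrite mxE eqxx mulr1n.
rewrite (_ : (fun _ => _) = (fun x : 'rV[R]_m => x 0 j : measurableTypeR R) \o snd).
  by apply: measurableT_comp => //; exact: measurable_coord.
by apply/funext => p; exact: row_mxEr.
Qed.

Lemma measurable_rV_uncons : measurable_fun [set: _] rV_uncons.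
Proof.
apply/measurable_fun_pairP; split; first exact: measurable_coord.
apply: measurable_fun_rV => i; rewrite (_ : (fun _ => _) =
  (fun x : 'rV[R]_m.+1 => x 0 (rshift 1 i) : measurableTypeR R)).
  exact: measurable_coord.
by apply/funext => x; rewrite /= mxE.
Qed.

Definition lebesgue_step : set 'rV[R]_m.+1 -> \bar R :=
  pushforward (lebesgue_measure \x mu)%E rV_cons.

Let measurable_preimage A : measurable A -> measurable (rV_cons @^-1` A).
Proof. by move=> mA; rewrite -[X in measurable X]setTI; exact: measurable_rV_cons. Qed.

Let lebesgue_step0 : lebesgue_step set0 = 0%E.
Proof. by rewrite /lebesgue_step /pushforward preimage_set0 measure0. Qed.

Let lebesgue_step_ge0 A : (0 <= lebesgue_step A)%E.
Proof. by rewrite /lebesgue_step /pushforward; exact: measure_ge0. Qed.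

Let lebesgue_step_sigma_additive : semi_sigma_additive lebesgue_step.
Proof.
move=> F mF tF mUF; rewrite /lebesgue_step /pushforward preimage_bigcup.
apply: measure_semi_sigma_additive.
- by move=> k; exact: measurable_preimage.
- apply/trivIsetP => /= i j _ _ ij; rewrite -preimage_setI.
  by move/trivIsetP : tF => /(_ _ _ _ _ ij) ->//; rewrite preimage_set0.
- by rewrite -preimage_bigcup; exact: measurable_preimage.
Qed.

HB.instance Definition _ := isMeasure.Build _ _ _ lebesgue_step
  lebesgue_step0 lebesgue_step_ge0 lebesgue_step_sigma_additive.

Let lebesgue_step_sigma_finite : sigma_finite setT lebesgue_step.
Proof.
have [F TF mF] : sigma_finite setT (lebesgue_measure \x mu)%E.
  have /sigma_finiteP[F [TF ndF Foo]] := sigma_finiteT (@lebesgue_measure R).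
  have /sigma_finiteP[G [TG ndG Goo]] := sigma_finiteT mu.
  exists (fun k => F k `*` G k).
    rewrite -setXTT TF TG predeqE => -[x y]; split.
      move=> [/= [i _ Fix] [j _ Gjy]]; exists (maxn i j) => //; split.
      - by move: x Fix; exact/subsetPset/ndF/leq_maxl.
      - by move: y Gjy; exact/subsetPset/ndG/leq_maxr.
    by move=> [i _ []/= ? ?]; split; exists i.
  move=> k; have [mF Fkoo] := Foo k; have [mG Gkoo] := Goo k.
  split; first exact: measurableX.
  by rewrite product_measure1E// lte_mul_pinfty// ge0_fin_numE.
exists (fun k => rV_uncons @^-1` F k).
  by rewrite -preimage_bigcup -TF preimage_setT.
move=> k; have [mFk Fkoo] := mF k; split.
  by rewrite -[X in measurable X]setTI; exact: measurable_rV_uncons.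
rewrite /lebesgue_step /pushforward -comp_preimage.
rewrite (_ : rV_uncons \o rV_cons = id) ?preimage_id//.
by apply/funext => p; exact: rV_consK.
Qed.

HB.instance Definition _ := Measure_isSigmaFinite.Build _ _ _ lebesgue_step
  lebesgue_step_sigma_finite.

End lebesgue_step.

Fixpoint lebesgue_rV (R : realType) (m : nat) :
    {sigma_finite_measure set 'rV[R]_m -> \bar R} :=
  if m is m'.+1 then lebesgue_step (lebesgue_rV R m') else \d_(0 : 'rV[R]_0).

Lemma lebesgue_rV_box (R : realType) (m : nat) (A : 'I_m -> set (measurableTypeR R)) :
  (forall i, measurable (A i)) ->
  lebesgue_rV R m [set x : 'rV[R]_m | forall i, A i (x 0 i)] =
  (\prod_(i < m) lebesgue_measure (A i))%E.
Proof.
elim: m A => [|m IH] A mA /=.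
  by rewrite big_ord0 diracE mem_set// => -[].
rewrite big_ord_recl -IH//.
rewrite -product_measure1E//; last first.
  rewrite (_ : mkset _ = \bigcap_(i in setT) [set x : 'rV[R]_m | A (lift ord0 i) (x 0 i)]).
    apply: fin_bigcap_measurable => // i _.
    by have := measurable_coord i measurableT (mA (lift ord0 i)); rewrite setTI.
  by apply/seteqP; split=> [x xA i _|x xA i]; exact: xA.
rewrite /lebesgue_step /pushforward; congr (product_measure1 _ _ _).
apply/seteqP; split=> -[a v] /=.
  move=> avA; split.
    by have := avA ord0; rewrite -[rV_cons _ 0 ord0]/(rV_uncons _).1 rV_consK.
  move=> i; have := avA (lift ord0 i).
  rewrite (_ : rV_cons _ 0 _ = v 0 i)//.
  rewrite (_ : lift ord0 i = rshift 1 i :> 'I_(1 + m)); last exact/val_inj.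
  exact: row_mxEr.
move=> [aA vA] i; case: (unliftP ord0 i) => [j|] ->.
  rewrite (_ : rV_cons _ 0 _ = v 0 j)//.
  rewrite (_ : lift ord0 j = rshift 1 j :> 'I_(1 + m)); last exact/val_inj.
  exact: row_mxEr.
by rewrite -[rV_cons _ 0 ord0]/(rV_uncons _).1 rV_consK.
Qed.

Definition boundary (T : topologicalType) (A : set T) : set T :=
  closure A `\` interior A.

Definition bounded_domain (R : realType) (m : nat) (Omega : set 'rV[R]_m) : Prop :=
  [/\ open Omega, connected Omega & bounded_set Omega].

(* Regular parametrization X of a relatively open part of S; the last clause
   says that X is a homeomorphism of U onto that part (S carries the subspace
   topology). The rows of the Jacobian ['J X u] are the vectors d_i X(u). *)
Definition chart (R : realType) (n : nat) (S : set 'rV[R]_n.+1)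
    (U : set 'rV[R]_n) (X : 'rV[R]_n -> 'rV[R]_n.+1) : Prop :=
  [/\ open U,
      smooth_on U X,
      (forall u v, U u -> U v -> X u = X v -> u = v),
      (forall u, U u -> row_free ('J X u)) &
      (forall W, open W -> W `<=` U -> exists2 V, open V & X @` W = S `&` V)].

Definition smooth_closed_hypersurface (R : realType) (n : nat)
    (S : set 'rV[R]_n.+1) : Prop :=
  compact S /\ forall x, S x -> exists U X, chart S U X /\ (X @` U) x.

Definition star_shaped (R : realType) (m : nat) (O : 'rV[R]_m)
    (S : set 'rV[R]_m) : Prop :=
  exists r : 'rV[R]_m -> R,
    [/\ forall theta, unit_sphere theta -> 0 < r theta,
        smooth_on_subset (@unit_sphere R m) r &
        S = [set O + r theta *: theta | theta in @unit_sphere R m]].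

Definition tangent_space (R : realType) (n : nat) (S : set 'rV[R]_n.+1)
    (x : 'rV[R]_n.+1) : set 'rV[R]_n.+1 :=
  [set v | exists U X u, [/\ chart S U X, U u, X u = x & (v <= 'J X u)%MS]].

(* Outward unit normal of boundary Omega; junk value 0 where it does not exist. *)
Definition outward_normal (R : realType) (n : nat) (Omega : set 'rV[R]_n.+1)
    (x : 'rV[R]_n.+1) : 'rV[R]_n.+1 :=
  xget 0 [set nu | [/\ enorm nu = 1,
    (forall v, tangent_space (boundary Omega) x v -> dot nu v = 0) &
    \forall t \near (0 : R)^'+, ~ Omega (x + t *: nu)]].

(* mu is the Euclidean area measure of S, extended by 0 outside S: in every
   chart its density is the square root of the Gram determinant. Since S is
   covered by countably many charts this determines mu on the Borel sets. *)
Definition area_measure (R : realType) (n : nat) (S : set 'rV[R]_n.+1)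
    (mu : {measure set 'rV[R]_n.+1 -> \bar R}) : Prop :=
  mu (~` S) = 0%E /\
  forall U X, chart S U X -> forall A, measurable A -> A `<=` U ->
    mu (X @` A) =
    (\int[lebesgue_rV R n]_(u in A)
       (Num.sqrt (\det ('J X u *m ('J X u)^T)))%:E)%E.

Record minkowski_norm (R : realType) (m : nat) (F : 'rV[R]_m -> R) : Prop :=
  MinkowskiNorm {
    minkowski_convex : forall (t : R) (x y : 'rV[R]_m), 0 <= t <= 1 ->
      F (t *: x + (1 - t) *: y) <= t * F x + (1 - t) * F y;
    minkowski_homogeneous : forall (l : R) (x : 'rV[R]_m), 0 < l -> F (l *: x) = l * F x;
    minkowski_gt0 : forall x : 'rV[R]_m, x != 0 -> 0 < F x;
    minkowski0 : F 0 = 0;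
    minkowski_smooth : smooth_on [set x | x != 0] F;
    minkowski_hessian : forall x v : 'rV[R]_m, x != 0 -> v != 0 ->
      0 < (v *m hessian (fun y => 2^-1 * F y ^+ 2) x *m v^T) 0 0 }.

Definition dual_norm (R : realType) (m : nat) (F : 'rV[R]_m -> R)
    (x : 'rV[R]_m) : R :=
  sup [set dot x y / F y | y in [set y | y != 0]].

Definition wulff_shape (R : realType) (m : nat) (F : 'rV[R]_m -> R) : set 'rV[R]_m :=
  [set x | dual_norm F x = 1].

Definition wulff_domain (R : realType) (m : nat) (F : 'rV[R]_m -> R) : set 'rV[R]_m :=
  [set x | dual_norm F x < 1].

Definition Vol (R : realType) (m : nat) (A : set 'rV[R]_m) : R :=
  fine (lebesgue_rV R m A).

Definition aniso_gauss_map (R : realType) (n : nat) (F : 'rV[R]_n.+1 -> R)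
    (Omega : set 'rV[R]_n.+1) (x : 'rV[R]_n.+1) : 'rV[R]_n.+1 :=
  grad F (outward_normal Omega x).

(* Trace of d nu_F on T_x(boundary Omega): A is the matrix of this endomorphism
   in the basis (d_i X) of the tangent space given by a chart X, that is,
   d_i (nu_F o X) = sum_j A_ij d_j X. The trace does not depend on the chart. *)
Definition aniso_mean_curvature (R : realType) (n : nat) (F : 'rV[R]_n.+1 -> R)
    (Omega : set 'rV[R]_n.+1) (x : 'rV[R]_n.+1) : R :=
  xget 0 [set h | exists U X u (A : 'M[R]_n),
    [/\ chart (boundary Omega) U X, U u /\ X u = x,
        differentiable (aniso_gauss_map F Omega \o X) u,
        'J (aniso_gauss_map F Omega \o X) u = A *m 'J X u &
        h = \tr A]].

Definition F_mean_convex (R : realType) (n : nat) (F : 'rV[R]_n.+1 -> R)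
    (Omega : set 'rV[R]_n.+1) : Prop :=
  forall x, boundary Omega x -> 0 <= aniso_mean_curvature F Omega x.

(* Integral of f over boundary Omega with respect to d mu_F = F(nu) d mu. *)
Definition aniso_integral (R : realType) (n : nat) (F : 'rV[R]_n.+1 -> R)
    (Omega : set 'rV[R]_n.+1) (mu : {measure set 'rV[R]_n.+1 -> \bar R})
    (f : 'rV[R]_n.+1 -> R) : R :=
  \int[mu]_(x in boundary Omega) (f x * F (outward_normal Omega x)).

Definition aniso_perimeter (R : realType) (n : nat) (F : 'rV[R]_n.+1 -> R)
    (Omega : set 'rV[R]_n.+1) (mu : {measure set 'rV[R]_n.+1 -> \bar R}) : R :=
  aniso_integral F Omega mu (fun=> 1).

(* Main.v *)
(* Let rho be the gauge of Sigma, so that Omega = {rho < 1}, and put W(x) = F^0(x - P). The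
   anisotropic normal extends to the 0-homogeneous field N = DF(D rho), and F-mean convexity says
   that div N >= 0. Fix S > 0 and compare Omega with the Wulff ball {W < S}:
   - outside Omega, the divergence of (S - W)_+ N is at least -<DW, N> >= -1 on {W < S}, whence
     int_Sigma (S - W)_+ d mu_F <= Vol({W < S} \ Omega);
   - inside Omega, the divergence of (1 - S / W)_+ (x - P) is at least 1 on {W > S}, and the
     inequality <x - P, D rho> <= W F(D rho) gives
     int_Sigma (W - S)_+ d mu_F >= Vol(Omega \ {W < S}).
   Subtracting, int_Sigma W d mu_F >= S |Sigma|_F - S^(n+1) Vol(L) + Vol(Omega), and the choice
   (n+1) Vol(L) S^n = |Sigma|_F gives the inequality. If equality holds, then the second step forces
   W <= S on Omega. If {W < S} met the exterior of Omega, then the first step would force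
   N = (x - P) / W there, so div N = n / W > 0, although (S - W) div N = 0; hence Sigma = {W = S}.
   Both steps apply the divergence theorem to fields that are cut off across the thin shell
   {1 < rho < 1 + d}; as d tends to 0, the dilations show that the integrals over the shell converge
   to integrals over Sigma. *)
From HB Require Import structures.
Require Import Defs.
From mathcomp Require Import all_boot all_order all_fingroup all_algebra.
From mathcomp Require Import all_classical all_reals all_analysis.
From mathcomp Require Import measurable_realfun ring lra.

Set Implicit Arguments.
Unset Strict Implicit.
Unset Printing Implicit Defensive.

Import Order.TTheory GRing.Theory Num.Theory.
Import numFieldNormedType.Exports.

Local Open Scope classical_set_scope.
Local Open Scope ring_scope.

(** * Lebesgue measure and integrals of bounded functions on R^m *)

(** The surface enters only through its gauge. Since [rho] is 1-homogeneous, [nu_F] extends to a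
    0-homogeneous field whose divergence is [H_F] on Sigma and has degree -1: the sign of [H_F]
    spreads to the whole space, and the Wulff ball can be compared with Omega far away from Sigma.
    Homogeneity also gives the area measure, known only chart by chart, a density on the cone
    [0 < rho < 1], so that surface integrals become volume integrals. The obstacle is the divergence
    theorem on a domain with boundary. It is replaced by the fact that derivatives of compactly
    supported Lipschitz functions on the whole space have integral 0, a consequence of translation
    invariance; hence the cutoffs, which are Lipschitz but not smooth. The dual norm comes only as a
    supremum: its gradient is identified with the unique maximizer. Part of what the estimates
    discard is kept in two nonnegative defects that do not depend on the shell width; otherwise the
    limit would lose the equality case. The radius S maximizes S |Sigma|_F - S^(n+1) Vol(L), and
    this maximality also settles the converse of the equality case. *)

Lemma indic_bool (R : realType) T (b : T -> bool) (x : T) : \1_[set x | b x] x = (b x)%:R :> R.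
Proof. by rewrite indicE; have [h|h] := boolP (b x); [rewrite mem_set|rewrite memNset//; exact/negP]. Qed.

Section Measure.
Context {R : realType}.
Implicit Types (m : nat).

Definition push_measure d d' (T : measurableType d) (T' : measurableType d')
    (mu : {measure set T -> \bar R}) (f : T -> T') (mf : measurable_fun setT f) :
    {measure set T' -> \bar R} :=
  measure_function_pushforward__canonical__measure_function_Measure mu mf.

(** Both sides are measures in [A], so it suffices to compare them on half-open intervals; for
    [c < 0] the preimage is closed at the opposite end, which does not change its length. *)
Lemma lebesgue_measure_affine (c b : R) (A : set (measurableTypeR R)) :
  c != 0 -> measurable A ->
  (`|c|%:E * lebesgue_measure ((fun t : measurableTypeR R => (c * t + b)%R : measurableTypeR R) @^-1` A) = lebesgue_measure A)%E.
Proof.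
move=> c0 mA; pose T (t : measurableTypeR R) : measurableTypeR R := c * t + b.
have mT : measurable_fun setT T.
  by apply: measurable_funD => //; exact: measurable_funM.
have c1 : 0 < `|c| by rewrite normr_gt0.
pose nu' : {measure set (measurableTypeR R) -> \bar R} :=
  mscale (NngNum (normr_ge0 c)) (push_measure lebesgue_measure mT).
rewrite -[LHS]/(nu' A); apply/esym; apply: (@lebesgue_measure_unique _ nu') => // X [[x y] _ <-] /=.
rewrite /nu' /= /mscale /= /pushforward.
have [cp|cn] : c < 0 \/ 0 < c by apply/orP; rewrite -neq_lt.
  rewrite (_ : T @^-1` _ = `[(y - b) / c, (x - b) / c[%classic).
    rewrite !lebesgue_measure_itv/= !lte_fin ltr_ndivrMr// divfK// ltrD2r.
    case: ifP => // _; last by rewrite mule0.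
    rewrite -!EFinD -EFinM; congr EFin; rewrite ltr0_norm//.
    by field.
  apply/seteqP; split=> t /=; rewrite /T !in_itv/= ler_ndivrMr// ltr_ndivlMr//.
    by move=> /andP[? ?]; apply/andP; split; rewrite ?lerBrDr ?ltrBlDr ?lerBlDr ?ltrBrDr mulrC.
  by rewrite ?lerBrDr ?ltrBlDr ?lerBlDr ?ltrBrDr mulrC andbC.
rewrite (_ : T @^-1` _ = `](x - b) / c, (y - b) / c]%classic).
  rewrite !lebesgue_measure_itv/= !lte_fin ltr_pdivrMr// divfK// ltrD2r.
  case: ifP => // _; last by rewrite mule0.
  rewrite -!EFinD -EFinM; congr EFin; rewrite gtr0_norm//.
  by field.
apply/seteqP; split=> t /=; rewrite /T !in_itv/= ltr_pdivrMr// ler_pdivlMr//.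
  by rewrite ?lerBrDr ?ltrBlDr ?lerBlDr ?ltrBrDr mulrC.
by rewrite ?lerBrDr ?ltrBlDr ?lerBlDr ?ltrBrDr mulrC.
Qed.

Definition boxes m : set (set 'rV[R]_m) :=
  [set B | exists2 A : 'I_m -> set (measurableTypeR R),
     (forall i, measurable (A i)) & B = [set x : 'rV[R]_m | forall i, A i (x 0 i)]].

Lemma measurable_box m (A : 'I_m -> set (measurableTypeR R)) :
  (forall i, measurable (A i)) -> measurable [set x : 'rV[R]_m | forall i, A i (x 0 i)].
Proof.
move=> mA; rewrite (_ : mkset _ = \bigcap_(i in setT) [set x : 'rV[R]_m | A i (x 0 i)]).
  apply: fin_bigcap_measurable => // i _.
  by have := measurable_coord i measurableT (mA i); rewrite setTI.
by apply/seteqP; split=> [x xA i _|x xA i]; exact: xA.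
Qed.

Lemma measurable_boxes m : (measurable : set (set 'rV[R]_m)) = <<s @boxes m >>.
Proof.
apply/seteqP; split; last first.
  apply: smallest_sub; first exact: sigma_algebra_measurable.
  by move=> B [A mA ->]; exact: measurable_box.
apply: smallest_sub; first exact: smallest_sigma_algebra.
rewrite -bigcup_seq => B [i _ [C mC <-]]; apply: sub_sigma_algebra.
exists (fun j => if j == i then C else setT).
  by move=> j; case: ifP.
rewrite setTI; apply/seteqP; split => [x /= Cx j|x /(_ i)]/=.
  by case: eqP => // ->.
by rewrite eqxx.
Qed.

(** Measurable boxes form a pi-system that generates the sigma-algebra, and the cubes [[-k, k]^m]
    exhaust the space with finite measure. *)
Lemma lebesgue_rV_unique m (nu : {measure set 'rV[R]_m -> \bar R}) :
  (forall A : 'I_m -> set (measurableTypeR R), (forall i, measurable (A i)) ->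
    nu [set x : 'rV[R]_m | forall i, A i (x 0 i)] =
    (\prod_(i < m) lebesgue_measure (A i))%E) ->
  forall B, measurable B -> lebesgue_rV R m B = nu B.
Proof.
move=> H B mB.
apply: (measure_unique (@boxes m)
  (fun k => [set x : 'rV[R]_m | forall i, `[- k%:R, k%:R]%classic (x 0 i)])) => //.
- exact: measurable_boxes.
- move=> _ _ [A1 mA1 ->] [A2 mA2 ->]; exists (fun i => A1 i `&` A2 i).
    by move=> i; exact: measurableI.
  by apply/seteqP; split=> [x [h1 h2] i|x h]; split => // i; case: (h i).
- by move=> k; exists (fun=> `[- k%:R, k%:R]%classic).
- apply/seteqP; split=> // x _.
  exists (Num.truncn `|x|).+1 => //= i; rewrite in_itv/= -ler_norml.
  apply: (@le_trans _ _ `|x|); last by rewrite ltW// truncnS_gt.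
  by rewrite [leRHS]/Num.norm/= mx_normrE (le_bigmax _ _ (0, i)).
- by move=> _ [A1 mA1 ->]; rewrite H//; exact: lebesgue_rV_box.
- move=> k; rewrite [ltLHS](_ : _ = \prod_(i < m) lebesgue_measure (`[(- k%:R)%R, k%:R%R]%classic : set (measurableTypeR R)))%E; last first.
    by apply: (@lebesgue_rV_box R m (fun=> `[- k%:R, k%:R]%classic)).
  rewrite -ge0_fin_numE; last by apply: prode_ge0 => i _; exact: measure_ge0.
  apply: prode_fin_num => i _.
  by rewrite lebesgue_measure_itv/=; case: ifP.
Qed.

(** Dilations, translations and permutations of coordinates map boxes to boxes, so their effect on
    Lebesgue measure follows from uniqueness on boxes. They serve difference quotients
    (translations), homogeneity (dilations) and charts (signed transpositions). *)
Definition aff m (c : R) (b : 'rV[R]_m) (s : {perm 'I_m}) (x : 'rV[R]_m) : 'rV[R]_m :=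
  \row_i (c * x 0 (s i) + b 0 i).

Lemma measurable_aff m (c : R) (b : 'rV[R]_m) s : measurable_fun setT (aff c b s).
Proof.
apply: measurable_fun_rV => i.
rewrite (_ : (fun _ => _) = (fun x : 'rV[R]_m => c * x 0 (s i) + b 0 i)); last first.
  by apply/funext => x; rewrite mxE.
by apply: measurable_funD => //; apply: measurable_funM => //; exact: measurable_coord.
Qed.

Lemma lebesgue_rV_aff m (c : R) (b : 'rV[R]_m) s A : c != 0 -> measurable A ->
  ((`|c| ^+ m)%:E * lebesgue_rV R m (aff c b s @^-1` A) = lebesgue_rV R m A)%E.
Proof.
move=> c0 mA.
have cm0 : 0 <= `|c| ^+ m by rewrite exprn_ge0.
pose nu : {measure set 'rV[R]_m -> \bar R} :=
  mscale (NngNum cm0) (push_measure (lebesgue_rV R m) (measurable_aff c b s)).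
rewrite -[LHS]/(nu A); apply/esym/(@lebesgue_rV_unique m nu) => // {}A {}mA.
rewrite -[LHS]/((`|c| ^+ m)%:E * lebesgue_rV R m (aff c b s @^-1` [set x : 'rV[R]_m | forall i, A i (x ord0 i)]))%E.
pose A' (j : 'I_m) := (fun t : measurableTypeR R => (c * t + b 0 ((s^-1)%g j))%R : measurableTypeR R) @^-1` (A ((s^-1)%g j)).
rewrite (_ : aff c b s @^-1` _ = [set x : 'rV[R]_m | forall i, A' i (x 0 i)]); last first.
  apply/seteqP; split=> x /= h i.
    by have := h ((s^-1)%g i); rewrite /A' mxE permKV.
  by have := h (s i); rewrite /A' mxE/= permK.
have mA' i : measurable (A' i).
  rewrite -[A' i]setTI; suff : measurable_fun setT (fun t : measurableTypeR R => (c * t + b 0 ((s^-1)%g i))%R : measurableTypeR R) by exact.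
  by apply: measurable_funD => //; exact: measurable_funM.
rewrite lebesgue_rV_box// (reindex_inj (@perm_inj _ s))/=.
have -> : (`|c| ^+ m)%:E = (\prod_(i < m) `|c|%:E)%E.
  elim: (m) => [|k IH]; first by rewrite big_ord0.
  by rewrite big_ord_recl -IH exprS EFinM.
rewrite -big_split/=; apply: eq_bigr => i _; rewrite /A' permK.
exact: lebesgue_measure_affine.
Qed.

Lemma normrV_lt m (x : 'rV[R]_m) e : 0 < e -> (`|x| < e) = [forall i, `|x 0 i| < e].
Proof.
move=> e0; rewrite [ltLHS]/Num.norm/= mx_normrE; apply/idP/forallP => [h i|h].
  by apply: le_lt_trans h; apply: (le_bigmax _ _ (0, i)).
by apply/bigmax_ltP; split=> // -[i j] _ /=; rewrite ord1.
Qed.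

Lemma normrV_le m (x : 'rV[R]_m) e : 0 <= e -> (forall i, `|x 0 i| <= e) -> `|x| <= e.
Proof.
move=> e0 h; rewrite [leLHS]/Num.norm/= mx_normrE.
by apply/bigmax_leP; split=> // -[i j] _ /=; rewrite ord1.
Qed.

Lemma normrV_coord m (x : 'rV[R]_m) i : `|x 0 i| <= `|x|.
Proof. by rewrite [leRHS]/Num.norm/= mx_normrE; apply: (le_bigmax _ _ (0, i)). Qed.

(** The sigma-algebra is generated by the coordinates, so an open set is written as a countable
    union of cubes with rational centres and radii [1 / (k + 1)]. *)
Lemma open_measurable_rV m (A : set 'rV[R]_m) : open A -> measurable A.
Proof.
move=> oA.
pose B (p : 'rV[rat]_m * nat) : set 'rV[R]_m :=
  [set x : 'rV[R]_m | forall i, ball (ratr (p.1 0 i) : R) (p.2.+1%:R^-1) (x 0 i)].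
have -> : A = \bigcup_(p in [set p | B p `<=` A]) B p.
  apply/seteqP; split; last by move=> x [p /= pA]; exact: pA.
  move=> x Ax; have /nbhs_ballP[e /= e0 eA] := oA _ Ax.
  have [k ke] : exists k, k.+1%:R^-1 < e / 2.
    exists (Num.truncn (e / 2)^-1); rewrite invf_plt ?posrE ?divr_gt0//.
    exact: truncnS_gt.
  have k0 : (0 : R) < k.+1%:R^-1 by rewrite invr_gt0.
  have q_ i : exists q, ball (ratr q : R) k.+1%:R^-1 (x 0 i).
    have /rat_in_itvoo[q] : x 0 i - k.+1%:R^-1 < x 0 i + k.+1%:R^-1 by rewrite ltrD2l gtrN.
    by rewrite in_itv/= -ltr_distl => ?; exists q; rewrite /ball/= .
  pose q := fun i => sval (cid (q_ i)).
  have hq i : ball (ratr (q i) : R) k.+1%:R^-1 (x 0 i) by rewrite /q; case: cid.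
  exists (\row_i q i, k) => /=; last by move=> i /=; rewrite mxE.
  move=> y; rewrite /B/= => By; apply: eA.
  rewrite -ball_normE/= normrV_lt//; apply/forallP => i; rewrite !mxE.
  have := By i; rewrite mxE -ball_normE/= => h1.
  have := hq i; rewrite -ball_normE/= => h2.
  rewrite -(subrK (ratr (q i)) (x 0 i)) -addrA (le_lt_trans (ler_normD _ _))//.
  rewrite (splitr e) ltrD// ?(lt_trans _ ke)//; first by rewrite distrC.
rewrite bigcup_mkcond; apply: countable_bigcupT_measurable; first exact: countableP.
move=> p; case: ifP => // _; apply: (@measurable_box m (fun i => ball (ratr (p.1 0 i) : R) (p.2.+1%:R^-1))).
by move=> i; exact: measurable_ball.
Qed.

Lemma closed_measurable_rV m (A : set 'rV[R]_m) : closed A -> measurable A.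
Proof.
by move=> cA; have := measurableC (open_measurable_rV (closed_openC cA)); rewrite setCK.
Qed.

Lemma open_continuous_measurable_rV m (D : set 'rV[R]_m) (f : 'rV[R]_m -> R) :
  open D -> (forall x, D x -> {for x, continuous f}) -> measurable_fun D f.
Proof.
move=> oD cf; apply: (measurability _ (RGenOInfty.measurableE R)).
move=> /= _ [_ [a ->]] <-; apply: open_measurable_rV.
rewrite openE => x [Dx /= fxa]; rewrite /interior.
apply: filterI; first exact: oD.
have := cf _ Dx; apply; apply: open_nbhs_nbhs; split => //.
Qed.

Lemma continuous_measurable_rV m (f : 'rV[R]_m -> R) :
  continuous f -> measurable_fun setT f.
Proof. by move=> cf; apply: open_continuous_measurable_rV; [exact: openT|move=> x _; exact: cf]. Qed.

(** Made for homogeneous functions and their gradients: continuity may fail at one point, and any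
    value there is harmless for measurability. *)
Lemma measurable_fun_off m (p : 'rV[R]_m) (f : 'rV[R]_m -> R) :
  (forall x, x != p -> {for x, continuous f}) -> measurable_fun setT f.
Proof.
move=> cf.
have cp : closed [set p] by exact/accessible_closed_set1/hausdorff_accessible/norm_hausdorff.
have c1 : measurable [set p].
  exact: closed_measurable_rV.
rewrite -(setvU [set p]) -[~` [set p]]setCK; apply/measurable_funU => //.
  by rewrite setCK; exact: measurableC.
rewrite setCK; split; last exact: measurable_fun_set1.
by apply: open_continuous_measurable_rV; [exact: closed_openC|move=> x /= /eqP; exact: cf].
Qed.

Lemma lebesgue_rV_bounded m (A : set 'rV[R]_m) M : measurable A ->
  (forall x, A x -> `|x| <= M) -> (lebesgue_rV R m A < +oo)%E.
Proof.
move=> mA AM.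
pose B := [set x : 'rV[R]_m | forall i, (`[(- M)%R, M]%classic : set (measurableTypeR R)) (x 0 i)].
apply: (@le_lt_trans _ _ (lebesgue_rV R m B)).
  have mB : measurable B by apply: (@measurable_box m (fun=> `[(- M)%R, M]%classic)).
  apply: le_measure; rewrite ?inE//.
  move=> x /AM xM i /=; rewrite in_itv/= -ler_norml; apply: le_trans xM.
  exact: normrV_coord.
rewrite [ltLHS](_ : _ = \prod_(i < m) lebesgue_measure (`[(- M)%R, M]%classic : set (measurableTypeR R)))%E; last first.
  by apply: (@lebesgue_rV_box R m (fun=> `[(- M)%R, M]%classic)).
rewrite -ge0_fin_numE; last by apply: prode_ge0 => i _; exact: measure_ge0.
apply: prode_fin_num => i _.
by rewrite lebesgue_measure_itv/=; case: ifP.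
Qed.

(** Measurable, bounded and of bounded support: on this class [Int] is linear and monotone without
    separate integrability conditions. A single [M] bounds both the values and the support. *)
Definition bmeas m (f : 'rV[R]_m -> R) := measurable_fun setT f /\
  exists M : R, (forall x, `|f x| <= M) /\ (forall x, M < `|x| -> f x = 0).

Definition Int m (f : 'rV[R]_m -> R) : R := \int[lebesgue_rV R m]_x f x.

Lemma bmeas_integrable m (f : 'rV[R]_m -> R) : bmeas f ->
  (lebesgue_rV R m).-integrable setT (EFin \o f).
Proof.
move=> [mf [M [fM f0]]].
pose B := [set x : 'rV[R]_m | `|x| <= M].
have mB : measurable B.
  apply: closed_measurable_rV; apply: (@closed_comp _ _ (fun x : 'rV[R]_m => `|x|) [set t | t <= M]).
    by move=> x _; exact: norm_continuous.
  exact: closed_le.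
have fB : EFin \o f = (EFin \o f) \_ B.
  apply/funext => x; rewrite /restrict; case: ifPn => //; rewrite notin_setE /B/= => /negP.
  by rewrite -ltNge => /f0 ->.
rewrite fB; apply/(integrable_mkcond _ mB) => //.
apply: measurable_bounded_integrable => //.
- exact: (@lebesgue_rV_bounded m B M).
- exact: measurable_funTS.
- exists M; split; first exact: num_real.
  by move=> M' MM' x _; apply: le_trans (ltW MM').
Qed.

Lemma ge0_integral_aff m (c : R) (b : 'rV[R]_m) s (f : 'rV[R]_m -> \bar R) : c != 0 ->
  measurable_fun setT f -> (forall x, 0 <= f x)%E ->
  (\int[lebesgue_rV R m]_x f x = (`|c| ^+ m)%:E * \int[lebesgue_rV R m]_x f (aff c b s x))%E.
Proof.
move=> c0 mf f0.
have cm0 : 0 <= `|c| ^+ m by rewrite exprn_ge0.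
pose nu : {measure set 'rV[R]_m -> \bar R} :=
  mscale (NngNum cm0) (push_measure (lebesgue_rV R m) (measurable_aff c b s)).
transitivity (\int[nu]_x f x)%E.
  apply: eq_measure_integral => A mA _; apply/esym; exact: lebesgue_rV_aff.
rewrite ge0_integral_mscale//=; congr (_ * _)%E.
rewrite ge0_integral_pushforward//; exact: measurable_aff.
Qed.

Lemma Int_aff m (c : R) (b : 'rV[R]_m) s f : c != 0 -> bmeas f ->
  bmeas (f \o aff c b s) /\ Int f = `|c| ^+ m * Int (f \o aff c b s).
Proof.
move=> c0 [mf [M [fM f0]]]; have c1 : 0 < `|c| by rewrite normr_gt0.
have bT : bmeas (f \o aff c b s).
  split; first by apply: measurableT_comp => //; exact: measurable_aff.
  exists (M + (M + `|b|) / `|c|); split=> x.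
    apply: le_trans (fM _) _; rewrite lerDl divr_ge0// addr_ge0//.
    exact: le_trans (fM 0).
  move=> h; apply: f0; rewrite ltNge; apply/negP => h'.
  have : `|x| <= (M + `|b|) / `|c|.
    apply: normrV_le => [|j].
      by rewrite divr_ge0// addr_ge0// (le_trans _ h').
    rewrite ler_pdivlMr// mulrC -normrM.
    have -> : c * x 0 j = aff c b s x 0 ((s^-1)%g j) - b 0 ((s^-1)%g j).
      by rewrite mxE permKV addrK.
    by rewrite (le_trans (ler_normB _ _))// lerD// ?(le_trans _ h')//; exact: normrV_coord.
  rewrite leNgt => /negP; apply; apply: le_lt_trans h.
  by rewrite lerDr (le_trans _ (fM 0)).
split=> //.
have iT := bmeas_integrable bT.
have if_ : (lebesgue_rV R m).-integrable setT (EFin \o f) by apply: bmeas_integrable; split => //; exists M.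
have mff : measurable_fun setT (EFin \o f) by exact/measurable_EFinP.
rewrite /Int /Rintegral.
rewrite [in LHS]integralE [in RHS]integralE.
rewrite (@ge0_integral_aff m c b s _ c0 (measurable_funepos mff))//.
rewrite (@ge0_integral_aff m c b s _ c0 (measurable_funeneg mff))//.
have fp : (\int[lebesgue_rV R m]_x (EFin \o f)^\+ (aff c b s x))%E \is a fin_num.
  apply: (integrable_fin_num measurableT).
  by have := integrable_funepos measurableT iT; rewrite compA funepos_comp.
have fn : (\int[lebesgue_rV R m]_x (EFin \o f)^\- (aff c b s x))%E \is a fin_num.
  apply: (integrable_fin_num measurableT).
  by have := integrable_funeneg measurableT iT; rewrite compA funeneg_comp.
rewrite [X in _ = _ * fine (X - _)](_ : _ = \int[lebesgue_rV R m]_x (EFin \o f)^\+ (aff c b s x))%E; last first.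
  by rewrite -[(fun _ => ((f \o _) _)%:E)]/((EFin \o f) \o aff c b s) funepos_comp.
rewrite [X in _ = _ * fine (_ - X)](_ : _ = \int[lebesgue_rV R m]_x (EFin \o f)^\- (aff c b s x))%E; last first.
  by rewrite -[(fun _ => ((f \o _) _)%:E)]/((EFin \o f) \o aff c b s) funeneg_comp.
rewrite -(fineK fp) -(fineK fn) -!EFinM -!EFinB /=.
by rewrite mulrBr.
Qed.

Lemma bmeasD m (f g : 'rV[R]_m -> R) : bmeas f -> bmeas g -> bmeas (fun x => f x + g x).
Proof.
move=> [mf [M [fM f0]]] [mg [K [gK g0]]]; split; first exact: measurable_funD.
have M0 : 0 <= M by apply: le_trans (fM 0).
have K0 : 0 <= K by apply: le_trans (gK 0).
exists (M + K); split=> x.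
  by rewrite (le_trans (ler_normD _ _))// lerD.
by move=> h; rewrite f0 ?g0 ?addr0// (le_lt_trans _ h)// ?lerDl ?lerDr.
Qed.

Lemma bmeasM m (f g : 'rV[R]_m -> R) : bmeas f -> measurable_fun setT g ->
  (exists K, forall x, f x != 0 -> `|g x| <= K) -> bmeas (fun x => f x * g x).
Proof.
move=> [mf [M [fM f0]]] mg [K gK]; split; first exact: measurable_funM.
have M0 : 0 <= M by apply: le_trans (fM 0).
exists (M + M * `|K|); split=> x.
  have [->|fx] := eqVneq (f x) 0; first by rewrite mul0r normr0 addr_ge0// mulr_ge0.
  rewrite normrM (@le_trans _ _ (M * `|K|))// ?lerDr// ler_pM//.
  by rewrite (le_trans (gK _ fx))// ler_norm.
by move=> h; rewrite f0 ?mul0r// (le_lt_trans _ h)// lerDl mulr_ge0.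
Qed.

Lemma bmeas0 m : bmeas (fun _ : 'rV[R]_m => 0).
Proof. by split => //; exists 0; split => // x; rewrite normr0. Qed.

Lemma bmeasZ m (c : R) (f : 'rV[R]_m -> R) : bmeas f -> bmeas (fun x => c * f x).
Proof.
move=> bf; have -> : (fun x => c * f x) = (fun x => f x * c) by apply/funext => x; rewrite mulrC.
by apply: bmeasM => //; exists `|c|.
Qed.

Lemma bmeasB m (f g : 'rV[R]_m -> R) : bmeas f -> bmeas g -> bmeas (fun x => f x - g x).
Proof.
move=> bf /(@bmeasZ _ (-1)) bg; have := bmeasD bf bg.
by under eq_fun do rewrite mulN1r.
Qed.

Lemma bmeas_sum m (J : Type) (r : seq J) (f : J -> 'rV[R]_m -> R) :
  (forall j, bmeas (f j)) -> bmeas (fun x => \sum_(j <- r) f j x).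
Proof.
move=> bf; elim: r => [|j r IH].
  by under eq_fun do rewrite big_nil; exact: bmeas0.
by under eq_fun do rewrite big_cons; exact: bmeasD.
Qed.

Lemma IntD m (f g : 'rV[R]_m -> R) : bmeas f -> bmeas g ->
  Int (fun x => f x + g x) = Int f + Int g.
Proof. by move=> bf bg; rewrite /Int RintegralD//; exact: bmeas_integrable. Qed.

Lemma IntZ m (c : R) (f : 'rV[R]_m -> R) : bmeas f -> Int (fun x => c * f x) = c * Int f.
Proof. by move=> bf; rewrite /Int RintegralZl//; exact: bmeas_integrable. Qed.

Lemma IntB m (f g : 'rV[R]_m -> R) : bmeas f -> bmeas g ->
  Int (fun x => f x - g x) = Int f - Int g.
Proof. by move=> bf bg; rewrite /Int RintegralB//; exact: bmeas_integrable. Qed.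

Lemma Int0 m : Int (fun _ : 'rV[R]_m => 0) = 0.
Proof. by rewrite /Int /Rintegral integral0. Qed.

Lemma Int_sum m (J : Type) (r : seq J) (f : J -> 'rV[R]_m -> R) :
  (forall j, bmeas (f j)) -> Int (fun x => \sum_(j <- r) f j x) = \sum_(j <- r) Int (f j).
Proof.
move=> bf; elim: r => [|j r IH].
  by rewrite big_nil; under eq_fun do rewrite big_nil; exact: Int0.
under eq_fun do rewrite big_cons.
by rewrite IntD ?IH ?big_cons//; exact: bmeas_sum.
Qed.

Lemma le_Int m (f g : 'rV[R]_m -> R) : bmeas f -> bmeas g ->
  (forall x, f x <= g x) -> Int f <= Int g.
Proof. by move=> bf bg fg; apply: le_Rintegral => //; exact: bmeas_integrable. Qed.

Lemma Int_ge0 m (f : 'rV[R]_m -> R) : (forall x, 0 <= f x) -> 0 <= Int f.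
Proof. by move=> f0; apply: Rintegral_ge0. Qed.

Lemma bmeas_indic m (A : set 'rV[R]_m) : measurable A -> bounded_set A -> bmeas (\1_A : 'rV[R]_m -> R).
Proof.
move=> mA bA; have [M M0 AM] := ex_strict_bound_gt0 bA.
split; first exact: measurable_indic.
exists (M + 1); split=> x.
  by rewrite indicE; case: (_ \in _); rewrite ?normr1 ?normr0 ?lerDr ?addr_ge0 ?ltW.
move=> h; rewrite indicE; case: (boolP (x \in A)) => //; rewrite inE => /AM.
by move=> /(lt_trans h); rewrite ltNge lerDl ler01.
Qed.

Lemma Int_indic m (A : set 'rV[R]_m) : measurable A -> Int (\1_A : 'rV[R]_m -> R) = Vol A.
Proof. by move=> mA; rewrite /Int /Rintegral integral_indic// setIT. Qed.

(** Dominated convergence with majorant [M] on the ball of radius [M]; pointwise convergence may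
    fail on the null set [N]. *)
Lemma Int_cvg m (f : nat -> 'rV[R]_m -> R) (g : 'rV[R]_m -> R) (M : R) (N : set 'rV[R]_m) :
  (forall k, measurable_fun setT (f k)) -> measurable_fun setT g ->
  (forall k x, `|f k x| <= M) -> (forall k x, M < `|x| -> f k x = 0) ->
  measurable N -> lebesgue_rV R m N = 0%E ->
  (forall x, ~ N x -> f ^~ x @ \oo --> g x) ->
  (fun k => Int (f k)) @ \oo --> Int g.
Proof.
move=> mf mg fM f0 mN N0 fg.
pose h (x : 'rV[R]_m) : R := M * \1_[set x : 'rV[R]_m | `|x| <= M] x.
have cB : closed [set x : 'rV[R]_m | `|x| <= M].
  apply: (@closed_comp _ _ (fun x : 'rV[R]_m => `|x|) [set t | t <= M]).
    by move=> x _; exact: norm_continuous.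
  exact: closed_le.
have bh : bmeas h.
  apply/bmeasZ/bmeas_indic; first exact: closed_measurable_rV.
  by exists M; split; [exact: num_real|move=> M' MM' x /= xM; rewrite (le_trans xM)// ltW].
have ih := bmeas_integrable bh.
have [|||||] := @dominated_convergence _ _ _ (lebesgue_rV R m) setT measurableT
  (fun k => EFin \o f k) (EFin \o g) (EFin \o h) => //.
- by move=> k; exact/measurable_EFinP.
- exact/measurable_EFinP.
- exists N; split => // x /= H; apply: contrapT => /fg xN; apply: H => _.
  by apply: cvg_EFin => //; exact: nearW.
- apply: aeW => x k _ /=; rewrite lee_fin /h indicE.
  have [xM|xM] := leP `|x| M; first by rewrite mem_set// mulr1.
  rewrite f0// normr0 memNset ?mulr0//=; by apply/negP; rewrite -ltNge.
move=> ig _ H; apply: fine_cvg; rewrite fineK//.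
exact: (integrable_fin_num measurableT ig).
Qed.

End Measure.

(** * Functions of class C^k, locally Lipschitz functions and vanishing integrals of derivatives *)

Lemma open_sublevel (R : realType) (T : topologicalType) (f : T -> R) (c : R) :
  continuous f -> open [set x | f x < c].
Proof.
by move=> cf; apply: (@open_comp _ _ f [set t | t < c]); [move=> x _; exact: cf|exact: open_lt].
Qed.

Lemma open_superlevel (R : realType) (T : topologicalType) (f : T -> R) (c : R) :
  continuous f -> open [set x | c < f x].
Proof.
by move=> cf; apply: (@open_comp _ _ f [set t | c < t]); [move=> x _; exact: cf|exact: open_gt].
Qed.

Section Calculus.
Context {R : realType}.
Implicit Types (m p : nat).

(** Turns directional derivatives into derivatives of a function of one real variable, to which the
    mean value theorem and the chain rule apply. *)
Lemma is_derive_line (V W : normedModType R) (f : V -> W) (p v : V) t d :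
  is_derive (p + t *: v) v f d <-> is_derive t 1 (fun s : R => f (p + s *: v)) d.
Proof.
suff E : (fun h : R => h^-1 *: ((f \o shift (p + t *: v)) (h *: v) - f (p + t *: v))) =
    (fun h : R => h^-1 *: (((fun s : R => f (p + s *: v)) \o shift t) (h *: (1 : R)) - f (p + t *: v))).
  split=> -[D1 D2]; split; move: D1 D2; rewrite /derivable /derive E//.
by apply/funext => h /=; rewrite [h *: 1]mulr1 addrCA -scalerDl.
Qed.

(* Along a path parallel to the coordinate axes; balls for the sup norm are cubes. *)
Lemma cube_mean_value m (f : 'rV[R]_m -> R) (x0 : 'rV[R]_m) (r eps : R) (a : 'I_m -> R) :
  (forall (i : 'I_m) (y : 'rV[R]_m), ball x0 r y -> derivable f y (delta_mx 0 i)) ->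
  (forall (i : 'I_m) (y : 'rV[R]_m), ball x0 r y -> `|'D_(delta_mx 0 i) f y - a i| <= eps) ->
  forall y z : 'rV[R]_m, ball x0 r y -> ball x0 r z ->
    `|f y - f z - \sum_i (y 0 i - z 0 i) * a i| <= m%:R * eps * `|y - z|.
Proof.
move=> df Df y z By Bz.
have r0 : 0 < r by case: By.
have B_coord (p : 'rV[R]_m) : ball x0 r p <-> forall i, `|x0 0 i - p 0 i| < r.
  rewrite -ball_normE/= normrV_lt//; split=> [/forallP h i|h]; last apply/forallP => i; rewrite ?mxE//.
  by have := h i; rewrite !mxE.
move/B_coord in By; move/B_coord in Bz.
pose w (k : nat) : 'rV[R]_m := \row_i (if (i < k)%N then y 0 i else z 0 i).
have Bw k : ball x0 r (w k) by apply/B_coord => i; rewrite mxE; case: ifP.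
have step (k : 'I_m) : `|f (w k.+1) - f (w k) - (y 0 k - z 0 k) * a k| <= eps * `|y - z|.
  pose e : 'rV[R]_m := delta_mx 0 k.
  pose s := y 0 k - z 0 k.
  have wE : w k.+1 = w k + s *: e.
    apply/rowP => i; rewrite !mxE eqxx/= ltnS.
    have [->|ik] := eqVneq i k; first by rewrite leqnn ltnn mulr1 /s addrC subrK.
    by rewrite leq_eqVlt -[_ == _ :> nat]/(i == k) (negbTE ik)/= mulr0 addr0.
  have Bl (t : R) : (t \in `[Num.min 0 s, Num.max 0 s]%R) -> ball x0 r (w k + t *: e).
    rewrite in_itv/= => tI; apply/B_coord => i; rewrite !mxE eqxx/=.
    have [->|ik] := eqVneq i k; last first.
      by rewrite mulr0 addr0; case: ifP => _.
    rewrite ltnn mulr1.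
    have := By k; have := Bz k; rewrite !ltr_distl => /andP[? ?] /andP[? ?].
    move: tI; rewrite /s; case: (leP 0 (y 0 k - z 0 k)) => _ /andP[? ?].
      apply/andP; split; lra.
    apply/andP; split; lra.
  pose g t := f (w k + t *: e).
  have gd (t : R) : t \in `[Num.min 0 s, Num.max 0 s]%R -> is_derive t 1 g ('D_e f (w k + t *: e)).
    by move=> /Bl Bt; apply: (proj1 (is_derive_line f (w k) e t _)); apply: derivableP; exact: df.
  have gc : {within `[Num.min 0 s, Num.max 0 s], continuous g}.
    by apply: derivable_within_continuous => t /gd [].
  have g0 : g 0 = f (w k) by rewrite /g scale0r addr0.
  have gs : g s = f (w k.+1) by rewrite /g wE.
  have [c cI gE] : exists2 c, c \in `[Num.min 0 s, Num.max 0 s]%R & g s - g 0 = 'D_e f (w k + c *: e) * s.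
    have [c cI gE] := @MVT_segment _ g (fun t => 'D_e f (w k + t *: e)) (Num.min 0 s) (Num.max 0 s)
      (ltac:(by rewrite ge_min le_max lexx)) (ltac:(by move=> t tI; apply: gd; apply: subset_itvW tI)) gc.
    exists c => //; move: gE; case: leP => _; first by rewrite subr0.
    by rewrite sub0r mulrN => /(congr1 -%R); rewrite opprB opprK.
  rewrite -gs -g0 gE mulrC -mulrBr normrM mulrC ler_pM//.
    by apply: Df; exact: Bl.
  by have := normrV_coord (y - z) k; rewrite !mxE.
have -> : f y - f z = \sum_(k < m) (f (w k.+1) - f (w k)).
  rewrite -(big_mkord xpredT (fun k => f (w k.+1) - f (w k))) telescope_sumr//.
  by congr (f _ - f _); apply/rowP => i; rewrite mxE ?ltn_ord.
rewrite -sumrB (le_trans (ler_norm_sum _ _ _))//.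
apply: le_trans (ler_sum _ (fun k _ => step k)) _.
by rewrite sumr_const card_ord -[leLHS]mulr_natl mulrA.
Qed.

Lemma continuous_sumR (T : topologicalType) (J : Type) (r : seq J) (F : J -> T -> R) (x : T) :
  (forall j, {for x, continuous (F j)}) -> {for x, continuous (fun y => \sum_(j <- r) F j y)}.
Proof.
move=> cF; elim: r => [|j r IH].
  have -> : (fun y => \sum_(j <- [::]) F j y) = cst 0 by apply/funext => y; rewrite big_nil.
  exact: cst_continuous.
have -> : (fun y => \sum_(j <- j :: r) F j y) = F j \+ (fun y => \sum_(j <- r) F j y).
  by apply/funext => y; rewrite big_cons.
exact: continuousD.
Qed.

Definition dform m (a : 'I_m -> R) (v : 'rV[R]_m) : R := \sum_i v 0 i * a i.

Lemma dform_is_linear m (a : 'I_m -> R) : linear (dform a).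
Proof.
move=> c u v; rewrite /dform scaler_sumr -big_split; apply: eq_bigr => i _ /=.
by rewrite !mxE mulrDl -mulrA.
Qed.

HB.instance Definition _ m (a : 'I_m -> R) :=
  GRing.isLinear.Build R 'rV[R]_m R _ (dform a) (dform_is_linear a).

Lemma dform_continuous m (a : 'I_m -> R) : continuous (dform a).
Proof.
move=> x; apply: (@continuous_sumR _ _ _ (fun i (v : 'rV[R]_m) => v 0 i * a i)) => i.
by apply: continuousM; [exact: coord_continuous|exact: cst_continuous].
Qed.

Lemma C1_differentiable m (f : 'rV[R]_m -> R) (x : 'rV[R]_m) :
  (forall i : 'I_m, \forall y \near x, derivable f y (delta_mx 0 i)) ->
  (forall i : 'I_m, {for x, continuous ('D_(delta_mx 0 i) f)}) ->
  differentiable f x /\ forall v, 'd f x v = \sum_i v 0 i * 'D_(delta_mx 0 i) f x.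
Proof.
move=> df cf.
pose a (i : 'I_m) : R := 'D_(delta_mx 0 i) f x.
have H : (f : 'rV[R]_m -> R^o) \o shift x = cst (f x : R^o) + (dform a : 'rV[R]_m -> R^o) +o_ (0 : 'rV[R]_m) id.
  apply/eqaddoP => _/posnumP[e].
  (* Dividing by [m + 1] absorbs the factor [m] of [cube_mean_value], also when [m = 0]. *)
  have e1 : 0 < e%:num / m.+1%:R by rewrite divr_gt0.
  have : \forall y \near x, forall i : 'I_m, derivable f y (delta_mx 0 i) /\
      `|'D_(delta_mx 0 i) f y - a i| <= e%:num / m.+1%:R.
    apply: (@filter_forall _ _ _ (nbhs x) _) => i; apply: filterI; first exact: df.
    have /cvgrPdist_le/(_ _ e1) := cf i.
    by apply: filterS => y; rewrite distrC.
  move=> /nbhs_ballP[r /= r0 rH].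
  have H0 : nbhs (0 : 'rV[R]_m) [set h : 'rV[R]_m | `|h| < r].
    by apply/nbhs_ballP; exists r => // h; rewrite -ball_normE /= sub0r normrN.
  apply: filterS H0 => h /= hr.
  have Bh : ball x r (h + x).
    by rewrite -ball_normE/= opprD addrCA subrr addr0 normrN.
  have := @cube_mean_value m f x r (e%:num / m.+1%:R) a
    (fun i y By => (rH y By i).1) (fun i y By => (rH y By i).2) (h + x) x Bh (ballxx _ r0).
  have -> : (f \o shift x - (cst (f x) + (dform a : 'rV[R]_m -> R^o))) h =
      f (h + x) - f x - \sum_i ((h + x) 0 i - x 0 i) * a i.
    rewrite -![(_ - _ : _ -> _) _]/(_ - _) -![(_ + _ : _ -> _) _]/(_ + _) opprD addrA /=.
    by congr (_ - _); apply: eq_bigr => i _; rewrite mxE addrK.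
  rewrite addrK => /le_trans; apply; rewrite ler_wpM2r//.
  by rewrite mulrCA ger_pMr// ler_pdivrMr// mul1r ler_nat.
have [E1 E2] : continuous ('d f x) /\ 'd f x = dform a :> ('rV[R]_m -> R).
  have E := @diff_unique _ _ _ _ (dform a) x (@dform_continuous _ a) H.
  split; last exact: E.
  by rewrite E; exact: dform_continuous.
split; last by move=> v; rewrite E2.
by apply/diff_locallyP; split => //; rewrite E2.
Qed.

Lemma diff_sum_partial m (f : 'rV[R]_m -> R) (x : 'rV[R]_m) v : differentiable f x ->
  'd f x v = \sum_i v 0 i * 'D_(delta_mx 0 i) f x.
Proof.
move=> df; rewrite [in LHS](row_sum_delta v) linear_sum; apply: eq_bigr => i _.
by rewrite linearZ/= deriveE.
Qed.

(** Truncation by [max] and [min] destroys differentiability but keeps this property; together with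
    bounded support it yields a global Lipschitz constant, which dominates the difference quotients
    in [Int_derive0]. *)
Definition loclip (V : normedModType R) (f : V -> R) (x : V) :=
  exists K r : R, [/\ 0 < r, 0 <= K & forall y z, ball x r y -> ball x r z ->
    `|f y - f z| <= K * `|y - z|].

(** * Algebra of locally Lipschitz functions *)

Section Loclip.
Context (V : normedModType R).
Implicit Types (f g : V -> R) (x : V).

Lemma ball_min x (r s : R) y : ball x (Num.min r s) y -> ball x r y /\ ball x s y.
Proof.
by move=> h; split; apply: le_ball h; rewrite ge_min lexx ?orbT.
Qed.

Lemma loclip_lip f x (K : R) : (forall y z, `|f y - f z| <= K * `|y - z|) -> loclip f x.
Proof.
move=> h; exists `|K|, 1; split => // y z _ _; apply: le_trans (h y z) _.
by rewrite ler_wpM2r// ler_norm.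
Qed.

Lemma loclip_cst (c : R) x : loclip (fun=> c) x.
Proof. by apply: (@loclip_lip _ _ 0) => y z; rewrite subrr normr0 mul0r. Qed.

Lemma loclip_near f g x (s : R) : 0 < s -> (forall y, ball x s y -> f y = g y) ->
  loclip g x -> loclip f x.
Proof.
move=> s0 fg [K [r [r0 K0 h]]]; exists K, (Num.min r s); split => //.
  by rewrite lt_min r0.
by move=> y z /ball_min[? ?] /ball_min[? ?]; rewrite !fg//; exact: h.
Qed.

Lemma loclipD f g x : loclip f x -> loclip g x -> loclip (fun y => f y + g y) x.
Proof.
move=> [K [r [r0 K0 h]]] [L [s [s0 L0 k]]]; exists (K + L), (Num.min r s); split.
- by rewrite lt_min r0.
- exact: addr_ge0.
move=> y z /ball_min[? ?] /ball_min[? ?]; rewrite opprD addrACA mulrDl.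
by rewrite (le_trans (ler_normD _ _))// lerD// ?h ?k.
Qed.

Lemma loclip_lipcomp (g : R -> R) (L : R) f x : (forall a b, `|g a - g b| <= L * `|a - b|) ->
  loclip f x -> loclip (fun y => g (f y)) x.
Proof.
move=> gL [K [r [r0 K0 h]]]; exists (`|L| * K), r; split => //; first exact: mulr_ge0.
move=> y z By Bz; apply: le_trans (gL _ _) _; rewrite -mulrA.
apply: (@le_trans _ _ (`|L| * `|f y - f z|)); first by rewrite ler_wpM2r// ler_norm.
by rewrite ler_wpM2l// h.
Qed.

Lemma loclip_bound f x : loclip f x -> exists B r : R, [/\ 0 < r, 0 <= B & forall y, ball x r y -> `|f y| <= B].
Proof.
move=> [K [r [r0 K0 h]]]; exists (`|f x| + K * r), r; split => //.
  by rewrite addr_ge0// mulr_ge0// ltW.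
move=> y By; rewrite -(subrK (f x) (f y)) addrC (le_trans (ler_normD _ _))// lerD2l.
apply: le_trans (h _ _ By (ballxx _ r0)) _; rewrite ler_wpM2l//.
by move: By; rewrite -ball_normE/= distrC => /ltW.
Qed.

Lemma loclipM f g x : loclip f x -> loclip g x -> loclip (fun y => f y * g y) x.
Proof.
move=> lf lg; have [B [r1 [r10 B0 fB]]] := loclip_bound lf.
have [C [r2 [r20 C0 gC]]] := loclip_bound lg.
move: lf lg => [K [r [r0 K0 h]]] [L [s [s0 L0 k]]].
exists (C * K + B * L), (Num.min (Num.min r s) (Num.min r1 r2)); split.
- by rewrite !lt_min r0 s0 r10.
- by rewrite addr_ge0// mulr_ge0.
move=> y z /ball_min[/ball_min[? ?] /ball_min[? ?]] /ball_min[/ball_min[? ?] /ball_min[? ?]].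
have -> : f y * g y - f z * g z = g y * (f y - f z) + f z * (g y - g z) by ring.
rewrite mulrDl (le_trans (ler_normD _ _))// lerD//.
  by rewrite normrM -mulrA ler_pM// ?gC ?h.
by rewrite normrM -mulrA ler_pM// ?fB ?k.
Qed.

Lemma loclip_continuous f x : loclip f x -> {for x, continuous f}.
Proof.
move=> [K [r [r0 K0 h]]]; apply/cvgrPdist_le => e e0.
have K1 : 0 < K + 1 by rewrite ltr_wpDl.
apply/nbhs_ballP; exists (Num.min r (e / (K + 1))) => /=.
  by rewrite lt_min r0 divr_gt0.
move=> y /ball_min[By By']; apply: le_trans (h _ _ (ballxx _ r0) By) _.
move: By'; rewrite -ball_normE/= ltr_pdivlMr// => /ltW; apply: le_trans.
by rewrite mulrC ler_wpM2l// lerDl.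
Qed.

End Loclip.

Lemma loclip_coord m (i : 'I_m) (x : 'rV[R]_m) : loclip (fun y : 'rV[R]_m => y 0 i) x.
Proof.
apply: (@loclip_lip _ _ _ 1) => y z; rewrite mul1r.
by have := normrV_coord (y - z) i; rewrite !mxE.
Qed.

Lemma C1_loclip m (f : 'rV[R]_m -> R) (x : 'rV[R]_m) :
  (forall i : 'I_m, \forall y \near x, derivable f y (delta_mx 0 i)) ->
  (forall i : 'I_m, {for x, continuous ('D_(delta_mx 0 i) f)}) -> loclip f x.
Proof.
move=> df cf; pose a (i : 'I_m) : R := 'D_(delta_mx 0 i) f x.
have : \forall y \near x, forall i : 'I_m, derivable f y (delta_mx 0 i) /\
    `|'D_(delta_mx 0 i) f y - a i| <= 1.
  apply: (@filter_forall _ _ _ (nbhs x) _) => i; apply: filterI; first exact: df.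
  have /cvgrPdist_le/(_ _ ltr01) := cf i.
  by apply: filterS => y; rewrite distrC.
move=> /nbhs_ballP[r /= r0 rH].
exists (m%:R * 1 + \sum_i `|a i|), r; split => //; first by rewrite addr_ge0 ?mulr_ge0 ?sumr_ge0.
move=> y z By Bz.
have := @cube_mean_value m f x r 1 a
    (fun i y By => (rH y By i).1) (fun i y By => (rH y By i).2) y z By Bz.
rewrite mulrDl; set s := \sum_i _ => H.
rewrite -(subrK s (f y - f z)) (le_trans (ler_normD _ _))// lerD//.
rewrite mulr_suml /s (le_trans (ler_norm_sum _ _ _))// ler_sum// => i _.
rewrite normrM mulrC ler_wpM2l//.
by have := normrV_coord (y - z) i; rewrite !mxE.
Qed.

(** A Lebesgue number argument: by compactness one scale [d] serves all centres in the ball of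
    radius [M]. Points at distance at least [d] are handled by the bound [B] on [|f|], which gives
    the term [(B + B) / d]. *)
Lemma loclip_lipschitz m (f : 'rV[R]_m -> R) (M : R) : (forall x, loclip f x) ->
  (forall x, M < `|x| -> f x = 0) ->
  exists K : R, 0 <= K /\ forall x y, `|f x - f y| <= K * `|x - y|.
Proof.
move=> lf f0.
pose C := [set x : 'rV[R]_m | `|x| <= M].
have cC : compact C.
  apply: bounded_closed_compact.
    by exists M; split; [exact: num_real|move=> M' MM' x /= xM; rewrite (le_trans xM)// ltW].
  apply: (@closed_comp _ _ (fun x : 'rV[R]_m => `|x|) [set t | t <= M]).
    by move=> x _; exact: norm_continuous.
  exact: closed_le.
have [B B0 fB] : exists2 B : R, 0 <= B & forall x, `|f x| <= B.
  have : bounded_set (f @` C).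
    apply: compact_bounded; apply: continuous_compact => //.
    by apply: continuous_subspaceT => x; exact: loclip_continuous.
  move=> [K [_ /(_ (`|K| + 1))]]; rewrite (le_lt_trans (ler_norm _)) ?ltrDl// => /(_ isT) KB.
  exists (`|K| + 1) => [|x]; first by rewrite addr_ge0.
  have [Cx|Cx] := pselect (C x); first by apply: KB; exists x.
  by rewrite f0 ?normr0 ?addr_ge0// ltNge; apply/negP.
have [d d0 dL] : exists2 d : R, 0 < d & forall x, C x -> forall y z,
    ball x d y -> ball x d z -> `|f y - f z| <= d^-1 * `|y - z|.
  move/compact_near_coveringP : cC => /(_ R (0^'+)%R (fun d x => forall y z,
    ball x d y -> ball x d z -> `|f y - f z| <= d^-1 * `|y - z|)) H.
  have : \forall d \near (0 : R)^'+, C `<=` (fun x => forall y z,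
    ball x d y -> ball x d z -> `|f y - f z| <= d^-1 * `|y - z|).
    apply: H => x _; have [K [r [r0 K0 h]]] := lf x.
    (* [d < r / 2] keeps the [d]-balls around nearby centres inside the ball of radius [r], and
       [d < 1 / (K + 1)] makes [d^-1] a valid Lipschitz constant. *)
    exists (ball x (r / 2), [set d : R | 0 < d /\ d < Num.min (r / 2) (K + 1)^-1]).
      split => /=; first by apply: nbhsx_ballx; rewrite divr_gt0.
      apply: filterI; first exact: nbhs_right_gt.
      by apply: nbhs_right_lt; rewrite lt_min divr_gt0// invr_gt0 ltr_wpDl.
    move=> [x' d] /= [Bx' [d0]]; rewrite lt_min => /andP[dr dK] y z By Bz.
    have Br w : ball x' d w -> ball x r w.
      move=> Bw; rewrite (splitr r); apply: ball_triangle Bx' _.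
      by apply: le_ball Bw; exact: ltW.
    apply: le_trans (h _ _ (Br _ By) (Br _ Bz)) _; rewrite ler_wpM2r//.
    rewrite -[K]invrK; have [->|Kn0] := eqVneq K 0; first by rewrite !invr0 invr_ge0 ltW.
    have Kp : 0 < K by rewrite lt_def Kn0.
    rewrite lef_pV2 ?posrE ?invr_gt0//.
    by apply/ltW/(lt_le_trans dK); rewrite lef_pV2 ?posrE ?ltr_wpDl// lerDl.
  move=> near_d.
  by have [d [H1 H2]] := filter_ex (filterI near_d (@nbhs_right_gt _ (0 : R))); exists d.
have di0 : 0 <= d^-1 by rewrite invr_ge0 ltW.
exists (d^-1 + (B + B) / d); split; first by rewrite addr_ge0// mulr_ge0 ?addr_ge0.
move=> x y; rewrite mulrDl.
have [xy|xy] := ltP `|x - y| d.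
  apply: (@le_trans _ _ (d^-1 * `|x - y|)); last by rewrite lerDl mulr_ge0// divr_ge0 ?addr_ge0// ltW.
  have [Cx|Cx] := pselect (C x).
    apply: (dL x Cx) => //; first exact: ballxx.
    by rewrite -ball_normE.
  have [Cy|Cy] := pselect (C y).
    apply: (dL y Cy) => //; last exact: ballxx.
    by rewrite -ball_normE/= distrC.
  have f00 z : ~ C z -> f z = 0 by move=> Cz; rewrite f0// ltNge; apply/negP.
  by rewrite !f00// subrr normr0 mulr_ge0.
apply: (@le_trans _ _ (B + B)).
  by rewrite (le_trans (ler_normB _ _))// lerD.
apply: (@le_trans _ _ ((B + B) / d * `|x - y|)).
  by rewrite mulrAC -mulrA ler_peMr ?addr_ge0// ler_pdivlMr// mul1r.
by rewrite lerDr mulr_ge0// invr_ge0 ltW.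
Qed.

Lemma harmonic_dnbhs : (fun k => (k.+1%:R : R)^-1) @ \oo --> (0 : R)^'.
Proof.
pose t (k : nat) : R := k.+1%:R^-1.
move=> A HA; have {}HA : \forall y \near (0 : R), y != 0 -> A y by exact: HA.
have H : \forall k \near \oo, t k != 0 -> A (t k) := (@cvg_harmonic R) _ HA.
suff : \forall k \near \oo, A (t k) by [].
by apply: filterS H => k; apply; rewrite gt_eqF// invr_gt0.
Qed.

(** The derivative is tested along [t = 1 / (k + 1)] only, so a one-sided bound suffices; in
    particular the derivative at a maximum is at most 0 in every direction. *)
Lemma derive_ub (V : normedModType R) (f : V -> R) (x v : V) (d c : R) :
  is_derive x v f d -> (forall t, 0 < t <= 1 -> f (x + t *: v) - f x <= t * c) -> d <= c.
Proof.
move=> [df <-] H; have := cvg_comp _ _ harmonic_dnbhs df.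
apply: (@closed_cvg _ _ _ _ _ [set y : R | y <= c]); first exact: closed_le.
apply: nearW => k /=; rewrite [_ *: v + x]addrC ler_pdivrMl ?invr_gt0// H//.
by rewrite invr_gt0 ltr0Sn invf_le1// ler1n.
Qed.

(* Dominated convergence: by translation invariance the difference quotients of f have integral 0. *)
Lemma Int_derive0 m (f df : 'rV[R]_m -> R) (v : 'rV[R]_m) (N : set 'rV[R]_m) (M : R) :
  (forall x, loclip f x) -> (forall x, M < `|x| -> f x = 0) ->
  measurable N -> lebesgue_rV R m N = 0%E -> measurable_fun setT df ->
  (forall x, ~ N x -> is_derive x v f (df x)) -> Int df = 0.
Proof.
move=> lf f0 mN N0 mdf dfE.
have cf : continuous f by move=> x; exact: loclip_continuous.
have mf : measurable_fun setT f by exact: continuous_measurable_rV.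
have [K [K0 fK]] := loclip_lipschitz lf f0.
have bf : bmeas f.
  split => //; exists (`|f 0| + K * `|M| + `|M|); split => x; last first.
    move=> h; apply: f0; apply: le_lt_trans h.
    by rewrite (le_trans (ler_norm M))// lerDr addr_ge0// mulr_ge0.
  have [xM|/f0 ->] := leP `|x| M; last by rewrite normr0 !addr_ge0// mulr_ge0.
  rewrite -(subrK (f 0) (f x)) addrC (le_trans (ler_normD _ _))// -addrA lerD2l.
  apply: (@le_trans _ _ (K * `|M|)); last by rewrite lerDl.
  by rewrite (le_trans (fK _ _))// subr0 ler_wpM2l// (le_trans xM)// ler_norm.
pose t (k : nat) : R := k.+1%:R^-1.
have t0 k : 0 < t k by rewrite invr_gt0.
have t1 k : t k <= 1 by rewrite invf_le1// ler1n.
pose sh k x := aff 1 (t k *: v) 1%g x.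
have shE k x : sh k x = x + t k *: v by apply/rowP => i; rewrite !mxE perm1 mul1r.
pose F k x := (t k)^-1 * (f (sh k x) - f x).
have bsh k : bmeas (fun x => f (sh k x)) by have [] := Int_aff (t k *: v) 1%g (oner_neq0 R) bf.
have IF k : Int (F k) = 0.
  rewrite IntZ; last exact: bmeasB.
  rewrite IntB//; have [_ ->] := Int_aff (t k *: v) 1%g (oner_neq0 R) bf.
  by rewrite normr1 expr1n mul1r subrr mulr0.
have : (fun k => Int (F k)) @ \oo --> Int df.
  apply: (@Int_cvg _ _ F df (K * `|v| + `|M| + `|v|) N) => //.
  - move=> k; have [] : bmeas (F k) by apply/bmeasZ/bmeasB.
    by [].
  - move=> k x; rewrite /F normrM normfV (gtr0_norm (t0 k)) ler_pdivrMl//.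
    apply: le_trans (fK _ _) _; rewrite shE addrAC subrr add0r normrZ (gtr0_norm (t0 k)).
    by rewrite mulrCA ler_wpM2l ?(ltW (t0 k))// -addrA lerDl addr_ge0.
  - move=> k x h; rewrite /F !f0 ?subrr ?mulr0//.
      apply: le_lt_trans h; rewrite (le_trans (ler_norm M))//.
      by rewrite addrAC lerDr addr_ge0// mulr_ge0.
    rewrite shE; have : `|x| <= `|x + t k *: v| + `|v|.
      rewrite -{1}(addrK (t k *: v) x) (le_trans (ler_normB _ _))// lerD2l normrZ gtr0_norm//.
      by rewrite ler_piMl.
    move: h; have := ler_norm M; have : 0 <= K * `|v| by rewrite mulr_ge0. lra.
  - move=> x /dfE [dx <-].
    have := cvg_comp _ _ harmonic_dnbhs dx; apply: cvg_trans.
    apply: near_eq_cvg; apply: nearW => k.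
    by rewrite /F shE /= [x + _]addrC.
under eq_fun do rewrite IF.
by move=> /cvg_lim <- //; rewrite lim_cst.
Qed.

(** * Stability of the classes C^k *)

Lemma near_open (T : topologicalType) (U : set T) (P : T -> Prop) x : open U -> U x ->
  (forall y, U y -> P y) -> \forall y \near x, P y.
Proof. by move=> oU Ux UP; apply: filterS (open_nbhs_nbhs (conj oU Ux)). Qed.

Lemma Ck_continuous (V W : normedModType R) k (U : set V) (f : V -> W) x :
  Ck_on k U f -> U x -> {for x, continuous f}.
Proof. by case: k => [|k] [cf _]; exact: cf. Qed.

Lemma Ck_ext (V W : normedModType R) k (U : set V) (f g : V -> W) : open U ->
  (forall x, U x -> f x = g x) -> Ck_on k U f -> Ck_on k U g.
Proof.
move=> oU; elim: k f g => [|k IH] f g fg [cf Df].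
all: have E x : U x -> \near x, f x = g x by move=> Ux; exact: near_open Ux fg.
all: have cg x : U x -> {for x, continuous g} by
  move=> Ux; rewrite /prop_for /continuous_at -(fg x Ux);
  apply: cvg_trans (cf x Ux); apply: near_eq_cvg; apply: filterS (E x Ux) => y ->.
all: split => //.
move=> v; have [dv cv] := Df v; split=> [x Ux|].
  by apply: (near_eq_derivable (E x Ux)); exact: dv.
by apply: IH cv => x Ux; apply: near_eq_derive; exact: E.
Qed.

Lemma CkS (V W : normedModType R) k (U : set V) (f : V -> W) : Ck_on k.+1 U f -> Ck_on k U f.
Proof.
elim: k f => [|k IH] f [cf Df]; split => // v.
by have [dv cv] := Df v; split => //; exact: IH.
Qed.

Lemma Ck_sub (V W : normedModType R) k (U U' : set V) (f : V -> W) : U' `<=` U ->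
  Ck_on k U f -> Ck_on k U' f.
Proof.
move=> UU'; elim: k f => [|k IH] f [cf Df]; split => //; [by move=> x /UU' /cf| by move=> x /UU' /cf|].
by move=> v; have [dv cv] := Df v; split => [x /UU'|]; [exact: dv|exact: IH].
Qed.

Lemma Ck_local (V W : normedModType R) k (U : set V) (f : V -> W) :
  (forall x, U x -> exists U', U' x /\ Ck_on k U' f) -> Ck_on k U f.
Proof.
elim: k f => [|k IH] f H; split => //.
- by move=> x /H[U' [U'x [cf _]]]; exact: cf.
- by move=> x /H[U' [U'x [cf _]]]; exact: cf.
move=> v; split=> [x /H[U' [U'x [_ /(_ v)[dv _]]]]|]; first exact: dv.
by apply: IH => x /H[U' [U'x [_ /(_ v)[_ cv]]]]; exists U'.
Qed.

Lemma Ck_cst (V W : normedModType R) k (U : set V) (c : W) : Ck_on k U (fun=> c).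
Proof.
elim: k c => [|k IH] c; split => //; try by move=> x _; exact: cst_continuous.
move=> v; split=> [x _|]; first exact: derivable_cst.
have -> : 'D_v (fun=> c : W) = (fun=> 0) :> (V -> W) by apply/funext => x; exact: derive_cst.
exact: IH.
Qed.

Lemma Ck_lin (V W : normedModType R) k (U : set V) (f : {linear V -> W}) : continuous f -> Ck_on k U f.
Proof.
move=> cf; case: k => [|k]; split => //; try by move=> x _; exact: cf.
have df x : differentiable f x by exact: linear_differentiable.
move=> v; split=> [x _|]; first exact: diff_derivable.
have -> : 'D_v f = (fun=> f v) :> (V -> W) by apply/funext => x; rewrite deriveE// diff_lin.
exact: Ck_cst.
Qed.

Section CkAlg.
Context (V : normedModType R).
Implicit Types (f g : V -> R) (U : set V).

Lemma CkD k U f g : open U -> Ck_on k U f -> Ck_on k U g -> Ck_on k U (fun x => f x + g x).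
Proof.
move=> oU; elim: k f g => [|k IH] f g [cf Df] [cg Dg]; split => //;
  try by move=> x Ux; apply: continuousD; [exact: cf|exact: cg].
move=> v; have [df c1] := Df v; have [dg c2] := Dg v; split=> [x Ux|].
  by apply: derivableD; [exact: df|exact: dg].
apply: Ck_ext (IH _ _ c1 c2) => // x Ux; apply/esym/deriveD; [exact: df|exact: dg].
Qed.

Lemma CkM k U f g : open U -> Ck_on k U f -> Ck_on k U g -> Ck_on k U (fun x => f x * g x).
Proof.
move=> oU; elim: k f g => [|k IH] f g Cf Cg; move: (Cf) (Cg) => [cf Df] [cg Dg]; split => //;
  try by move=> x Ux; apply: continuousM; [exact: cf|exact: cg].
move=> v; have [df c1] := Df v; have [dg c2] := Dg v; split=> [x Ux|].
  by apply: derivableM; [exact: df|exact: dg].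
have := CkD oU (IH _ _ (CkS Cf) c2) (IH _ _ (CkS Cg) c1).
by apply: Ck_ext => // x Ux; apply/esym/deriveM; [exact: df|exact: dg].
Qed.

Lemma Ck_sum k U (J : Type) (r : seq J) (F : J -> V -> R) : open U ->
  (forall j, Ck_on k U (F j)) -> Ck_on k U (fun x => \sum_(j <- r) F j x).
Proof.
move=> oU CF; elim: r => [|j r IH].
  by apply: Ck_ext (Ck_cst k U 0) => // x _; rewrite big_nil.
by apply: Ck_ext (CkD oU (CF j) IH) => // x _; rewrite big_cons.
Qed.

Lemma is_derive_comp1 (g : R -> R) f x v (dg df : R) :
  is_derive (f x) 1 g dg -> is_derive x v f df -> is_derive x v (fun y => g (f y)) (dg * df).
Proof.
move=> Hg Hf.
have {}Hf : is_derive (0 : R) 1 (fun s : R => f (x + s *: v)) df.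
  by apply: (proj1 (is_derive_line f x v 0 df)); rewrite scale0r addr0.
rewrite -[x in is_derive x](addr0 x) -(scale0r v).
apply: (proj2 (is_derive_line (fun y => g (f y)) x v 0 _)).
have E : f (x + 0 *: v) = f x by rewrite scale0r addr0.
apply: (@is_derive1_comp _ g (fun s : R => f (x + s *: v))).
by rewrite E.
Qed.

Lemma CkV k U f : open U -> (forall x, U x -> f x != 0) -> Ck_on k U f -> Ck_on k U (fun x => (f x)^-1).
Proof.
move=> oU f0; elim: k => [|k IH] Cf; have [cf Df] := Cf; split => //;
  try by move=> x Ux; apply: continuousV; [exact: f0|exact: cf].
move=> v; have [df c1] := Df v; split=> [x Ux|].
  by apply: derivableV; [exact: f0|exact: df].
have Ci := IH (CkS Cf).
have := CkM oU (Ck_cst k U (-1 : R)) (CkM oU (CkM oU Ci Ci) c1).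
apply: Ck_ext => // x Ux; rewrite deriveV//; [|exact: f0|exact: df].
by rewrite mulN1r -exprVn expr2 scaleNr.
Qed.

Lemma Ck_sqrt k U f : open U -> (forall x, U x -> 0 < f x) -> Ck_on k U f ->
  Ck_on k U (fun x => Num.sqrt (f x)).
Proof.
move=> oU f0; elim: k => [|k IH] Cf; have [cf Df] := Cf; split => //;
  try by move=> x Ux; apply: (@continuous_comp _ _ _ f Num.sqrt); [exact: cf|exact: sqrt_continuous].
move=> v; have [df c1] := Df v.
have D x : U x -> is_derive x v (fun y => Num.sqrt (f y)) ((2 * Num.sqrt (f x))^-1 * 'D_v f x).
  move=> Ux; apply: is_derive_comp1; first exact: (is_derive1_sqrt (f0 x Ux)).
  by apply: derivableP; exact: df.
split=> [x /D[] //|].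
have Cs := IH (CkS Cf).
have Cs2 : Ck_on k U (fun x => (2 * Num.sqrt (f x))^-1).
  apply: CkV => //; last exact: CkM (Ck_cst k U _) Cs.
  by move=> x Ux; rewrite mulf_neq0// gt_eqF// sqrtr_gt0 f0.
by apply: Ck_ext (CkM oU Cs2 c1) => // x /D[].
Qed.

End CkAlg.

Lemma Ck_coord m k (U : set 'rV[R]_m) (i : 'I_m) : Ck_on k U (fun x : 'rV[R]_m => x 0 i).
Proof.
have -> : (fun x : 'rV[R]_m => x 0 i) = dform (fun j => (j == i)%:R).
  apply/funext => x; rewrite /dform (bigD1 i)//= eqxx mulr1 big1 ?addr0// => j /negbTE ->.
  by rewrite mulr0.
by apply: Ck_lin; exact: dform_continuous.
Qed.

Lemma continuous_rV (T : topologicalType) m (f : T -> 'rV[R]_m) x :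
  (forall i, {for x, continuous (fun y => f y 0 i)}) <-> {for x, continuous f}.
Proof.
split=> [H|cf i]; last first.
  by apply: (@continuous_comp _ _ _ f (fun M : 'rV[R]_m => M 0 i)) => //; exact: coord_continuous.
apply/cvgrPdist_lt => e e0.
have : \forall y \near x, forall i : 'I_m, `|f x 0 i - f y 0 i| < e.
  apply: (@filter_forall _ _ _ (nbhs x) _) => i.
  by have /cvgrPdist_lt/(_ _ e0) := H i.
apply: filterS => y h; rewrite normrV_lt//; apply/forallP => i; rewrite !mxE; exact: h.
Qed.

Lemma Ck_rV (V : normedModType R) m k (U : set V) (f : V -> 'rV[R]_m) :
  open U -> (forall i, Ck_on k U (fun x => f x 0 i)) -> Ck_on k U f.
Proof.
move=> oU; elim: k f => [|k IH] f Cf.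
  by split=> // x Ux; apply/continuous_rV => i; have [c _] := Cf i; exact: c.
split=> [x Ux|v]; first by apply/continuous_rV => i; have [c _] := Cf i; exact: c.
have df x : U x -> derivable f x v.
  by move=> Ux; apply/derivable_mxP => i j; rewrite ord1; have [_ /(_ v)[d _]] := Cf j; exact: d.
split=> //; apply: IH => i; have [_ /(_ v)[_]] := Cf i; apply: Ck_ext => // x Ux.
by rewrite derive_mx ?mxE//; exact: df.
Qed.

Lemma Ck1_differentiable m (f : 'rV[R]_m -> R) k (U : set 'rV[R]_m) : open U -> Ck_on k.+1 U f ->
  forall x, U x -> differentiable f x.
Proof.
move=> oU [cf Df] x Ux; apply: (C1_differentiable _ _).1 => i; have [d c] := Df (delta_mx 0 i).
  exact: near_open Ux d.
exact: Ck_continuous c Ux.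
Qed.

Lemma Ck1_loclip m (f : 'rV[R]_m -> R) k (U : set 'rV[R]_m) : open U -> Ck_on k.+1 U f ->
  forall x, U x -> loclip f x.
Proof.
move=> oU [cf Df] x Ux; apply: C1_loclip => i; have [d c] := Df (delta_mx 0 i).
  exact: near_open Ux d.
exact: Ck_continuous c Ux.
Qed.

(** Restricting [h] to the line through [x] in the direction [v] gives a differentiable curve, to
    which the chain rule for differentials applies. *)
Lemma is_derive_comp (V W : normedModType R) m (g : 'rV[R]_m -> W) (h : V -> 'rV[R]_m) (x v : V) :
  differentiable g (h x) -> derivable h x v ->
  is_derive x v (fun y => g (h y)) ('d g (h x) ('D_v h x)).
Proof.
move=> dg dh.
have H : is_derive (0 : R) 1 (fun s : R => h (x + s *: v)) ('D_v h x).
  by apply: (proj1 (is_derive_line h x v 0 _)); rewrite scale0r addr0; exact: derivableP.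
rewrite -[x in is_derive x](addr0 x) -(scale0r v).
apply: (proj2 (is_derive_line (fun y => g (h y)) x v 0 _)).
have E : h (x + 0 *: v) = h x by rewrite scale0r addr0.
have d1 : differentiable (fun s : R => h (x + s *: v)) (0 : R) by apply/derivable1_diffP; case: H.
have d2 : differentiable g (h (x + 0 *: v)) by rewrite E.
have d3 := differentiable_comp d1 d2.
apply: DeriveDef; first exact/derivable1_diffP.
have H1 : 'd (fun s : R => h (x + s *: v)) (0 : R) 1 = 'D_v h x.
  by rewrite -(@derive_val _ _ _ _ _ _ _ H) deriveE.
by rewrite deriveE// (diff_comp d1 d2)/= H1 E.
Qed.

Lemma Ck_comp (V : normedModType R) m k (U : set V) (O : set 'rV[R]_m) (g : 'rV[R]_m -> R) (h : V -> 'rV[R]_m) :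
  open U -> open O -> (forall x, U x -> O (h x)) ->
  Ck_on k O g -> (forall i, Ck_on k U (fun x => h x 0 i)) -> Ck_on k U (fun x => g (h x)).
Proof.
move=> oU oO UO; elim: k g => [|k IH] g Cg Ch.
all: have chx x : U x -> {for x, continuous h} by
  move=> Ux; apply/continuous_rV => i; have [c _] := Ch i; exact: c.
all: have cgh x : U x -> {for x, continuous (fun x => g (h x))} by
  move=> Ux; apply: (@continuous_comp _ _ _ h g); [exact: chx|have [c _] := Cg; apply: c; exact: UO].
all: split => //.
move=> v.
have D x : U x -> is_derive x v (fun y => g (h y)) (\sum_i 'D_v (fun y => h y 0 i) x * 'D_(delta_mx 0 i) g (h x)).
  move=> Ux; have dg : differentiable g (h x) by apply: (Ck1_differentiable oO Cg); exact: UO.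
  have dh : derivable h x v.
    by apply/derivable_mxP => i j; rewrite ord1; have [_ /(_ v)[d _]] := Ch j; exact: d.
  have := is_derive_comp dg dh; rewrite diff_sum_partial// derive_mx//.
  by under eq_bigr do rewrite mxE.
split=> [x /D[] //|].
have Ch' i := CkS (Ch i).
apply: Ck_ext (Ck_sum (index_enum _) oU (F := fun i x => 'D_v (fun y => h y 0 i) x * 'D_(delta_mx 0 i) g (h x)) _) => // [x /D[]//|i].
apply: CkM => //; first by have [_ /(_ v)[]] := Ch i.
by apply: (IH ('D_(delta_mx 0 i) g) _ Ch'); have [_ /(_ (delta_mx 0 i))[]] := Cg.
Qed.

End Calculus.

(** * Minkowski norms and their duals *)

Section Dot.
Context {R : realType} {m : nat}.
Implicit Types (u v w : 'rV[R]_m).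

Lemma dotE u v : dot u v = \sum_i u 0 i * v 0 i.
Proof. by rewrite /dot mxE; apply: eq_bigr => i _; rewrite mxE. Qed.

Lemma dotC u v : dot u v = dot v u.
Proof. by rewrite !dotE; apply: eq_bigr => i _; rewrite mulrC. Qed.

Lemma dotDl u v w : dot (u + v) w = dot u w + dot v w.
Proof. by rewrite /dot mulmxDl mxE. Qed.

Lemma dotZl (c : R) u v : dot (c *: u) v = c * dot u v.
Proof. by rewrite /dot -scalemxAl mxE. Qed.

Lemma dotDr u v w : dot u (v + w) = dot u v + dot u w.
Proof. by rewrite dotC dotDl ![dot _ u]dotC. Qed.

Lemma dotZr (c : R) u v : dot u (c *: v) = c * dot u v.
Proof. by rewrite dotC dotZl dotC. Qed.

Lemma dotNl u v : dot (- u) v = - dot u v.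
Proof. by rewrite -scaleN1r dotZl mulN1r. Qed.

Lemma dotNr u v : dot u (- v) = - dot u v.
Proof. by rewrite dotC dotNl dotC. Qed.

Lemma dotBl u v w : dot (u - v) w = dot u w - dot v w.
Proof. by rewrite dotDl dotNl. Qed.

Lemma dotBr u v w : dot u (v - w) = dot u v - dot u w.
Proof. by rewrite dotDr dotNr. Qed.

Lemma dot0l u : dot 0 u = 0.
Proof. by rewrite /dot mul0mx mxE. Qed.

Lemma dot0r u : dot u 0 = 0.
Proof. by rewrite dotC dot0l. Qed.

Lemma dot_ge0 u : 0 <= dot u u.
Proof. by rewrite dotE sumr_ge0// => i _; rewrite -expr2 sqr_ge0. Qed.

Lemma dot_eq0 u : dot u u = 0 -> u = 0.
Proof.
rewrite dotE => /eqP; rewrite psumr_eq0; last by move=> i _; rewrite -expr2 sqr_ge0.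
move=> /allP h; apply/rowP => i; rewrite mxE.
by have := h i; rewrite mem_index_enum -expr2 sqrf_eq0 => /(_ isT)/eqP.
Qed.

Lemma dot_gt0 u : u != 0 -> 0 < dot u u.
Proof. by move=> u0; rewrite lt_def dot_ge0 andbT; apply: contra_neq u0; exact: dot_eq0. Qed.

Lemma dot_bound u v : `|dot u v| <= m%:R * `|u| * `|v|.
Proof.
rewrite dotE (le_trans (ler_norm_sum _ _ _))//.
apply: (@le_trans _ _ (\sum_(i < m) (`|u| * `|v|))).
  by apply: ler_sum => i _; rewrite normrM ler_pM// normrV_coord.
by rewrite sumr_const card_ord -[leLHS]mulr_natl mulrA.
Qed.

Lemma dot_continuous (T : topologicalType) (f g : T -> 'rV[R]_m) x :
  {for x, continuous f} -> {for x, continuous g} -> {for x, continuous (fun y => dot (f y) (g y))}.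
Proof.
move=> /continuous_rV cf /continuous_rV cg.
have -> : (fun y => dot (f y) (g y)) = (fun y => \sum_i f y 0 i * g y 0 i).
  by apply/funext => y; rewrite dotE.
by apply: continuous_sumR => i; apply: continuousM; [exact: cf|exact: cg].
Qed.

Lemma dot_delta u i : dot u (delta_mx 0 i) = u 0 i.
Proof.
rewrite dotE (bigD1 i)//= mxE !eqxx mulr1 big1 ?addr0// => j /negbTE ji.
by rewrite mxE ji andbF mulr0.
Qed.

Lemma dot_dform u : dot u = dform (fun i => u 0 i).
Proof. by apply/funext => v; rewrite dotE; apply: eq_bigr => i _; rewrite mulrC. Qed.

Lemma diff_dot u x : differentiable (dot u) x.
Proof. by rewrite dot_dform; apply: linear_differentiable; exact: dform_continuous. Qed.

Lemma is_derive_dot u x v : is_derive x v (dot u) (dot u v).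
Proof.
apply: DeriveDef; first exact/diff_derivable/diff_dot.
rewrite deriveE; last exact: diff_dot.
by rewrite dot_dform diff_lin//; exact: dform_continuous.
Qed.

Lemma diff_grad (f : 'rV[R]_m -> R) x v : differentiable f x -> 'd f x v = dot v (grad f x).
Proof. by move=> df; rewrite diff_sum_partial// dotE; apply: eq_bigr => i _; rewrite mxE. Qed.

Lemma derive_grad (f : 'rV[R]_m -> R) x v : differentiable f x -> 'D_v f x = dot v (grad f x).
Proof. by move=> df; rewrite deriveE// diff_grad. Qed.

End Dot.

Lemma open_neq (T : topologicalType) (p : T) : hausdorff_space T -> open [set x | x != p].
Proof.
move=> hT; rewrite (_ : mkset _ = ~` [set p]).
  exact/closed_openC/accessible_closed_set1/hausdorff_accessible.
by apply/seteqP; split=> x /= /eqP.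
Qed.

Lemma open_neq0 (R : realType) m (p : 'rV[R]_m) : open [set x : 'rV[R]_m | x != p].
Proof. apply: open_neq; exact: norm_hausdorff. Qed.

Arguments open_neq0 {R m} p.

(** * Positive 1-homogeneous functions *)

Section Gauge.
Context {R : realType} {n : nat}.
Notation E := 'rV[R]_n.+1.
Variable G : E -> R.
Hypothesis homG : forall (l : R) (x : E), 0 < l -> G (l *: x) = l * G x.
Hypothesis posG : forall x : E, x != 0 -> 0 < G x.
Hypothesis contG : forall x : E, x != 0 -> {for x, continuous G}.

Lemma gauge0 : G 0 = 0.
Proof.
have := @homG 2 0 (ltr0Sn _ 1); rewrite scaler0 => /eqP.
by rewrite -subr_eq0 -{1}[G 0]mul1r -mulrBl mulf_eq0 => /orP[|/eqP//]; lra.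
Qed.

Lemma gauge_ge0 x : 0 <= G x.
Proof. by have [->|/posG/ltW//] := eqVneq x 0; rewrite gauge0. Qed.

Let S := [set x : E | `|x| = 1].

Let cS : compact S.
Proof.
apply: bounded_closed_compact.
  exists 1; split; first exact: num_real.
  by move=> M' MM' x /= ->; rewrite ltW.
apply: (@closed_comp _ _ (fun x : E => `|x|) [set 1]).
  by move=> x _; exact: norm_continuous.
exact/accessible_closed_set1/hausdorff_accessible/norm_hausdorff.
Qed.

Lemma sphere_neq0 (x : E) : `|x| = 1 -> x != 0.
Proof. by move=> x1; rewrite -normr_eq0 x1 oner_neq0. Qed.

Lemma sphere_point : exists x : E, `|x| = 1.
Proof.
exists (const_mx 1); apply/eqP; rewrite eq_le; apply/andP; split.
  by apply: normrV_le => // i; rewrite mxE normr1.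
by have := normrV_coord (const_mx 1 : E) 0; rewrite mxE normr1.
Qed.

Lemma sphere_max (f : E -> R) : (forall x : E, x != 0 -> {for x, continuous f}) ->
  exists2 x : E, `|x| = 1 & forall y : E, `|y| = 1 -> f y <= f x.
Proof.
move=> cf; have [x0 x01] := sphere_point.
have [||x Sx xmax] := @compact_EVT_max E R f S _ cS; first by exists x0.
  apply: continuous_in_subspaceT => x; rewrite inE => /sphere_neq0; exact: cf.
exists x; first by move: Sx; rewrite inE.
by move=> y y1; apply: xmax; rewrite inE.
Qed.

Lemma gauge_bounds : exists c C : R, [/\ 0 < c, 0 < C & forall x, c * `|x| <= G x <= C * `|x|].
Proof.
have [xM xM1 HM] := sphere_max contG.
have [xm xm1 Hm] := @sphere_max (fun x => - G x) (fun x x0 => continuousN (contG x0)).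
exists (G xm), (G xM); split; try by apply: posG; exact: sphere_neq0.
move=> x; have [->|x0] := eqVneq x 0; first by rewrite normr0 !mulr0 gauge0 lexx.
have xp : 0 < `|x| by rewrite normr_gt0.
have y1 : `| `|x|^-1 *: x| = 1 by rewrite normrZ normfV normr_id mulVf// gt_eqF.
have E : G x = `|x| * G (`|x|^-1 *: x).
  by rewrite homG ?invr_gt0// mulrA mulfV ?gt_eqF// mul1r.
rewrite E ![_ * `|x|]mulrC !ler_pM2l//; apply/andP; split; last exact: HM.
by rewrite -lerN2; exact: Hm.
Qed.

Lemma gauge_continuous : continuous G.
Proof.
move=> x; have [xz|] := eqVneq x 0; last exact: contG.
have [c [C [c0 C0 h]]] := gauge_bounds.
apply/(@cvgrPdist_lt _ _ _ (nbhs x) _ G (G x)) => e e0; rewrite xz gauge0.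
apply/nbhs_ballP; exists (e / C) => /=; first exact: divr_gt0.
move=> y; rewrite -ball_normE/= !sub0r !normrN => yC.
rewrite ger0_norm ?gauge_ge0//; have /andP[_] := h y; move=> /le_lt_trans; apply.
by rewrite mulrC -ltr_pdivlMr.
Qed.

End Gauge.

Section HomogDeriv.
Context {R : realType} {m : nat}.
Variable G : 'rV[R]_m -> R.
Hypothesis homG : forall (l : R) (x : 'rV[R]_m), 0 < l -> G (l *: x) = l * G x.
Hypothesis dG : forall x : 'rV[R]_m, x != 0 -> differentiable G x.

Lemma homog_gradZ (l : R) (x : 'rV[R]_m) : 0 < l -> x != 0 -> grad G (l *: x) = grad G x.
Proof.
move=> l0 x0; apply/rowP => i; rewrite !mxE; set v := delta_mx 0 i.
have lx0 : l *: x != 0 by rewrite scaler_eq0 negb_or gt_eqF.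
have dZ : derivable (fun y : 'rV[R]_m => l *: y) x v by exact/derivableZ/derivable_id.
have D1 : is_derive x v (fun y => G (l *: y)) ('d G (l *: x) ('D_v (fun y => l *: y) x)).
  by apply: (@is_derive_comp _ _ _ _ G (fun y : 'rV[R]_m => l *: y)) => //; exact: dG.
have D2 : is_derive x v (fun y => l * G y) (l * 'D_v G x).
  by apply: is_deriveZ; apply: derivableP; apply: diff_derivable; exact: dG.
have E2 : (fun y => G (l *: y)) = (fun y => l * G y) by apply/funext => y; rewrite homG.
move: D1; rewrite E2 => -[_ +]; case: D2 => _ -> /esym.
rewrite deriveZ ?derive_id; last exact: derivable_id.
rewrite linearZ/= -deriveE; last exact: dG.
exact: (mulfI (lt0r_neq0 l0)).
Qed.

Lemma homog_euler (x : 'rV[R]_m) : x != 0 -> dot x (grad G x) = G x.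
Proof.
move=> x0; rewrite -derive_grad; last exact: dG.
have D1 : is_derive x x G ('D_x G x) by apply: derivableP; apply: diff_derivable; exact: dG.
have {}D1 : is_derive (0 : R) 1 (fun s : R => G (x + s *: x)) ('D_x G x).
  by apply: (proj1 (is_derive_line G x x 0 _)); rewrite scale0r addr0.
have : is_derive (0 : R) 1 (fun s : R => (1 + s) * G x) ('D_x G x).
  apply: near_eq_is_derive D1.
  apply: filterS (nbhsx_ballx (0 : R) 1 ltr01) => s; rewrite -ball_normE/= sub0r normrN => s1.
  rewrite -{1}[x]scale1r -scalerDl homG//.
  by move: s1; rewrite ltr_norml => /andP[? _]; lra.
move=> [_ <-].
have D3 : is_derive (0 : R) 1 (fun s : R => (1 + s) * G x) (G x).
  by apply: is_derive_eq; rewrite !(scaler0,add0r,addr0) [_ *: _]mulr1.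
by case: D3.
Qed.

End HomogDeriv.

(** * Duality between a Minkowski norm and its dual norm *)

Section Minkowski.
Context {R : realType} {n : nat}.
Notation E := 'rV[R]_n.+1.
Implicit Types (x y z v : E).
Variable F : E -> R.
Hypothesis hF : minkowski_norm F.

Let homF := minkowski_homogeneous hF.
Let posF := minkowski_gt0 hF.
Let smF := minkowski_smooth hF.

Lemma mink_cont x : x != 0 -> {for x, continuous F}.
Proof. by move=> x0; exact: Ck_continuous (smF 0) x0. Qed.

Let F_ge0 := gauge_ge0 homF posF.

Lemma mink_diff x : x != 0 -> differentiable F x.
Proof. move=> x0; refine (@Ck1_differentiable _ _ F 0 _ (open_neq0 0) (smF 1) x x0). Qed.

Lemma mink_subadd x y : F (x + y) <= F x + F y.
Proof.
have h : 0 <= (2^-1 : R) <= 1 by rewrite invr_ge0 ler0n invf_le1// ler1n.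
have := minkowski_convex hF (2 *: x) (2 *: y) h.
have -> : 1 - 2^-1 = 2^-1 :> R by field.
by rewrite !scalerA mulVf// !scale1r !homF// !mulrA mulVf// !mul1r.
Qed.

Lemma mink_euler x : x != 0 -> dot x (grad F x) = F x.
Proof. exact: homog_euler homF mink_diff x. Qed.

Lemma mink_gradZ (l : R) x : 0 < l -> x != 0 -> grad F (l *: x) = grad F x.
Proof. exact: homog_gradZ homF mink_diff l x. Qed.

(** By subadditivity [F (x + t y) - F x <= t F y]. Geometrically, the tangent hyperplane of the
    graph at [x] passes through the origin and lies below the graph. *)
Lemma mink_derive_le x y : x != 0 -> dot y (grad F x) <= F y.
Proof.
move=> x0; rewrite -derive_grad; last exact: mink_diff.
have d : derivable F x y by apply: diff_derivable; exact: mink_diff.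
apply: (derive_ub (derivableP d)) => t /andP[t0 _].
by rewrite lerBlDl -homF//; exact: mink_subadd.
Qed.

(* Strict convexity of the unit ball, from the positivity of the Hessian of F^2/2
   at the midpoint of a segment on which F is constant. *)
Lemma mink_strict x y : F x = 1 -> F y = 1 ->
  (forall t, 0 <= t <= 1 -> F (x + t *: (y - x)) = 1) -> x = y.
Proof.
move=> Fx Fy H; apply/esym/eqP; rewrite -subr_eq0; apply/contraT => v0.
set v := y - x in H v0; clearbody v.
pose z := x + 2^-1 *: v.
have Fz : F z = 1 by apply: H; lra.
have z0 : z != 0 by apply: contra_eq_neq Fz => ->; rewrite (gauge0 homF) eq_sym oner_neq0.
pose Q := fun y : E => 2^-1 * F y ^+ 2.
have smQ k : Ck_on k [set x : E | x != 0] Q.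
  have o := @open_neq0 R n.+1 0 : open [set x : E | x != 0].
  by apply: CkM => //; [exact: Ck_cst|apply: CkM => //; exact: smF].
have dQ w : w != 0 -> differentiable Q w.
  by move=> w0; apply: (@Ck1_differentiable _ _ Q 0 _ (open_neq0 0) (smQ 1) w w0).
have dQi i w : w != 0 -> differentiable ('D_(delta_mx 0 i) Q) w.
  move=> w0; apply: (@Ck1_differentiable _ _ _ 0 _ (open_neq0 0) _ w w0).
  by have [_ /(_ (delta_mx 0 i))[]] := smQ 2.
have := minkowski_hessian hF z0 v0; rewrite -/Q.
have -> : (v *m hessian Q z *m v^T) 0 0 = 'D_v ('D_v Q) z.
  have -> : 'D_v ('D_v Q) z = 'D_v (fun w => \sum_i v 0 i * 'D_(delta_mx 0 i) Q w) z.
    apply: near_eq_derive; apply: (near_open (open_neq0 0) z0) => w w0.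
    by rewrite deriveE ?diff_sum_partial//; exact: dQ.
  have -> : (fun w => \sum_i v 0 i * 'D_(delta_mx 0 i) Q w) =
     \sum_i (fun w => v 0 i * 'D_(delta_mx 0 i) Q w).
    by apply/funext => w; rewrite fct_sumE.
  rewrite derive_sum => [|i]; last first.
    by apply: derivableZ; apply: diff_derivable; exact: dQi.
  rewrite mxE; apply: eq_bigr => j _.
  rewrite deriveZ; last by apply: diff_derivable; exact: dQi.
  rewrite deriveE ?diff_sum_partial; [|exact: dQi..].
  by rewrite !mxE mulrC; congr (_ * _); apply: eq_bigr => i _; rewrite mxE.
suff -> : 'D_v ('D_v Q) z = 0 by rewrite ltxx.
have B s w : `|s| < 2^-1 -> w = z + s *: v -> F w = 1.
  rewrite ltr_norml => /andP[? ?] ->; rewrite /z -addrA -scalerDl; apply: H; lra.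
have h4 : (0 : R) < 4^-1 by [].
have D1 s : `|s| < 4^-1 -> 'D_v Q (z + s *: v) = 0.
  move=> s4; have Fw : F (z + s *: v) = 1 by apply: (B s) => //; lra.
  have w0 : z + s *: v != 0 by apply: contra_eq_neq Fw => ->; rewrite (gauge0 homF) eq_sym oner_neq0.
  have D : is_derive (z + s *: v) v Q ('D_v Q (z + s *: v)).
    by apply: derivableP; apply: diff_derivable; exact: dQ.
  have {}D := proj1 (is_derive_line Q z v s _) D.
  have : is_derive s 1 (fun=> 2^-1 : R) ('D_v Q (z + s *: v)).
    apply: near_eq_is_derive D; apply: filterS (nbhsx_ballx s _ h4) => t.
    rewrite -ball_normE/= => st; rewrite /Q (B t)// ?expr1n ?mulr1//.
    have := ler_normD (t - s) s; rewrite subrK distrC; lra.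
  by case=> _ <-; rewrite derive_cst.
have D : is_derive (z + 0 *: v) v ('D_v Q) ('D_v ('D_v Q) z).
  rewrite scale0r addr0; apply: derivableP; apply: diff_derivable.
  apply: (@Ck1_differentiable _ _ _ 0 _ (open_neq0 0) _ z z0).
  by have [_ /(_ v)[]] := smQ 2.
have {}D := proj1 (is_derive_line _ z v 0 _) D.
have : is_derive (0 : R) 1 (fun=> 0 : R) ('D_v ('D_v Q) z).
  apply: near_eq_is_derive D; apply: filterS (nbhsx_ballx (0 : R) _ h4) => t.
  by rewrite -ball_normE/= sub0r normrN => /D1.
by case=> _ <-; rewrite derive_cst.
Qed.

(** Equality case of [mink_derive_le]: on the segment from [x] to [y] convexity gives [F <= 1] and
    the tangent hyperplane at [x] gives [F >= 1], so [mink_strict] applies. *)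
Lemma mink_grad_eq x y : F x = 1 -> F y = 1 -> dot y (grad F x) = 1 -> y = x.
Proof.
move=> Fx Fy xy; apply/esym/mink_strict => // t /andP[t0 t1].
have x0 : x != 0 by apply: contra_eq_neq Fx => ->; rewrite (gauge0 homF) eq_sym oner_neq0.
have -> : x + t *: (y - x) = t *: y + (1 - t) *: x.
  by rewrite scalerBr scalerBl scale1r addrCA addrA.
apply/eqP; rewrite eq_le; apply/andP; split.
  have := minkowski_convex hF y x (introT andP (conj t0 t1)).
  by rewrite Fx Fy !mulr1 [t + _]addrC subrK.
have := mink_derive_le (t *: y + (1 - t) *: x) x0.
by rewrite dotDl !dotZl xy mink_euler// Fx !mulr1 [t + (1 - t)]addrC subrK.
Qed.

Let G := dual_norm F.

(** The quotient is 0-homogeneous in [y], so its supremum is attained on the compact sup-norm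
    sphere; the maximizer is then rescaled to [F y = 1]. *)
Lemma dual_max z : exists2 y, F y = 1 & G z = dot z y /\ forall w, dot z w <= G z * F w.
Proof.
have [y y1 Hy] : exists2 y : E, `|y| = 1 & forall w : E, `|w| = 1 -> dot z w / F w <= dot z y / F y.
  apply: sphere_max => x x0; apply: continuousM.
    by apply: dot_continuous => //; exact: cst_continuous.
  by apply: continuousV; [rewrite gt_eqF// posF|exact: mink_cont].
have y0 := sphere_neq0 y1.
have Fy0 : 0 < F y by exact: posF.
have Hw w : w != 0 -> dot z w / F w <= dot z y / F y.
  move=> w0; have wp : 0 < `|w| by rewrite normr_gt0.
  have := Hy (`|w|^-1 *: w).
  rewrite normrZ normfV normr_id mulVf ?gt_eqF// => /(_ erefl).
  rewrite dotZr homF ?invr_gt0// invfM invrK mulrACA.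
  by rewrite mulVf ?gt_eqF// mul1r.
have GE : G z = dot z y / F y.
  apply/eqP; rewrite eq_le; apply/andP; split.
    apply: ge_sup; first by exists (dot z y / F y), y.
    by move=> _ [w w0 <-]; exact: Hw.
  apply: ub_le_sup; last by exists y.
  by exists (dot z y / F y) => _ [w w0 <-]; exact: Hw.
exists ((F y)^-1 *: y); first by rewrite homF ?invr_gt0// mulVf// gt_eqF.
split; first by rewrite GE dotZr mulrC.
move=> w; have [->|w0] := eqVneq w 0; first by rewrite dot0r (gauge0 homF) mulr0.
by rewrite -ler_pdivrMr ?posF// GE Hw.
Qed.

Lemma dual_le z w : dot z w <= G z * F w.
Proof. by have [y _ [_]] := dual_max z. Qed.

Lemma dual_homog (l : R) z : 0 < l -> G (l *: z) = l * G z.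
Proof.
move=> l0; apply/eqP; rewrite eq_le; apply/andP; split.
  have [y y1 [-> _]] := dual_max (l *: z).
  by rewrite dotZl ler_pM2l// -[leRHS]mulr1 -y1; exact: dual_le.
have [y y1 [-> _]] := dual_max z.
by rewrite -dotZl -[leRHS]mulr1 -y1; exact: dual_le.
Qed.

Lemma dual_gt0 z : z != 0 -> 0 < G z.
Proof. by move=> z0; rewrite -(pmulr_lgt0 _ (posF z0)) (lt_le_trans _ (dual_le z z))// dot_gt0. Qed.

Lemma dual_subadd y z : G (y + z) <= G y + G z.
Proof.
have [w w1 [-> _]] := dual_max (y + z).
rewrite dotDl lerD//; [rewrite -[leRHS]mulr1 -w1|rewrite -[leRHS]mulr1 -w1]; exact: dual_le.
Qed.

Lemma dual_gauge_bounds : exists C : R, 0 < C /\ forall z, G z <= C * `|z|.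
Proof.
have [c [C [c0 C0 h]]] := gauge_bounds homF posF mink_cont.
exists (n.+1%:R / c); split=> [|z]; first by rewrite divr_gt0.
have [y Fy [-> _]] := dual_max z.
have /andP[cy _] := h y; rewrite Fy -ler_pdivlMl// mulr1 in cy.
apply: le_trans (ler_norm _) _; apply: le_trans (dot_bound _ _) _.
by rewrite mulrAC -mulrA -!mulrA ler_wpM2l// ler_wpM2r.
Qed.

Lemma dual0 : G 0 = 0. Proof. exact: gauge0 dual_homog. Qed.

Lemma dual_ge0 z : 0 <= G z. Proof. exact: gauge_ge0 dual_homog dual_gt0 z. Qed.

Lemma dual_lip : exists C : R, 0 < C /\ forall y z, `|G y - G z| <= C * `|y - z|.
Proof.
have [C [C0 h]] := dual_gauge_bounds; exists C; split => // y z.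
rewrite ler_norml; apply/andP; split.
  rewrite lerNl opprB lerBlDr -(subrK y z) (le_trans (dual_subadd _ _))// lerD2r distrC.
  by rewrite subrK h.
rewrite lerBlDr -{1}(subrK z y) (le_trans (dual_subadd _ _))// lerD2r.
exact: h.
Qed.

Lemma dual_continuous : continuous G.
Proof.
have [C [C0 h]] := dual_lip => z; apply: loclip_continuous.
exact: loclip_lip h.
Qed.

(* The point of the unit sphere of [F] at which the supremum defining the dual
   norm is attained; this is the gradient of the dual norm. *)
Definition legendre z : E := xget 0 [set y | F y = 1 /\ dot z y = G z].

Lemma legendreP z : F (legendre z) = 1 /\ dot z (legendre z) = G z.
Proof.
by rewrite /legendre; case: xgetP => // H; have [y Fy [/esym Gz _]] := dual_max z; case: (H y).
Qed.

(** Between two maximizers of [dot z] on the unit ball of [F] the whole segment consists of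
    maximizers, hence lies on the unit sphere, which [mink_strict] excludes unless they coincide. *)
Lemma legendre_uniq z y : z != 0 -> F y = 1 -> dot z y = G z -> y = legendre z.
Proof.
move=> z0 Fy zy; have [Fl zl] := legendreP z.
apply: mink_strict => // t /andP[t0 t1].
apply/eqP; rewrite eq_le; apply/andP; split.
  have := minkowski_convex hF (legendre z) y (introT andP (conj t0 t1)).
  by rewrite Fl Fy !mulr1 [t + _]addrC subrK scalerBr scalerBl scale1r addrCA addrA.
have := dual_le z (y + t *: (legendre z - y)).
rewrite dotDr dotZr dotBr zy zl subrr mulr0 addr0 -[leLHS]mulr1 ler_pM2l//.
exact: dual_gt0.
Qed.

Lemma legendre_le z v : dot v (legendre z) <= G v.
Proof. by have := dual_le v (legendre z); rewrite (legendreP z).1 mulr1. Qed.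

(** A unique maximizer over a compact set depends continuously on the objective: away from
    [legendre z] the values of [dot z] stay below [G z] by a definite gap, which a small change of
    [z] cannot bridge. *)
Lemma legendre_continuous z : z != 0 -> {for z, continuous legendre}.
Proof.
move=> z0.
have cK : compact [set y : E | F y = 1].
  have [c [C [c0 C0 h]]] := gauge_bounds homF posF mink_cont.
  apply: bounded_closed_compact.
    exists c^-1; split; first exact: num_real.
    move=> M cM y /= Fy; have /andP[+ _] := h y; rewrite Fy -ler_pdivlMl// mulr1.
    by move=> /le_trans; apply; exact: ltW.
  apply: (@closed_comp _ _ F [set 1]).
    by move=> x _; exact: (gauge_continuous homF posF mink_cont).
  exact/accessible_closed_set1/hausdorff_accessible/norm_hausdorff.
have [c [C [c0 C0 h]]] := gauge_bounds homF posF mink_cont.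
have lb w : `|legendre w| <= c^-1.
  have /andP[+ _] := h (legendre w); rewrite (legendreP w).1 -ler_pdivlMl// mulr1; exact.
have [L [L0 GL]] := dual_lip.
apply/(@cvgrPdist_lt _ _ _ (nbhs z) _ legendre (legendre z)) => e e0.
(* The competitors at distance at least [e]; if there are any, the maximum of [dot z] over them is
   strictly less than [G z]. *)
pose Ke := [set y : E | F y = 1] `&` [set y | e <= `|legendre z - y|].
have cKe : compact Ke.
  apply: compact_closedI => //.
  apply: (@closed_comp _ _ (fun y : E => `|legendre z - y|) [set t | e <= t]); last exact: closed_ge.
  move=> x _; apply: (@continuous_comp _ _ _ (fun y : E => legendre z - y) (fun y : E => `|y|)).
    by apply: continuousB; [exact: cst_continuous|exact: cvg_id].
  exact: norm_continuous.
have [[y0 Ky0]|Ke0] := pselect (exists y, Ke y); last first.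
  apply: nearW => w; rewrite ltNge; apply/negP => ew; apply: Ke0; exists (legendre w).
  by split => //; exact: (legendreP w).1.
have [||y1 /[!inE] -[/= Fy1 ey1] Hy1] := @compact_EVT_max E R (dot z) Ke _ cKe; first by exists y0.
  by apply: continuous_subspaceT => x; apply: dot_continuous; [exact: cst_continuous|exact: cvg_id].
have zy1 : dot z y1 < G z.
  rewrite lt_def; apply/andP; split.
    apply/eqP => H; move: ey1; rewrite (legendre_uniq z0 Fy1 (esym H)) subrr normr0.
    by rewrite leNgt e0.
  by have := dual_le z y1; rewrite Fy1 mulr1.
(* Moving [z] to [w] costs [L] times the distance in [G], and [(n + 1) / c] times it in the pairing
   with [legendre w], whose norm is at most [1 / c]. *)
pose K := n.+1%:R * c^-1 + L.
have K0 : 0 < K by rewrite ltr_wpDl// mulr_ge0// invr_ge0 ltW.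
have d0 : 0 < (G z - dot z y1) / K by rewrite divr_gt0// subr_gt0.
apply: filterS (nbhsx_ballx z _ d0) => w; rewrite -ball_normE/= ltr_pdivlMr// => zw.
rewrite ltNge; apply/negP => ew.
have : dot z (legendre w) <= dot z y1.
  by apply: Hy1; rewrite inE; split => //=; exact: (legendreP w).1.
have -> : dot z (legendre w) = G w + dot (z - w) (legendre w).
  by rewrite dotBl (legendreP w).2 addrCA subrr addr0.
have := GL z w; rewrite ler_norml => /andP[_ H1].
have := dot_bound (z - w) (legendre w); rewrite ler_norml => /andP[H2 _] H3.
have : n.+1%:R * `|z - w| * `|legendre w| <= n.+1%:R * c^-1 * `|z - w|.
  by rewrite mulrAC ler_wpM2r// ler_wpM2l.
by move: zw; rewrite /K mulrDr [`|z - w| * (_ * _)]mulrC [`|z - w| * L]mulrC; lra.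
Qed.

(** Envelope argument: as a supremum of linear forms, [G] has increments along [v] that lie between
    [h] times the pairings of [v] with the maximizers at the two endpoints. Continuity of [legendre]
    makes both converge to the same derivative. *)
Lemma dual_diff z : z != 0 -> differentiable G z /\ grad G z = legendre z.
Proof.
move=> z0.
have D v w : w != 0 -> is_derive w v G (dot v (legendre w)).
  move=> w0.
  have H : (fun h : R => h^-1 *: ((G \o shift w) (h *: v) - G w)) @ (0 : R)^' --> dot v (legendre w).
    apply/cvgrPdist_le => e e0.
    have : {for (0 : R), continuous (fun h : R => dot v (legendre (h *: v + w)))}.
      apply: dot_continuous; first exact: cst_continuous.
      apply: (@continuous_comp _ _ _ (fun h : R => h *: v + w) legendre); last first.
        by rewrite scale0r add0r; exact: legendre_continuous.
      apply: continuousD; last exact: cst_continuous.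
      exact: scalel_continuous.
    move=> /cvgrPdist_le/(_ _ e0); rewrite scale0r add0r => H.
    have {}H : \forall h \near (0 : R), h != 0 -> `|dot v (legendre w) - dot v (legendre (h *: v + w))| <= e.
      by apply: filterS H.
    suff : \forall h \near (0 : R), h != 0 -> `|dot v (legendre w) - h^-1 *: ((G \o shift w) (h *: v) - G w)| <= e by [].
    apply: filterS H => h H h0; apply: le_trans (H h0) => /=.
    set u := h *: v + w.
    have A1 : h * dot v (legendre w) <= G u - G w.
      have := legendre_le w u; rewrite /u dotDl dotZl (legendreP w).2; lra.
    have A2 : G u - G w <= h * dot v (legendre u).
      have := legendre_le u w; have <- := (legendreP u).2; rewrite {2}/u dotDl dotZl; lra.
    rewrite -(ler_pM2l (_ : 0 < `|h|)) ?normr_gt0// -!normrM !mulrBr.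
    rewrite [h * (_ *: _)]mulrA mulfV// mul1r distrC [leRHS]distrC.
    by rewrite !ger0_norm ?subr_ge0// ?lerB// (le_trans A1).
  by apply: DeriveDef; [apply/cvg_ex; exists (dot v (legendre w))|exact: cvg_lim].
have cD v : 'D_v G z = dot v (legendre z) by case: (D v z z0).
split; last by apply/rowP => i; rewrite !mxE cD dotC dot_delta.
apply: (C1_differentiable _ _).1 => i.
  by apply: (near_open (open_neq0 0) z0) => w /(D (delta_mx 0 i)) [].
have E1 : \forall w \near z, dot (delta_mx 0 i) (legendre w) = 'D_(delta_mx 0 i) G w.
  by apply: (near_open (open_neq0 0) z0) => w /(D (delta_mx 0 i)) [_ ->].
apply: (cvg_trans (near_eq_cvg E1)).
rewrite cD; apply: dot_continuous; first exact: cst_continuous.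
exact: legendre_continuous.
Qed.

Lemma legendre_neq0 z : legendre z != 0.
Proof.
by apply: contra_eq_neq (legendreP z).1 => ->; rewrite (gauge0 homF) eq_sym oner_neq0.
Qed.

(** [grad F] inverts the gradient of the dual norm up to scale; this is what turns an equality of
    pairings into a formula for [grad F] in [legendre_grad_eq]. *)
Lemma grad_legendre z : z != 0 -> G z *: grad F (legendre z) = z.
Proof.
move=> z0; have [Fl zl] := legendreP z; set y := legendre z in Fl zl *.
have y0 : y != 0 by exact: legendre_neq0.
(* [w |-> dot z w - G z * F w] is maximal at [y], hence critical. *)
have H v : dot v (z - G z *: grad F y) <= 0.
  have D1 : is_derive y v (fun w => dot z w - G z * F w) (dot z v - G z * dot v (grad F y)).
    apply: is_deriveB; first exact: is_derive_dot.
    apply: is_deriveZ; rewrite -derive_grad; last exact: mink_diff.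
    by apply: derivableP; apply: diff_derivable; exact: mink_diff.
  rewrite dotBr dotZr dotC; apply: (derive_ub D1) => t _.
  by rewrite Fl zl mulr1 subrr subr0 mulr0 subr_le0; exact: dual_le.
by apply/esym/eqP; rewrite -subr_eq0; apply/eqP/dot_eq0/le_anti; rewrite H dot_ge0.
Qed.

Lemma legendre_grad_le z x : x != 0 -> dot (legendre z) (grad F x) <= 1.
Proof. by move=> x0; have := mink_derive_le (legendre z) x0; rewrite (legendreP z).1. Qed.

(** Rigidity of [legendre_grad_le]: equality makes [x] a positive multiple of [legendre z]. It
    identifies the field N in the equality case of the theorem. *)
Lemma legendre_grad_eq z x : z != 0 -> x != 0 -> dot (legendre z) (grad F x) = 1 ->
  grad F x = (G z)^-1 *: z.
Proof.
move=> z0 x0 H.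
have Fx : 0 < F x by exact: posF.
have xE : legendre z = (F x)^-1 *: x.
  apply: mink_grad_eq; last by rewrite mink_gradZ// invr_gt0.
    by rewrite homF ?invr_gt0// mulVf// gt_eqF.
  exact: (legendreP z).1.
rewrite -[X in _ = _ *: X](grad_legendre z0) scalerA mulVf ?scale1r; last by rewrite gt_eqF// dual_gt0.
by rewrite xE mink_gradZ// invr_gt0.
Qed.

End Minkowski.

(** * Star-shaped hypersurfaces as level sets of a gauge *)

Section VecDiff.
Context {R : realType}.

Lemma differentiable_rV (V : normedModType R) m (f : V -> 'rV[R]_m) x :
  (forall i, differentiable (fun y => f y 0 i) x) -> differentiable f x.
Proof.
move=> df; have -> : f = \sum_(i < m) (fun y => f y 0 i *: (delta_mx 0 i : 'rV[R]_m)).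
  by apply/funext => y; rewrite fct_sumE; exact: row_sum_delta.
by apply: differentiable_sum => i; apply: differentiableZl.
Qed.

Lemma Ck1_differentiable_rV n m (f : 'rV[R]_n -> 'rV[R]_m) k (U : set 'rV[R]_n) : open U ->
  (forall i, Ck_on k.+1 U (fun x => f x 0 i)) -> forall x, U x -> differentiable f x.
Proof.
by move=> oU cf x Ux; apply: differentiable_rV => i; exact: (Ck1_differentiable oU (cf i)).
Qed.

Lemma Ck_coordinate (V : normedModType R) m k (U : set V) (f : V -> 'rV[R]_m) i :
  open U -> Ck_on k U f -> Ck_on k U (fun x => f x 0 i).
Proof.
move=> oU; elim: k f => [|k IH] f [cf Df].
  by split=> // x Ux; have /continuous_rV := cf x Ux; exact.
split=> [x Ux|v]; first by have /continuous_rV := cf x Ux; exact.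
have [dv cv] := Df v; split=> [x /dv /derivable_mxP //|].
apply: Ck_ext (IH _ cv) => // x Ux; rewrite derive_mx ?mxE//; exact: dv.
Qed.

Lemma derive_jacobian_rV n m (f : 'rV[R]_n -> 'rV[R]_m) x v :
  differentiable f x -> 'D_v f x = v *m 'J f x.
Proof. exact: deriveEjacobian. Qed.

End VecDiff.

Lemma is_derive_affine (R : realType) (V W : normedModType R) (f : V -> W) (x v : V) (d : W) :
  (forall h : R, f (h *: v + x) = f x + h *: d) -> is_derive x v f d.
Proof.
move=> H.
have C : (fun h : R => h^-1 *: ((f \o shift x) (h *: v) - f x)) @ (0 : R)^' --> d.
  apply: cvg_near_cst; near=> h; rewrite /= H addrAC subrr add0r scalerA mulVf ?scale1r//.
  by near: h; exact: nbhs_dnbhs_neq.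
by apply: DeriveDef; [apply/cvg_ex; exists d|exact: cvg_lim].
Unshelve. all: by end_near. Qed.

(** * Tangent hyperplanes and traces *)

Section LinAlg.
Context {R : realType} {n : nat}.

Lemma row_freeP0 m1 m2 (A : 'M[R]_(m1, m2)) :
  (forall v : 'rV_m1, v *m A = 0 -> v = 0) -> row_free A.
Proof.
move=> H; rewrite -kermx_eq0; apply/eqP/row_matrixP => i; rewrite row0.
by apply: H; rewrite -row_mul mulmx_ker row0.
Qed.

(** The row space of [J] and the orthogonal complement of [p] both have dimension [n], and one
    contains the other. *)
Lemma orth_submx (J : 'M[R]_(n, n.+1)) (p : 'rV[R]_n.+1) m (v : 'M[R]_(m, n.+1)) :
  row_free J -> p != 0 -> J *m p^T = 0 -> v *m p^T = 0 -> (v <= J)%MS.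
Proof.
move=> fJ p0 Jp vp.
have kJ : (J <= kermx p^T)%MS by apply/sub_kermxP.
have rk : \rank (kermx p^T) = n.
  by rewrite mxrank_ker mxrank_tr rank_rV p0 subn1.
have /eqP rJ : \rank J = n by apply/eqP.
have : (kermx p^T <= J)%MS by rewrite -(geq_leqif (mxrank_leqif_sup kJ)) rk (eqP rJ).
by apply: submx_trans; apply/sub_kermxP.
Qed.

(** In the basis formed by [x] and the rows of [J], the map [M] is block diagonal with blocks 0 and
    [A]. This identifies the divergence of the 0-homogeneous extension with the trace over the
    tangent space. *)
Lemma trace_tangential (J : 'M[R]_(n, n.+1)) (x p : 'rV[R]_n.+1) (M : 'M[R]_n.+1) (A : 'M[R]_n) :
  row_free J -> J *m p^T = 0 -> dot x p != 0 -> x *m M = 0 -> J *m M = A *m J -> \tr M = \tr A.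
Proof.
move=> fJ Jp xp xM JM.
pose B : 'M[R]_(1 + n) := col_mx x J.
have uB : B \in unitmx.
  rewrite -row_free_unit; apply: row_freeP0 => v.
  rewrite -[v]hsubmxK mul_row_col => H.
  have : (lsubmx v *m x + rsubmx v *m J) *m p^T = 0 by rewrite H mul0mx.
  rewrite mulmxDl -!mulmxA Jp mulmx0 addr0 => /matrixP/(_ 0 0).
  rewrite mxE big_ord1 [RHS]mxE => /eqP; rewrite mulf_eq0 (negbTE xp) orbF => /eqP l0.
  have l00 : lsubmx v = 0 by apply/matrixP => i j; rewrite !ord1 l0 mxE.
  move: H; rewrite l00 mul0mx add0r => H.
  have -> : rsubmx v = 0 by apply: (row_free_inj fJ); rewrite H mul0mx.
  by rewrite row_mx0.
pose K : 'M[R]_(1 + n) := block_mx 0 0 0 A.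
have BM : B *m M = K *m B.
  rewrite mul_col_mx xM JM mul_block_col !mul0mx addr0 add0r.
  by [].
have -> : M = invmx B *m (K *m B) by rewrite -BM mulKmx.
by rewrite mxtrace_mulC mulmxK// mxtrace_block mxtrace0 add0r.
Qed.

End LinAlg.

Section Segment.
Context {R : realType} {n : nat}.
Notation E := 'rV[R]_n.+1.
Implicit Types (Omega : set E) (x y : E).

Lemma boundary_open_disj Omega x : open Omega -> Omega x -> ~ boundary Omega x.
Proof. by move=> oO Ox [_]; apply; move: oO => /interior_id ->. Qed.

(** On the segment [Omega] and its closure cut out the same set, which is therefore open and closed
    in a connected set. *)
Lemma segment_in_domain Omega x y : open Omega -> Omega x ->
  (forall t, 0 <= t <= 1 -> ~ boundary Omega (x + t *: (y - x))) -> Omega y.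
Proof.
move=> oO Ox H.
pose c (t : R) := x + t *: (y - x).
pose C := c @` `[0, 1].
have cc : continuous c.
  move=> t; apply: (@continuousD _ _ _ (fun=> x) (fun t : R => t *: (y - x))).
    exact: cst_continuous.
  exact: scalel_continuous.
have conC : connected C.
  apply: connected_continuous_connected; first exact: segment_connected.
  exact: continuous_subspaceT.
have B : C `&` Omega = C.
  apply: conC.
  - exists x; split => //; exists 0; first by rewrite /= in_itv/= lexx ler01.
    by rewrite /c scale0r addr0.
  - by exists Omega.
  - exists (closure Omega); first exact: closed_closure.
    apply/seteqP; split => z [Cz Oz]; split => //; first exact: subset_closure.
    apply: contrapT => nO; case: Cz => t; rewrite /= in_itv/= => /H nb zE; apply: nb; rewrite -/(c t) zE; split => // /interior_subset; exact: nO.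
have : C y by exists 1; [rewrite /= in_itv/= lexx ler01|rewrite /c scale1r addrC subrK].
by rewrite -B => -[].
Qed.

(** The boundary alone determines the domain once boundedness excludes the outside. This is applied
    to the gauge of Sigma centred at 0 and, in the equality case, to a multiple of the dual norm
    centred at [P]. *)
Lemma gauge_domain (G : E -> R) (O : E) Omega :
  (forall (l : R) x, 0 < l -> G (l *: x) = l * G x) -> (forall x, x != 0 -> 0 < G x) ->
  open Omega -> bounded_set Omega ->
  boundary Omega = [set x | G (x - O) = 1] -> Omega = [set x | G (x - O) < 1].
Proof.
move=> hG pG oO bO bE.
have G0 : G 0 = 0 := gauge0 hG.
have hG0 (l : R) x : 0 <= l -> G (l *: x) = l * G x.
  by rewrite le_eqVlt => /predU1P[<-|/hG //]; rewrite scale0r mul0r.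
have nb x : Omega x -> G (x - O) != 1.
  by move=> Ox; apply/eqP => Gx; apply: (boundary_open_disj oO Ox); rewrite bE.
have lt1 x : Omega x -> G (x - O) < 1.
  move=> Ox; rewrite lt_neqAle nb//= leNgt; apply/negP => G1.
  have x0 : x - O != 0 by apply: contraTneq G1 => ->; rewrite G0 ltNge ler01.
  (* From a point with [G > 1] the outward ray never meets the boundary again, so it would stay in
     [Omega] all the way to infinity. *)
  have ray s : 1 <= s -> Omega (O + s *: (x - O)).
    move=> s1; apply: (segment_in_domain oO Ox) => t /andP[t0 t1]; rewrite bE /=.
    have -> : x + t *: (O + s *: (x - O) - x) - O = (1 + t * (s - 1)) *: (x - O).
      by apply/rowP => i; rewrite !mxE; ring.
    have st : 0 <= t * (s - 1) by rewrite mulr_ge0// subr_ge0.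
    rewrite hG ?ltr_pwDl// => H.
    have : G (x - O) <= 1 by rewrite -H ler_peMl ?lerDl// ltW// (lt_trans ltr01).
    by rewrite leNgt G1.
  have [M M0 OM] := ex_strict_bound_gt0 bO.
  have xp : 0 < `|x - O| by rewrite normr_gt0.
  pose s := 1 + (M + `|O|) / `|x - O|.
  have s1 : 1 <= s by rewrite lerDl divr_ge0// addr_ge0// ltW.
  have := OM _ (ray _ s1); apply/negP; rewrite -leNgt.
  have : `|s *: (x - O)| <= `|O + s *: (x - O)| + `|O|.
    by rewrite -{1}[s *: _](addrK O) [_ + O]addrC ler_normB.
  rewrite normrZ (ger0_norm (le_trans ler01 s1)) /s mulrDl mul1r divfK ?gt_eqF//; lra.
apply/seteqP; split => // y /= Gy.
have [z bz] : boundary Omega !=set0.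
  rewrite bE; exists (O + (G (const_mx 1))^-1 *: const_mx 1); rewrite /= addrC addKr.
  have c0 : (const_mx 1 : E) != 0 by apply/eqP => /rowP/(_ 0); rewrite !mxE => /eqP; rewrite oner_eq0.
  by rewrite hG ?invr_gt0 ?pG// mulVf// gt_eqF// pG.
have [x Ox] : Omega !=set0.
  case: bz => cz _; have [x [Ox _]] := cz setT (filterT); by exists x.
(* Along the segment towards [O] the gauge only decreases from a value less than 1, so the boundary
   is not met. *)
have OO : Omega O.
  apply: (segment_in_domain oO Ox) => t /andP[t0 t1]; rewrite bE /=.
  have -> : x + t *: (O - x) - O = (1 - t) *: (x - O) by apply/rowP => i; rewrite !mxE; ring.
  rewrite hG0 ?subr_ge0// => H; have := lt1 _ Ox; apply/negP; rewrite -leNgt -H.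
  by rewrite ler_piMl ?gerBl// (gauge_ge0 hG pG).
apply: (segment_in_domain oO OO) => t /andP[t0 t1]; rewrite bE /=.
have -> : O + t *: (y - O) - O = t *: (y - O) by rewrite addrC addKr.
rewrite hG0// => H; move: Gy; apply/negP; rewrite -leNgt -H.
by rewrite ler_piMl// (gauge_ge0 hG pG).
Qed.

End Segment.

Section StarShaped.
Context {R : realType} {n : nat}.
Notation E := 'rV[R]_n.+1.

Lemma enormZ (l : R) (x : E) : 0 <= l -> enorm (l *: x) = l * enorm x.
Proof.
move=> l0; rewrite /enorm dotZl dotZr mulrA -expr2 sqrtrM ?sqr_ge0//.
by rewrite sqrtr_sqr ger0_norm.
Qed.

Lemma enorm_gt0 (x : E) : x != 0 -> 0 < enorm x.
Proof. by move=> x0; rewrite sqrtr_gt0 dot_gt0. Qed.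

(** The gauge is [|x| / r (x / |x|)] with the Euclidean norm, set to 0 at the origin by
    [enorm 0 = 0]. Smoothness is proved locally because [r] has only local smooth extensions around
    points of the sphere. *)
Lemma star_shaped_gauge (S : set E) : star_shaped 0 S -> exists rho : E -> R,
  [/\ forall (l : R) x, 0 < l -> rho (l *: x) = l * rho x,
      forall x, x != 0 -> 0 < rho x,
      smooth_on [set x | x != 0] rho &
      S = [set x | rho x = 1]].
Proof.
move=> [r [r0 rs ->]].
pose dir (x : E) := (enorm x)^-1 *: x.
pose rho (x : E) := enorm x / r (dir x).
have dir1 x : x != 0 -> unit_sphere (dir x).
  move=> /enorm_gt0 x0; rewrite /unit_sphere/= enormZ ?invr_ge0 ?ltW//.
  by rewrite mulVf// gt_eqF.
have dirZ l x : 0 < l -> dir (l *: x) = dir x.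
  move=> l0; rewrite /dir enormZ ?ltW// invfM scalerA mulrAC mulVf ?gt_eqF// mul1r//.
exists rho; split.
- by move=> l x l0; rewrite /rho dirZ// enormZ ?ltW// mulrA.
- by move=> x x0; rewrite /rho divr_gt0 ?enorm_gt0// r0//; exact: dir1.
- move=> k; apply: Ck_local => x0 /= x00.
  have [U [g [oU Ux gs gr]]] := rs _ (dir1 _ x00).
  have oN := @open_neq0 R n.+1 0 : open [set x : E | x != 0].
  have sE j : Ck_on j [set x : E | x != 0] (@enorm R n.+1).
    apply: Ck_sqrt => // [x|]; first exact: dot_gt0.
    apply: Ck_ext (Ck_sum (index_enum _) oN (F := fun i (x : E) => x 0 i * x 0 i) _) => //.
      by move=> x _; rewrite dotE.
    by move=> i; apply: CkM => //; exact: Ck_coord.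
  have sI j : Ck_on j [set x : E | x != 0] (fun x => (enorm x)^-1).
    by apply: CkV => // x /= /enorm_gt0; exact: lt0r_neq0.
  have sD j i : Ck_on j [set x : E | x != 0] (fun x => dir x 0 i).
    by apply: Ck_ext (CkM oN (sI j) (Ck_coord _ _ i)) => // x _; rewrite mxE.
  have cdir (x : E) : x != 0 -> {for x, continuous dir}.
    by move=> xn; apply/continuous_rV => i; exact: Ck_continuous (sD 0 i) xn.
  pose U' := [set x : E | x != 0] `&` dir @^-1` U.
  have oU' : open U'.
    rewrite openE => x [xn Udx]; apply: filterI; first exact: oN.
    by apply: (cdir _ xn); exact: open_nbhs_nbhs.
  exists U'; split; first by split.
  apply: (@Ck_ext _ _ _ _ _ (fun x : E => enorm x * (g (dir x))^-1)) => //.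
    by move=> x [xn Udx]; rewrite /rho gr//; exact: dir1.
  have s1 : U' `<=` [set x : E | x != 0] by move=> x [].
  apply: CkM => //; first exact: Ck_sub s1 (sE k).
  apply: CkV => //.
    by move=> x [xn Udx]; rewrite -gr ?gt_eqF ?r0//; exact: dir1.
  apply: (Ck_comp oU' oU) => //; first by move=> x [].
  by move=> i; exact: Ck_sub s1 (sD k i).
- apply/seteqP; split=> x /=.
    move=> [th th1 <-]; rewrite add0r /rho.
    have rp := r0 _ th1.
    rewrite dirZ// enormZ ?ltW//.
    by rewrite /dir (th1 : enorm th = 1) invr1 scale1r mulr1 mulfV// gt_eqF.
  move=> rx; have x0 : x != 0.
    apply: contra_eq_neq rx => ->; rewrite /rho /enorm dot0l sqrtr0 mul0r.
    by rewrite eq_sym oner_neq0.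
  exists (dir x); first exact: dir1.
  rewrite add0r {2}/dir scalerA; have rp := r0 _ (dir1 _ x0).
  have -> : r (dir x) = enorm x.
    by rewrite -[LHS]mul1r -rx /rho divfK// gt_eqF.
  by rewrite mulfV ?scale1r// gt_eqF// enorm_gt0.
Qed.

End StarShaped.

(** * Charts of a radial graph by central projection *)

Section RadialGraph.
Context {R : realType} {n : nat}.
Notation E := 'rV[R]_n.+1.
Variable rho : E -> R.
Hypothesis hrho : forall (l : R) (x : E), 0 < l -> rho (l *: x) = l * rho x.
Hypothesis prho : forall x : E, x != 0 -> 0 < rho x.
Hypothesis srho : smooth_on [set x : E | x != 0] rho.
Implicit Types (x y v : E).

Let Sigma := [set x | rho x = 1].

Let oN : open [set x : E | x != 0] := open_neq0 0.

Lemma rho_cont x : x != 0 -> {for x, continuous rho}.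
Proof. by move=> x0; exact: Ck_continuous (srho 0) x0. Qed.

Lemma rho_diff x : x != 0 -> differentiable rho x.
Proof. by move=> x0; apply: (@Ck1_differentiable _ _ rho 0 _ oN (srho 1) x x0). Qed.

Lemma rho_euler x : x != 0 -> dot x (grad rho x) = rho x.
Proof. exact: homog_euler hrho rho_diff x. Qed.

Lemma rho_gradZ (l : R) x : 0 < l -> x != 0 -> grad rho (l *: x) = grad rho x.
Proof. exact: homog_gradZ hrho rho_diff l x. Qed.

Lemma rho_grad_neq0 x : x != 0 -> grad rho x != 0.
Proof.
move=> x0; apply: contraTneq (prho x0) => p0.
by rewrite -rho_euler// p0 dot0r ltxx.
Qed.

Lemma rho_neq0 x : rho x = 1 -> x != 0.
Proof. by move=> rx; apply: contra_eq_neq rx => ->; rewrite (gauge0 hrho) eq_sym oner_neq0. Qed.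

Lemma Ck_grad_coord k i : Ck_on k [set x : E | x != 0] (fun x => grad rho x 0 i).
Proof.
have [_ /(_ (delta_mx 0 i))[_]] := srho k.+1; apply: Ck_ext => // x _.
by rewrite mxE.
Qed.

Lemma grad_cont x : x != 0 -> {for x, continuous (grad rho)}.
Proof.
by move=> x0; apply/continuous_rV => i; exact: Ck_continuous (Ck_grad_coord 0 i) x0.
Qed.

Section Charts.
Variables (U : set 'rV[R]_n) (X : 'rV[R]_n -> E).
Hypothesis chX : chart Sigma U X.

Lemma chart_open : open U. Proof. by case: chX. Qed.

Lemma chart_in u : U u -> rho (X u) = 1.
Proof.
case: chX => oU _ _ _ /(_ U oU (fun _ => id))[V _ XU] Uu.
by have : (X @` U) (X u) by [exists u]; rewrite XU => -[].
Qed.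

Lemma chart_coord k i : Ck_on k U (fun u => X u 0 i).
Proof. by case: chX => oU sX _ _ _; apply: Ck_coordinate => //; exact: sX. Qed.

Lemma chart_diff u : U u -> differentiable X u.
Proof.
by move=> Uu; apply: (@Ck1_differentiable_rV _ _ _ X 0 U chart_open _ u Uu) => i; exact: chart_coord.
Qed.

(** Differentiate the constant function [rho (X u) = 1]. *)
Lemma chart_orth u : U u -> 'J X u *m (grad rho (X u))^T = 0.
Proof.
move=> Uu; apply/row_matrixP => i; rewrite row0 row_mul rowE -derive_jacobian_rV; last exact: chart_diff.
have x0 := rho_neq0 (chart_in Uu).
have dX : derivable X u (delta_mx 0 i) by apply: diff_derivable; exact: chart_diff.
have := is_derive_comp (rho_diff x0) dX.
rewrite diff_grad; last exact: rho_diff.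
move=> D; have : is_derive u (delta_mx 0 i) (fun=> 1 : R) (dot ('D_(delta_mx 0 i) X u) (grad rho (X u))).
  by apply: near_eq_is_derive D; exact: (near_open chart_open Uu (@chart_in)).
move=> [_]; rewrite derive_cst => H; apply/matrixP => a b; rewrite !ord1 [RHS]mxE.
exact: esym H.
Qed.

Lemma chart_row_free u : U u -> row_free ('J X u).
Proof. by case: chX => _ _ _ + _; exact. Qed.

End Charts.

Lemma tangent_orth x v : tangent_space Sigma x v -> dot v (grad rho x) = 0.
Proof.
move=> [U [X [u [chX Uu <- /submxP[D ->]]]]].
by rewrite /dot -mulmxA (chart_orth chX Uu) mulmx0 mxE.
Qed.

Variable Q : 'M[R]_n.+1.
Hypothesis uQ : Q \in unitmx.

(* Central projection chart of the radial graph: the ray through [(1, u) *m Q]. *)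
Definition ray (u : 'rV[R]_n) : E := (row_mx 1%:M u : 'rV[R]_(1 + n)) *m Q.

Definition pchart (u : 'rV[R]_n) : E := (rho (ray u))^-1 *: ray u.

Let coeff0 (u : 'rV[R]_n) : (row_mx 1%:M u : 'rV[R]_(1 + n)) 0 0 = 1.
Proof.
transitivity ((row_mx 1%:M u : 'rV[R]_(1 + n)) 0 (lshift n 0)).
  by congr (_ _ _); exact/val_inj.
by rewrite row_mxEl mxE eqxx.
Qed.

Lemma ray_neq0 u : ray u != 0.
Proof.
apply/eqP => H; have : (row_mx 1%:M u : 'rV[R]_(1 + n)) = 0.
  by rewrite -[LHS](mulmxK uQ) -/(ray u) H mul0mx.
move=> /rowP/(_ 0); rewrite coeff0 mxE => /eqP; by rewrite oner_eq0.
Qed.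

Let rr u : 0 < rho (ray u). Proof. exact/prho/ray_neq0. Qed.

Lemma pchart_in u : rho (pchart u) = 1.
Proof. by rewrite /pchart hrho ?invr_gt0// mulVf// gt_eqF. Qed.

Lemma Ck_ray k i : Ck_on k setT (fun u => ray u 0 i).
Proof.
apply: (@Ck_ext _ _ _ _ _ (fun u : 'rV[R]_n => Q 0 i + \sum_j u 0 j * Q (lift ord0 j) i)).
- exact: openT.
- move=> u _; rewrite /ray mxE big_ord_recl coeff0 mul1r; congr (_ + _).
  apply: eq_bigr => j _; congr (_ * _).
  have -> : lift ord0 j = rshift 1 j :> 'I_(1 + n) by exact/val_inj.
  by rewrite row_mxEr.
apply: CkD; [exact: openT|exact: Ck_cst|].
apply: Ck_sum; first exact: openT.
by move=> j; apply: CkM; [exact: openT|exact: Ck_coord|exact: Ck_cst].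
Qed.

Lemma Ck_rho_ray k : Ck_on k setT (fun u => rho (ray u)).
Proof.
apply: (Ck_comp openT oN) => //; first by move=> u _; exact: ray_neq0.
by move=> i; exact: Ck_ray.
Qed.

Lemma Ck_pchart k i : Ck_on k setT (fun u => pchart u 0 i).
Proof.
apply: (@Ck_ext _ _ _ _ _ (fun u : 'rV[R]_n => (rho (ray u))^-1 * ray u 0 i)).
- exact: openT.
- by move=> u _; rewrite /pchart [RHS]mxE.
apply: CkM; [exact: openT| |exact: Ck_ray].
by apply: CkV; [exact: openT| |exact: Ck_rho_ray] => u _; rewrite gt_eqF.
Qed.

Lemma derive_ray (u v : 'rV[R]_n) : is_derive u v ray ((row_mx 0 v : 'rV[R]_(1 + n)) *m Q).
Proof.
apply: is_derive_affine => h; rewrite /ray scalemxAl -mulmxDl scale_row_mx scaler0.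
by congr mulmx; apply/esym; apply: etrans (add_row_mx _ _ _ _) _; rewrite addr0 addrC.
Qed.

Lemma pchart_differentiable u : differentiable pchart u.
Proof. by apply: (@Ck1_differentiable_rV _ _ _ pchart 0 setT openT _ u I) => i; exact: Ck_pchart. Qed.

Lemma derive_pchart (u v : 'rV[R]_n) : 'D_v pchart u =
  (rho (ray u))^-1 *: ((row_mx 0 v : 'rV[R]_(1 + n)) *m Q) +
  'D_v (fun u => (rho (ray u))^-1) u *: ray u.
Proof.
have dr : derivable ray u v by case: (derive_ray u v).
have di : derivable (fun u => (rho (ray u))^-1) u v.
  have [_ /(_ v)[+ _]] := CkV openT (fun u _ => lt0r_neq0 (rr u)) (Ck_rho_ray 1).
  exact.
apply/rowP => i; rewrite derive_mx; last by apply: diff_derivable; exact: pchart_differentiable.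
rewrite [LHS]mxE [RHS]mxE [X in _ = X + _]mxE [X in _ = _ + X]mxE.
have -> : (fun u => pchart u 0 i) = (fun u => (rho (ray u))^-1) * (fun u => ray u 0 i).
  by apply/funext => w; rewrite /pchart [LHS]mxE.
move/derivable_mxP : (dr) => /(_ 0 i) dri.
rewrite deriveM//; congr (_ + _).
  by have [_ E1] := derive_ray u v; move/rowP : E1 => /(_ i); rewrite derive_mx// [LHS]mxE => ->.
by rewrite mulrC.
Qed.

Lemma pchart_row_free u : row_free ('J pchart u).
Proof.
apply: row_freeP0 => v; rewrite -derive_jacobian_rV ?derive_pchart; last exact: pchart_differentiable.
set c := 'D_v _ u => H.
have : ((rho (ray u))^-1 *: row_mx 0 v + c *: row_mx 1%:M u) *m Q = 0 :> 'rV[R]_n.+1.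
  by rewrite mulmxDl -!scalemxAl.
move=> /(congr1 (fun M => M *m invmx Q)); rewrite mulmxK// mul0mx !scale_row_mx scaler0 add_row_mx add0r => H'.
have {}H' : row_mx (c *: 1%:M) ((rho (ray u))^-1 *: v + c *: u) = row_mx 0 0 :> 'M[R]_(1, 1 + n).
  by rewrite row_mx0; exact: H'.
have [/matrixP/(_ 0 0)] := eq_row_mx H'.
rewrite !mxE eqxx mulr1 => -> ; rewrite scale0r addr0 => /eqP.
by rewrite scaler_eq0 invr_eq0 gt_eqF//= => /eqP.
Qed.

Lemma pchart_inj (u v : 'rV[R]_n) : pchart u = pchart v -> u = v.
Proof.
move=> H; have : (rho (ray u))^-1 *: row_mx 1%:M u = (rho (ray v))^-1 *: row_mx 1%:M v :> 'rV[R]_(1 + n).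
  by apply: (can_inj (mulmxK uQ)); rewrite -!scalemxAl; exact: H.
rewrite !scale_row_mx => H'; have [/matrixP/(_ 0 0) + ] := eq_row_mx H'.
rewrite !mxE eqxx !mulr1 => ->; apply: scalerI.
by rewrite invr_eq0 gt_eqF.
Qed.

(* The cone over the image of [pchart], and the inverse of the chart. *)
Definition pcone : set E := [set x | 0 < (x *m invmx Q) 0 0].

Definition pcoord (x : E) : 'rV[R]_n :=
  ((x *m invmx Q) 0 0)^-1 *: rsubmx (x *m invmx Q : 'rV[R]_(1 + n)).

Lemma pcoordZ (l : R) x : 0 < l -> pcoord (l *: x) = pcoord x.
Proof.
move=> l0; rewrite /pcoord -scalemxAl mxE invfM linearZ/= scalerA mulrAC mulVf ?gt_eqF//.
by rewrite mul1r.
Qed.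

Lemma pcoord_ray u : pcoord (ray u) = u.
Proof. by rewrite /pcoord /ray mulmxK// coeff0 invr1 scale1r row_mxKr. Qed.

Lemma pcone_ray u : pcone (ray u).
Proof. by rewrite /pcone/= /ray mulmxK// coeff0. Qed.

Lemma pconeZ (l : R) x : 0 < l -> pcone (l *: x) <-> pcone x.
Proof. by move=> l0; rewrite /pcone /= -scalemxAl mxE pmulr_rgt0. Qed.

Lemma ray_pcoord x : pcone x -> x = (x *m invmx Q) 0 0 *: ray (pcoord x).
Proof.
rewrite /pcone/= /ray /pcoord => a0; set a := (x *m invmx Q) 0 0 in a0 *.
rewrite scalemxAl scale_row_mx scalerA mulfV ?gt_eqF// scale1r.
rewrite -[LHS](mulmxKV uQ); congr (_ *m _).
apply: etrans (esym (@hsubmxK _ 1 1 n _)) _; congr row_mx; apply/matrixP => i j.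
rewrite !ord1 mxE [RHS]mxE [X in _ = _ * X]mxE eqxx mulr1 /a; congr (_ _ _); exact/val_inj.
Qed.

Lemma pchart_image W : pchart @` W = Sigma `&` [set x | pcone x /\ W (pcoord x)].
Proof.
apply/seteqP; split=> x.
  move=> [u Wu <-]; split; first exact: pchart_in.
  have r0 : 0 < (rho (ray u))^-1 by rewrite invr_gt0.
  by split; [apply/pconeZ => //; exact: pcone_ray|rewrite /pchart pcoordZ// pcoord_ray].
move=> [rx [cx Wx]]; exists (pcoord x) => //.
have xE := ray_pcoord cx; rewrite /pchart.
move: cx; rewrite /pcone/=; set a := (x *m invmx Q) 0 0 in xE * => a0.
have : rho x = a * rho (ray (pcoord x)) by rewrite [in LHS]xE hrho.
rewrite rx => /esym H; rewrite [RHS]xE; congr (_ *: _).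
by apply: (mulIf (lt0r_neq0 (rr (pcoord x)))); rewrite mulVf ?H// gt_eqF.
Qed.

Let mulmx_cont (A : 'M[R]_n.+1) i : continuous (fun x : E => (x *m A) 0 i).
Proof.
move=> x; have -> : (fun x : E => (x *m A) 0 i) = (fun x : E => \sum_j x 0 j * A j i).
  by apply/funext => y; rewrite mxE.
apply: continuous_sumR => j; apply: continuousM; first exact: coord_continuous.
exact: cst_continuous.
Qed.

Lemma pcone_open : open pcone.
Proof.
by apply: open_superlevel; exact: mulmx_cont.
Qed.

Lemma pcoord_cont x : pcone x -> {for x, continuous pcoord}.
Proof.
move=> cx; apply/continuous_rV => i.
have -> : (fun x => pcoord x 0 i) =
    (fun x : E => ((x *m invmx Q) 0 0)^-1) \* (fun x : E => (x *m invmx Q) 0 (rshift 1 i)).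
  by apply/funext => y; rewrite /= /pcoord mxE [rsubmx _ _ _]mxE.
apply: continuousM; last exact: mulmx_cont.
by apply: continuousV; [rewrite gt_eqF|exact: mulmx_cont].
Qed.

Lemma pchart_chart : chart Sigma setT pchart.
Proof.
split.
- exact: openT.
- by move=> k; apply: Ck_rV; [exact: openT|move=> i; exact: Ck_pchart].
- by move=> u v _ _; exact: pchart_inj.
- by move=> u _; exact: pchart_row_free.
- move=> W oW _; exists [set x | pcone x /\ W (pcoord x)]; last exact: pchart_image.
  rewrite openE => x [cx Wx]; apply: filterI; first exact: (open_nbhs_nbhs (conj pcone_open cx)).
  by apply: (pcoord_cont cx); exact: open_nbhs_nbhs.
Qed.

End RadialGraph.

(** * Normals and anisotropic mean curvature *)

Section SignedTransposition.
Context {R : realType} {n : nat}.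
Notation E := 'rV[R]_n.+1.

(** Self-inverse choices of [Q] for the projection charts: the cone of [stperm i b] is the
    half-space where the [i]-th coordinate has the sign [(-1) ^ b], and these [2 (n + 1)]
    half-spaces cover all nonzero points. *)
Definition stperm (i : 'I_n.+1) (b : bool) : 'M[R]_n.+1 := (-1) ^+ b *: tperm_mx 0 i.

Lemma stperm_sqr i b : stperm i b *m stperm i b = 1%:M.
Proof.
rewrite /stperm -scalemxAl -scalemxAr scalerA -expr2 sqrr_sign scale1r.
by rewrite -perm_mxM tperm2 perm_mx1.
Qed.

Lemma stperm_unit i b : stperm i b \in unitmx.
Proof. by have [] := mulmx1_unit (stperm_sqr i b). Qed.

Lemma stperm_inv i b : invmx (stperm i b) = stperm i b.
Proof. by rewrite -[LHS]mulmx1 -(stperm_sqr i b) mulKmx// stperm_unit. Qed.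

Lemma mul_stperm i b (x : E) : x *m stperm i b = aff ((-1) ^+ b) 0 (tperm 0 i) x.
Proof.
by apply/rowP => j; rewrite /stperm -scalemxAr -xcolE !mxE addr0.
Qed.

Lemma pcone_cover (x : E) : x != 0 -> exists i b, pcone (stperm i b) x.
Proof.
move=> x0; have [i xi] : exists i, x 0 i != 0.
  apply: contrapT => H; move/eqP: x0; apply; apply/rowP => i; rewrite mxE.
  by apply/eqP/negPn/negP => xi; apply: H; exists i.
exists i, (x 0 i < 0).
rewrite /pcone /= stperm_inv mul_stperm mxE tpermL mxE addr0.
move: xi; rewrite neq_lt => /orP[xi|xi]; first by rewrite xi expr1 mulN1r oppr_gt0.
by rewrite (ltNge (x 0 i)) ltW//= mul1r.
Qed.

End SignedTransposition.

Section DeriveSign.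
Context {R : realType} {V : normedModType R}.

Lemma derive_gt0_near (f : V -> R) (x v : V) d : is_derive x v f d -> 0 < d ->
  \forall t \near (0 : R)^'+, f x < f (x + t *: v).
Proof.
move=> [df dE] d0.
have : \forall t \near (0 : R)^', 0 < t^-1 *: ((f \o shift x) (t *: v) - f x).
  have /cvgrPdist_lt/(_ _ d0) : (fun t : R => t^-1 *: ((f \o shift x) (t *: v) - f x)) @ (0 : R)^' --> d by rewrite -dE.
  apply: filterS => t; rewrite ltr_norml => /andP[_ +]; rewrite ltrBlDr -subr_gt0; lra.
move=> H; have {}H : \forall t \near (0 : R)^'+, 0 < t^-1 *: ((f \o shift x) (t *: v) - f x).
  suff : \forall t \near (0 : R), 0 < t -> 0 < t^-1 *: ((f \o shift x) (t *: v) - f x) by [].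
  have {}H : \forall t \near (0 : R), t != 0 -> 0 < t^-1 *: ((f \o shift x) (t *: v) - f x) by [].
  by apply: filterS H => t Ht t0; apply: Ht; rewrite gt_eqF.
apply: filterS2 (@nbhs_right_gt _ (0 : R)) H => t /= t0.
by rewrite pmulr_rgt0 ?invr_gt0// subr_gt0 addrC.
Qed.

End DeriveSign.

Section Homog0.
Context {R : realType} {m : nat}.
Variable g : 'rV[R]_m -> R.
Hypothesis hg : forall (l : R) (x : 'rV[R]_m), 0 < l -> g (l *: x) = g x.
Hypothesis dg : forall x : 'rV[R]_m, x != 0 -> differentiable g x.

Lemma homog0_derive (l : R) (x v : 'rV[R]_m) : 0 < l -> x != 0 -> 'D_v g (l *: x) = l^-1 * 'D_v g x.
Proof.
move=> l0 x0.
have lx0 : l *: x != 0 by rewrite scaler_eq0 negb_or gt_eqF.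
have dZ : derivable (fun y : 'rV[R]_m => l *: y) x v by exact/derivableZ/derivable_id.
have D1 : is_derive x v (fun y => g (l *: y)) ('d g (l *: x) ('D_v (fun y => l *: y) x)).
  by apply: (@is_derive_comp _ _ _ _ g (fun y : 'rV[R]_m => l *: y)) => //; exact: dg.
have E2 : (fun y => g (l *: y)) = g by apply/funext => y; rewrite hg.
move: D1; rewrite E2 => -[_ ->]; rewrite deriveZ ?derive_id; last exact: derivable_id.
by rewrite linearZ/= -deriveE ?mulKf ?gt_eqF//; exact: dg.
Qed.

Lemma homog0_euler (x : 'rV[R]_m) : x != 0 -> 'D_x g x = 0.
Proof.
move=> x0.
have D1 : is_derive x x g ('D_x g x) by apply: derivableP; apply: diff_derivable; exact: dg.
have {}D1 : is_derive (0 : R) 1 (fun s : R => g (x + s *: x)) ('D_x g x).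
  by apply: (proj1 (is_derive_line g x x 0 _)); rewrite scale0r addr0.
have : is_derive (0 : R) 1 (fun=> g x) ('D_x g x).
  apply: near_eq_is_derive D1.
  apply: filterS (nbhsx_ballx (0 : R) 1 ltr01) => s; rewrite -ball_normE/= sub0r normrN => s1.
  rewrite -{1}[x]scale1r -scalerDl hg//.
  by move: s1; rewrite ltr_norml => /andP[? _]; lra.
by case=> _ <-; rewrite derive_cst.
Qed.

End Homog0.

(** * The anisotropic normal field and its divergence *)

Section AnisoNormal.
Context {R : realType} {n : nat}.
Notation E := 'rV[R]_n.+1.
Variable rho : E -> R.
Hypothesis hrho : forall (l : R) (x : E), 0 < l -> rho (l *: x) = l * rho x.
Hypothesis prho : forall x : E, x != 0 -> 0 < rho x.
Hypothesis srho : smooth_on [set x : E | x != 0] rho.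
Variable Omega : set E.
Hypothesis OmegaE : Omega = [set x | rho x < 1].
Hypothesis bOmega : boundary Omega = [set x | rho x = 1].
Implicit Types (x y v : E).

(** The default value of [xget] is ruled out because the normalized gradient qualifies. For
    uniqueness, a projection chart exhibits an [n]-dimensional tangent space, so any candidate is
    parallel to the gradient, and the exterior condition fixes its sign. *)
Lemma outward_normalE x : rho x = 1 ->
  outward_normal Omega x = (enorm (grad rho x))^-1 *: grad rho x.
Proof.
move=> rx; have x0 := rho_neq0 hrho rx; set p := grad rho x.
have p0 : p != 0 := rho_grad_neq0 hrho prho srho x0.
have ep : 0 < enorm p := enorm_gt0 p0.
have dp : 0 < dot p p := dot_gt0 p0.
have D (c : R) : is_derive x (c *: p) rho (c * dot p p).
  rewrite -dotZl -derive_grad; last exact: rho_diff.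
  by apply: derivableP; apply: diff_derivable; exact: rho_diff.
apply: xget_unique.
  split.
  - by rewrite enormZ ?invr_ge0 ?ltW// mulVf// gt_eqF.
  - by move=> v; rewrite bOmega => tv; rewrite dotZl dotC (tangent_orth hrho srho tv) mulr0.
  - have c0 : 0 < (enorm p)^-1 * dot p p by rewrite mulr_gt0// invr_gt0.
    apply: filterS (derive_gt0_near (D _) c0) => t; rewrite rx OmegaE /= => H.
    by apply/negP; rewrite -leNgt ltW.
move=> y [y1 yT yO].
have [i [b cx]] := pcone_cover x0.
have uQ := @stperm_unit R n i b.
have chX := pchart_chart hrho prho srho uQ.
have [u _ Xu] : (pchart rho (stperm i b) @` setT) x.
  by rewrite (pchart_image hrho prho uQ); split.
set J := 'J (pchart rho (stperm i b)) u.
have Jp : J *m p^T = 0 by have := chart_orth hrho srho chX (u := u) I; rewrite Xu.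
have fJ : row_free J by exact: (chart_row_free chX).
have Jy : J *m y^T = 0.
  apply/row_matrixP => k; rewrite row0 row_mul; apply/matrixP => a c; rewrite !ord1 [RHS]mxE.
  rewrite -/(dot (row k J) y) dotC; apply: yT; rewrite bOmega.
  by exists setT, (pchart rho (stperm i b)), u; split => //; exact: row_sub.
have /sub_rVP[c yc] : (y <= p)%MS.
  have pk : (p <= kermx J^T)%MS by apply/sub_kermxP; rewrite -[LHS]trmxK trmx_mul !trmxK Jp trmx0.
  have yk : (y <= kermx J^T)%MS by apply/sub_kermxP; rewrite -[LHS]trmxK trmx_mul !trmxK Jy trmx0.
  apply: submx_trans yk _; rewrite -(geq_leqif (mxrank_leqif_sup pk)).
  by rewrite mxrank_ker mxrank_tr (eqP fJ) rank_rV p0 subSnn.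
have c0 : c != 0.
  by apply: contra_eq_neq y1 => c0; rewrite yc c0 scale0r /enorm dot0l sqrtr0 eq_sym oner_neq0.
(* For [c < 0] the gauge decreases along [y], so the points [x + t y] would enter [Omega]. *)
have [cn|cp] : c < 0 \/ 0 < c by apply/orP; rewrite -neq_lt.
  have : 0 < - (c * dot p p) by rewrite oppr_gt0 nmulr_rlt0.
  have DN : is_derive x y (fun z => - rho z) (- (c * dot p p)).
    by apply: is_deriveN; rewrite yc.
  move=> /(derive_gt0_near DN) H.
  have [t [/= H1 H2]] := filter_ex (filterI yO H).
  by case: H1; rewrite OmegaE /=; move: H2; rewrite ltrN2 rx.
rewrite yc; congr (_ *: _); move: y1; rewrite yc enormZ ?ltW// => H.
by apply: (mulIf (lt0r_neq0 ep)); rewrite H mulVf// gt_eqF.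
Qed.

Variable F : E -> R.
Hypothesis hF : minkowski_norm F.

(* The 0-homogeneous extension of nu_F. *)
Definition gfield x : E := grad F (grad rho x).

Lemma gfieldZ (l : R) x : 0 < l -> gfield (l *: x) = gfield x.
Proof.
move=> l0; have [->|x0] := eqVneq x 0; first by rewrite scaler0.
by rewrite /gfield (rho_gradZ hrho srho).
Qed.

Lemma gauss_mapE x : rho x = 1 -> aniso_gauss_map F Omega x = gfield x.
Proof.
move=> rx; have p0 := rho_grad_neq0 hrho prho srho (rho_neq0 hrho rx).
by rewrite /aniso_gauss_map outward_normalE// (mink_gradZ hF)// invr_gt0 enorm_gt0.
Qed.

Lemma Ck_gfield k i : Ck_on k [set x : E | x != 0] (fun x => gfield x 0 i).
Proof.
have oN := open_neq0 0 : open [set x : E | x != 0].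
apply: (@Ck_ext _ _ _ _ _ (fun x => 'D_(delta_mx 0 i) F (grad rho x))) => //.
  by move=> x _; rewrite mxE.
apply: (@Ck_comp _ _ _ _ _ _ ('D_(delta_mx 0 i) F) (grad rho) oN oN).
    by move=> x; exact: rho_grad_neq0.
  by have [_ /(_ (delta_mx 0 i))[]] := minkowski_smooth hF k.+1.
by move=> j; exact: Ck_grad_coord.
Qed.

Definition gdiv x : R := \sum_i 'D_(delta_mx 0 i) (fun y => gfield y 0 i) x.

Lemma gfield_coord_diff i x : x != 0 -> differentiable (fun y => gfield y 0 i) x.
Proof.
move=> x0; exact: (@Ck1_differentiable _ _ (fun y => gfield y 0 i) 0 _ (open_neq0 0) (Ck_gfield 1 i) x x0).
Qed.

Lemma gfield_diff x : x != 0 -> differentiable gfield x.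
Proof. by move=> x0; apply: differentiable_rV => i; exact: gfield_coord_diff. Qed.

Lemma gdiv_trace x : x != 0 -> \tr ('J gfield x) = gdiv x.
Proof.
move=> x0; apply: eq_bigr => i _.
transitivity (row i ('J gfield x) 0 i); first by rewrite [RHS]mxE.
rewrite rowE -derive_jacobian_rV; last exact: gfield_diff.
by rewrite derive_mx ?[LHS]mxE//; apply: diff_derivable; exact: gfield_diff.
Qed.

Lemma gfield_euler x : x != 0 -> x *m 'J gfield x = 0.
Proof.
move=> x0; rewrite -derive_jacobian_rV; last exact: gfield_diff.
rewrite derive_mx; last by apply: diff_derivable; exact: gfield_diff.
apply/rowP => i; rewrite [LHS]mxE [RHS]mxE; apply: (homog0_euler (g := fun y => gfield y 0 i) _ _ x0).
  by move=> l y l0; rewrite gfieldZ.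
by move=> y y0; exact: gfield_coord_diff.
Qed.

(** Derivatives of the field are tangent to the level sets of [rho]; this makes [d nu_F] an
    endomorphism of the tangent space and supplies the matrix required by [aniso_mean_curvature]. *)
Lemma gfield_grad_orth x v : x != 0 -> dot (v *m 'J gfield x) (grad rho x) = 0.
Proof.
move=> x0; set p := grad rho x.
have oN := open_neq0 0 : open [set x : E | x != 0].
have p0 : p != 0 := rho_grad_neq0 hrho prho srho x0.
(* [y |-> dot p (gfield y)] is bounded by [F p], with equality at [x]. *)
have le0 w : dot p (w *m 'J gfield x) <= 0.
  rewrite -derive_jacobian_rV; last exact: gfield_diff.
  have dg : derivable gfield x w by apply: diff_derivable; exact: gfield_diff.
  have Dw : is_derive x w (fun y => dot p (gfield y)) (dot p ('D_w gfield x)).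
    have := @is_derive_comp _ _ _ _ (dot p) gfield x w (diff_dot _ _) dg.
    by rewrite -deriveE; [case: (is_derive_dot p (gfield x) ('D_w gfield x)) => _ ->|exact: diff_dot].
  rewrite leNgt; apply/negP => d0.
  have nz : \forall t \near (0 : R)^'+, x + t *: w != 0.
    have ct : {for (0 : R), continuous (fun t : R => x + t *: w)}.
      apply: (@continuousD _ _ _ (fun=> x) (fun t : R => t *: w)); first exact: cst_continuous.
      exact: scalel_continuous.
    have : \forall t \near (0 : R), x + t *: w != 0.
      suff /ct : nbhs (x + 0 *: w) [set y : E | y != 0] by [].
      by rewrite scale0r addr0; exact: (open_nbhs_nbhs (conj oN x0)).
    by apply: cvg_within.
  have [t [tnz]] := filter_ex (filterI nz (derive_gt0_near Dw d0)).
  apply/negP; rewrite -leNgt /gfield [leRHS](mink_euler hF)//.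
  by apply: (mink_derive_le hF); exact: (rho_grad_neq0 hrho prho srho).
rewrite dotC; apply/eqP; rewrite eq_le le0 /=.
by have := le0 (- v); rewrite mulNmx dotNr oppr_le0.
Qed.

Lemma jacobian_comp_chart U X u : chart [set x : E | rho x = 1] U X -> U u ->
  differentiable (aniso_gauss_map F Omega \o X) u /\
  'J (aniso_gauss_map F Omega \o X) u = 'J X u *m 'J gfield (X u).
Proof.
move=> chX Uu; have oU := chart_open chX.
have oN := open_neq0 0 : open [set x : E | x != 0].
have XN w : U w -> X w != 0 by move=> Uw; apply: (rho_neq0 hrho); exact: (chart_in chX Uw).
have E1 w : U w -> gfield (X w) = (aniso_gauss_map F Omega \o X) w.
  by move=> Uw; rewrite /= gauss_mapE//; exact: (chart_in chX Uw).
have C1 k i : Ck_on k U (fun w => gfield (X w) 0 i).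
  apply: (@Ck_comp _ _ _ _ _ _ (fun y => gfield y 0 i) X oU oN XN); first exact: Ck_gfield.
  by move=> j; exact: (chart_coord chX).
have C2 k i : Ck_on k U (fun w => (aniso_gauss_map F Omega \o X) w 0 i).
  by apply: (Ck_ext oU _ (C1 k i)) => w /E1 ->.
have dA : differentiable (aniso_gauss_map F Omega \o X) u.
  by apply: (@Ck1_differentiable_rV _ _ _ _ 0 U oU _ u Uu) => i; exact: C2.
split => //; apply/row_matrixP => i.
transitivity ('D_(delta_mx 0 i) (aniso_gauss_map F Omega \o X) u).
  by rewrite rowE (derive_jacobian_rV _ dA).
transitivity ('D_(delta_mx 0 i) (fun w => gfield (X w)) u).
  by apply/esym/near_eq_derive; exact: near_open oU Uu E1.
have dX : derivable X u (delta_mx 0 i) by apply: diff_derivable; exact: (chart_diff chX).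
have dN := gfield_diff (XN _ Uu).
have [_ ->] := is_derive_comp dN dX.
by rewrite -(deriveE _ dN) (derive_jacobian_rV _ dN) (derive_jacobian_rV _ (chart_diff chX Uu)) row_mul rowE.
Qed.

(** On Sigma the divergence equals the anisotropic mean curvature: by [gfield_euler] the radial
    direction contributes nothing to the trace of the Jacobian. *)
Lemma gdiv_ge0_on x : rho x = 1 -> 0 <= aniso_mean_curvature F Omega x -> 0 <= gdiv x.
Proof.
move=> rx; have x0 := rho_neq0 hrho rx.
suff : gdiv x = aniso_mean_curvature F Omega x by move=> ->.
rewrite /aniso_mean_curvature bOmega; case: xgetP => [h _ [U [X [u [A [chX [Uu Xu] _ JA ->]]]]]|H].
  have Jp := chart_orth hrho srho chX Uu.
  rewrite -gdiv_trace//; apply: (trace_tangential (chart_row_free chX Uu) Jp (x := x)).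
  - by rewrite Xu (rho_euler hrho srho)// rx oner_neq0.
  - exact: gfield_euler.
  - by rewrite -JA; have [_ ->] := jacobian_comp_chart chX Uu; rewrite Xu.
(* The default value 0 of [aniso_mean_curvature] does not occur: a projection chart covers [x], and
   tangency of the derivative lets the pseudo-inverse of the Jacobian produce the matrix. *)
exfalso.
have [i [b cx]] := pcone_cover x0.
have uQ := @stperm_unit R n i b.
have chX := pchart_chart hrho prho srho uQ.
have [u _ Xu] : (pchart rho (stperm i b) @` setT) x.
  by rewrite (pchart_image hrho prho uQ); split.
set X := pchart rho (stperm i b) in chX Xu.
have Uu : (@setT 'rV[R]_n) u by [].
have [dA JE] := jacobian_comp_chart chX Uu.
pose M := 'J X u *m 'J gfield (X u).
have MJ : (M <= 'J X u)%MS.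
  apply: (orth_submx (chart_row_free chX Uu) (rho_grad_neq0 hrho prho srho x0)).
    by rewrite -Xu; exact: (chart_orth hrho srho chX Uu).
  apply/row_matrixP => k; rewrite row0 row_mul /M row_mul; apply/matrixP => a c; rewrite !ord1 [RHS]mxE.
  by rewrite Xu; exact: gfield_grad_orth.
apply: (H (\tr (M *m pinvmx ('J X u)))).
exists setT, X, u, (M *m pinvmx ('J X u)); split => //.
by rewrite JE mulmxKpV.
Qed.

Lemma gdivZ (l : R) x : 0 < l -> x != 0 -> gdiv (l *: x) = l^-1 * gdiv x.
Proof.
move=> l0 x0; rewrite /gdiv mulr_sumr; apply: eq_bigr => i _.
have H1 (c : R) y : 0 < c -> gfield (c *: y) 0 i = gfield y 0 i by move=> c0; rewrite gfieldZ.
have H2 y : y != 0 -> differentiable (fun y => gfield y 0 i) y by exact: gfield_coord_diff.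
exact: (@homog0_derive R n.+1 (fun y => gfield y 0 i) H1 H2 l x (delta_mx 0 i) l0 x0).
Qed.

Lemma gdiv_ge0 : F_mean_convex F Omega -> forall x, x != 0 -> 0 <= gdiv x.
Proof.
move=> mc x x0; have r0 := prho x0.
have rx : rho ((rho x)^-1 *: x) = 1 by rewrite hrho ?invr_gt0// mulVf// gt_eqF.
have := gdiv_ge0_on rx; rewrite gdivZ ?invr_gt0// invrK pmulr_rge0//; apply.
by apply: mc; rewrite bOmega.
Qed.

End AnisoNormal.

(** * The area formula *)

Section Transfer.
Local Open Scope ereal_scope.
Context d1 d2 (T : measurableType d1) (Y : measurableType d2) (R : realType).
Variables (m : {measure set T -> \bar R}) (mu : {measure set Y -> \bar R}).
Variables (phi : T -> Y) (g : T -> R).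
Hypothesis mphi : measurable_fun setT phi.
Hypothesis mg : measurable_fun setT g.
Hypothesis g0 : forall x, (0 <= g x)%R.
Hypothesis muE : forall B, measurable B -> mu B = \int[m]_(x in phi @^-1` B) (g x)%:E.

Import HBNNSimple.

(** The hypothesis [muE] says that [mu] is the image under [phi] of the measure with density [g].
    The formula for sets extends to simple functions by linearity and to nonnegative functions by
    monotone convergence. *)
Lemma ge0_integral_image_density (f : Y -> \bar R) : measurable_fun setT f -> (forall y, 0 <= f y) ->
  \int[mu]_y f y = \int[m]_x (f (phi x) * (g x)%:E).
Proof.
move=> mf f0; pose h := nnsfun_approx measurableT mf.
have hE y : (h n y)%:E @[n --> \oo] --> f y by apply: cvg_nnsfun_approx.
have -> : \int[mu]_y f y = lim (\int[mu]_y (h n y)%:E @[n --> \oo]).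
  have fE y : f y = lim ((h n y)%:E @[n --> \oo]) by apply/esym/cvg_lim.
  under eq_integral do rewrite fE.
  apply: monotone_convergence => //.
  - by move=> n; exact/measurable_EFinP.
  - by move=> n y _; rewrite lee_fin.
  - by move=> y _ a b ab; rewrite lee_fin; exact/lefP/nd_nnsfun_approx.
have mgE : measurable_fun setT (fun x => (g x)%:E) by exact/measurable_EFinP.
have -> : \int[m]_x (f (phi x) * (g x)%:E) = lim (\int[m]_x ((h n (phi x))%:E * (g x)%:E) @[n --> \oo]).
  have fE x : f (phi x) * (g x)%:E = lim ((h n (phi x))%:E * (g x)%:E @[n --> \oo]).
    by apply/esym/cvg_lim => //; apply: cvgeZr.
  under eq_integral do rewrite fE.
  apply: monotone_convergence => //.
  - move=> n; apply: emeasurable_funM => //; apply/measurable_EFinP.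
    exact: measurableT_comp.
  - by move=> n y _; rewrite mule_ge0 ?lee_fin.
  - by move=> y _ a b ab; rewrite lee_wpmul2r ?lee_fin//; exact/lefP/nd_nnsfun_approx.
congr (lim (_ @ \oo)); apply/funext => n.
have mpre r : measurable (phi @^-1` (h n @^-1` [set r])).
  by rewrite -[X in measurable X]setTI; apply: mphi.
transitivity (\int[mu]_y (\sum_(r \in range (h n)) (r * \1_(h n @^-1` [set r]) y)%:E)).
  by apply: eq_integral => y _; rewrite fimfunE -fsumEFin.
rewrite ge0_integral_fsum//; last 2 first.
- by move=> r; exact/measurable_EFinP/measurable_funM.
- by move=> r y _; exact: nnfun_muleindic_ge0.
transitivity (\int[m]_x (\sum_(r \in range (h n)) (r * \1_(h n @^-1` [set r]) (phi x))%:E * (g x)%:E)); last first.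
  apply: eq_integral => x _; rewrite -ge0_mule_fsuml; last by move=> r; exact: nnfun_muleindic_ge0.
  by rewrite fsumEFin// -(fimfunE _ (phi x)).
rewrite [RHS]ge0_integral_fsum//; last 2 first.
- move=> r; apply: emeasurable_funM => //; apply/measurable_EFinP; apply: measurable_funM => //.
  by rewrite (_ : (fun x => _) = \1_(phi @^-1` (h n @^-1` [set r])))//.
- by move=> r x _; rewrite mule_ge0 ?lee_fin//; exact: nnfun_muleindic_ge0.
apply: eq_fsbigr => r rh.
under eq_integral do rewrite EFinM.
rewrite integralZl_indic_nnsfun// integral_indic// setIT muE//.
have r0 : 0 <= r%:E by move: rh; rewrite inE => -[y _ <-]; rewrite lee_fin.
rewrite integral_mkcond -ge0_integralZl//; last 2 first.
- by apply/(measurable_restrictT _ _).1 => //; exact: measurable_funTS.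
- by move=> x _; rewrite patchE; case: ifP => // _; rewrite lee_fin.
apply: eq_integral => x _; rewrite patchE EFinM -muleA; congr (_ * _).
rewrite indicE -[phi x \in _]/(x \in phi @^-1` (h n @^-1` [set r])).
by case: ifP => _; rewrite ?mul1e ?mul0e.
Qed.

End Transfer.

(** * Integration over cones *)

Section ConeFormula.
Context {R : realType} {n : nat}.
Local Notation E := 'rV[R]_n.+1.

Lemma integral_rV_cons (f : E -> \bar R) : measurable_fun setT f -> (forall x, 0 <= f x)%E ->
  (\int[lebesgue_rV R n.+1]_x f x =
   \int[lebesgue_measure]_t \int[lebesgue_rV R n]_v f (rV_cons (t, v)))%E.
Proof.
move=> mf f0.
transitivity (\int[push_measure (lebesgue_measure \x lebesgue_rV R n)%E (@measurable_rV_cons R n)]_x f x)%E.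
  by apply: eq_measure_integral.
rewrite ge0_integral_pushforward//; last exact: measurable_rV_cons.
rewrite fubini_tonelli1//; last by move=> x; exact: f0.
by apply: measurableT_comp => //; exact: measurable_rV_cons.
Qed.

Lemma measurable_invr : measurable_fun setT (fun t : measurableTypeR R => t^-1 : measurableTypeR R).
Proof.
rewrite -(setvU [set 0]) -[~` [set 0]]setCK; apply/measurable_funU => //.
  by rewrite setCK; exact: measurableC.
rewrite setCK; split; last exact: measurable_fun_set1.
apply: (@open_continuous_measurable_fun R).
  exact/closed_openC/accessible_closed_set1/hausdorff_accessible/norm_hausdorff.
by move=> x /set_mem/= /eqP x0; exact: inv_continuous.
Qed.

Lemma integral_power (b : R) : 0 <= b ->
  (\int[lebesgue_measure]_(t in `]0%R, b[) (n.+1%:R * t ^+ n)%:E = (b ^+ n.+1)%:E)%E.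
Proof.
rewrite le_eqVlt => /predU1P[<-|b0].
  by rewrite set_itv_ge ?bnd_simp// integral_set0 expr0n.
have cp (f : R -> R) : f = (fun t => n.+1%:R * t ^+ n) -> continuous f.
  move=> -> t; apply: cvgM; first exact: cvg_cst.
  exact: exprn_continuous.
rewrite -(@integral_itv_bndoo R 0 b _ true false); last first.
  apply: measurable_funTS; apply/measurable_EFinP.
  by apply: continuous_measurable_fun; exact: cp.
rewrite (@continuous_FTC2 _ _ (fun t => t ^+ n.+1)) ?expr0n ?sube0//.
- by apply: continuous_subspaceT; exact: cp.
- split; first by move=> x _; exact: exprn_derivable.
  + by apply: cvg_at_right_filter; exact: exprn_continuous.
  + by apply: cvg_at_left_filter; exact: exprn_continuous.
- by move=> x _; rewrite exp_derive1.
Qed.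

(** In the coordinates [(t, t u)] Lebesgue measure is [t ^ n dt du], and [(n + 1) t ^ n] integrates
    to [b u ^ (n + 1)] over [0 < t < b u]. The bound [b] is the height at which the ray of slope [u]
    leaves the cone. *)
Lemma cone_formula (k b : 'rV[R]_n -> R) : measurable_fun setT k -> measurable_fun setT b ->
  (forall u, 0 <= k u) -> (forall u, 0 < b u) ->
  (\int[lebesgue_rV R n.+1]_y (let t := (rV_uncons y).1 : R in let u := t^-1 *: (rV_uncons y).2 in
     if (0 < t < b u)%R then (n.+1%:R * k u)%:E else 0) =
   \int[lebesgue_rV R n]_u (k u * b u ^+ n.+1)%:E)%E.
Proof.
move=> mk mb k0 b0.
pose D (p : measurableTypeR R * 'rV[R]_n) : bool := (0 < (p.1 : R) < b p.2)%R.
pose h p : \bar R := if D p then (n.+1%:R * k p.2)%:E else 0%E.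
have mh : measurable_fun setT h.
  apply: measurable_fun_ifT => //.
    apply: measurable_and; apply: measurable_fun_ltr => //.
    exact: measurableT_comp.
  by apply/measurable_EFinP/measurable_funM => //; exact: measurableT_comp.
have h0 p : (0 <= h p)%E by rewrite /h; case: ifP => // _; rewrite lee_fin mulr_ge0.
pose sc (p : measurableTypeR R * 'rV[R]_n) : measurableTypeR R * 'rV[R]_n := (p.1, (p.1 : R)^-1 *: p.2).
have msc : measurable_fun setT sc.
  apply/measurable_fun_pairP; split => /=; first exact: measurable_fst.
  apply: measurable_fun_rV => i; rewrite (_ : (fun t => _) = (fun p : measurableTypeR R * 'rV[R]_n => (p.1 : R)^-1 * p.2 0 i)).
    apply: measurable_funM.
      exact: (measurableT_comp measurable_invr).
    by apply: (measurableT_comp (measurable_coord i)).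
  by apply/funext => p; rewrite /= mxE.
rewrite integral_rV_cons; last 2 first.
- rewrite (_ : (fun _ => _) = h \o sc \o @rV_uncons R n)//.
  apply: measurableT_comp; last exact: measurable_rV_uncons.
  exact: measurableT_comp.
- by move=> x; exact: h0 (sc (rV_uncons x)).
pose q (p : measurableTypeR R * 'rV[R]_n) : \bar R := (((p.1 : R) ^+ n)%:E * h p)%E.
(* On the slice at height [t > 0] the substitution [v = t u] turns the slope [v / t] into [u] and
   produces the factor [t ^ n]; slices with [t <= 0] contribute nothing. *)
transitivity (\int[lebesgue_measure]_t \int[lebesgue_rV R n]_v (if (0 < (t : R))%R then q (t, v) else 0))%E.
  apply: eq_integral => t _.
  transitivity (\int[lebesgue_rV R n]_v h (sc (t, v)))%E.
    by apply: eq_integral => v _; rewrite -[in RHS](rV_consK (t, v)).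
  have [t0|t0] := ltP 0 (t : R); last first.
    rewrite integral0_eq ?integral0_eq// => v _ /=.
    by rewrite /h /D /= ltNge t0.
  rewrite (@ge0_integral_aff _ _ (t : R) 0 1%g); last 3 first.
  - by rewrite gt_eqF.
  - rewrite (_ : (fun _ => _) = (fun v => h (sc (t, v))))//.
    apply: measurableT_comp => //; apply: measurableT_comp => //.
  - by move=> v; exact: h0 (sc (t, v)).
  rewrite -ge0_integralZl//; last first.
    apply: measurableT_comp => //; apply: measurableT_comp => //.
    by apply: measurableT_comp => //; exact: measurable_aff.
  apply: eq_integral => v _; rewrite /q /= gtr0_norm//; congr (_ * _)%E.
  congr h; rewrite /sc /=; congr pair; apply/rowP => i; rewrite !mxE perm1 addr0 mulrA mulVf ?mul1r//.
  by rewrite gt_eqF.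
have q0 p : (0 <= (if (0 < (p.1 : R))%R then q p else 0))%E.
  by case: ifP => // p0; rewrite mule_ge0// lee_fin exprn_ge0// ltW.
rewrite (@fubini_tonelli _ _ _ _ _ lebesgue_measure (lebesgue_rV R n)
  (fun p => if (0 < (p.1 : R))%R then q p else 0%E))//; last first.
  apply: measurable_fun_ifT => //; first exact: measurable_fun_ltr.
  apply: emeasurable_funM => //; apply/measurable_EFinP; exact: measurable_funX.
apply: eq_integral => u _ /=.
rewrite EFinM -integral_power ?ltW// -ge0_integralZl//; last 3 first.
- by apply: measurable_funTS; apply/measurable_EFinP/measurable_funM => //; exact: measurable_funX.
- move=> t /=; rewrite in_itv/= => /andP[t0 _]; rewrite lee_fin mulr_ge0// exprn_ge0// ltW//.
- by rewrite lee_fin.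
rewrite [RHS]integral_mkcond; apply: eq_integral => t _.
rewrite patchE /q /h /D /=; case: ifP => t0; last first.
  by rewrite memNset//= in_itv/= t0.
case: ifP => tb; rewrite t0 /= in tb.
  by rewrite mem_set/= ?in_itv/= ?t0 ?tb// -!EFinM; congr (_%:E); ring.
by rewrite mule0 memNset//= in_itv/= t0 tb.
Qed.

End ConeFormula.

Section GramChart.
Context {R : realType} {n : nat}.
Notation E := 'rV[R]_n.+1.
Variable rho : E -> R.
Hypothesis hrho : forall (l : R) (x : E), 0 < l -> rho (l *: x) = l * rho x.
Hypothesis prho : forall x : E, x != 0 -> 0 < rho x.
Hypothesis srho : smooth_on [set x : E | x != 0] rho.
Variable Q : 'M[R]_n.+1.
Hypothesis uQ : Q \in unitmx.

(* With X = pchart, x = X u and p = grad rho x, the tangency of the rows of J = 'J X u and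
   Euler's relation <x, p> = 1 give det [p; J] det [x; J] = det G and det [p; J]^2 = |p|^2 det G,
   where G = J J^T; and det [x; J] is obtained by row operations. *)
Lemma gram_pchart (u : 'rV[R]_n) :
  Num.sqrt (\det ('J (pchart rho Q) u *m ('J (pchart rho Q) u)^T)) =
  enorm (grad rho (pchart rho Q u)) * (`|\det Q| * (rho (ray Q u))^-1 ^+ n.+1).
Proof.
set X := pchart rho Q; set J : 'M[R]_(n, 1 + n) := 'J X u; set p := grad rho (X u).
set r := (rho (ray Q u))^-1.
have cX : chart [set x | rho x = 1] setT X by exact: pchart_chart.
have x0 : X u != 0 by apply: (rho_neq0 hrho); exact: pchart_in.
have Jp : J *m p^T = 0 by exact: (chart_orth hrho srho cX).
have xp : dot (X u) p = 1 by rewrite /dot; have := rho_euler hrho srho x0; rewrite pchart_in.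
have p0 : p != 0 by exact: (rho_grad_neq0 hrho prho srho x0).
have pp : 0 < dot p p by exact: dot_gt0.
pose A (w : E) : 'M[R]_(1 + n) := col_mx (w : 'rV[R]_(1 + n)) J.
have M11 (a b : E) : (a : 'rV[R]_(1 + n)) *m (b : 'rV[R]_(1 + n))^T = (dot a b)%:M.
  by rewrite [LHS]mx11_scalar.
have AA w : A p *m (A w)^T = block_mx (dot p w)%:M 0 (J *m (w : 'rV[R]_(1 + n))^T) (J *m J^T).
  rewrite /A tr_col_mx mul_col_row M11; congr block_mx.
  by rewrite -[LHS]trmxK trmx_mul trmxK Jp trmx0.
have D1 w : \det (A p) * \det (A w) = dot p w * \det (J *m J^T).
  rewrite -(det_tr (A w)) -det_mulmx AA.
  by rewrite det_lblock det_scalar1.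
have dAp : \det (A p) != 0.
  rewrite -unitfE -unitmxE -row_free_unit; apply: row_freeP0 => w.
  rewrite -(hsubmxK w) /A mul_row_col; set a := lsubmx w; set v := rsubmx w => H.
  have : (a *m (p : 'rV[R]_(1 + n)) + v *m J) *m (p : 'rV[R]_(1 + n))^T = 0 by rewrite H mul0mx.
  rewrite mulmxDl -!mulmxA Jp mulmx0 addr0 M11 mul_mx_scalar => /eqP.
  rewrite scaler_eq0 gt_eqF//= => /eqP a0.
  move: H; rewrite a0 mul0mx add0r => vJ.
  have -> : v = 0; last by rewrite row_mx0.
  have fJ : row_free J by exact: (pchart_row_free prho srho uQ u).
  by apply/eqP; rewrite -(mulmx_free_eq0 _ fJ) vJ.
have DG : \det (J *m J^T) = dot p p * \det (A (X u)) ^+ 2.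
  have E1 := D1 (X u); rewrite dotC xp mul1r in E1.
  have E2 := D1 p; rewrite -E1 in E2.
  have E3 : \det (A p) = dot p p * \det (A (X u)).
    by apply: (mulIf dAp); rewrite E2; ring.
  by rewrite -E1 E3; ring.
have DA : \det (A (X u)) = \det Q * r ^+ n.+1.
  pose c : 'cV[R]_n := \col_i 'D_(delta_mx 0 i) (fun u => (rho (ray Q u))^-1) u.
  have -> : A (X u) = (block_mx r%:M 0 c r%:M *m block_mx 1%:M u 0 1%:M : 'M[R]_(1 + n)) *m Q.
    rewrite mulmx_block !mulmx1 !mulmx0 !addr0 mul_scalar_mx.
    apply/row_matrixP => i; case: (split_ordP i) => j ->.
      rewrite ord1 /A [LHS]rowKu row_mul [X in _ = X *m _]rowKu row_id /X /pchart -/r.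
      rewrite row_row_mx !row_id /ray scalemxAl; congr (_ *m _).
      by rewrite [LHS]scale_row_mx scalemx1.
    rewrite /A [LHS]rowKd row_mul [X in _ = X *m _]rowKd.
    have -> : row j J = 'D_(delta_mx 0 j) X u.
      rewrite rowE; exact: esym (derive_jacobian_rV _ (pchart_differentiable prho srho uQ u)).
    rewrite derive_pchart// -/r /ray !scalemxAl -mulmxDl; congr (_ *m _).
    rewrite !scale_row_mx scaler0 row_row_mx; apply: etrans (add_row_mx _ _ _ _) _; rewrite add0r.
    congr row_mx; first by apply/rowP => k; rewrite ord1 !mxE eqxx mulr1.
    apply/rowP => k; rewrite !mxE big_ord1 !mxE [in RHS]addrC; congr (_ + _).
    by rewrite mulr_natr; congr (_ *+ _); rewrite eq_sym.
  rewrite det_mulmx mulrC; congr (_ * _).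
  rewrite det_mulmx det_lblock det_ublock !det_scalar1 !det_scalar expr1n !mulr1.
  by rewrite exprS.
have r0 : 0 < r by rewrite invr_gt0; apply: prho; exact: ray_neq0.
rewrite DG sqrtrM ?ltW// sqrtr_sqr DA normrM normrX (gtr0_norm r0) /enorm.
by [].
Qed.

End GramChart.

(** * The area measure as a density on the cone *)

Section AreaMeasure.
Context {R : realType} {n : nat}.
Notation E := 'rV[R]_n.+1.
Variable rho : E -> R.
Hypothesis hrho : forall (l : R) (x : E), 0 < l -> rho (l *: x) = l * rho x.
Hypothesis prho : forall x : E, x != 0 -> 0 < rho x.
Hypothesis srho : smooth_on [set x : E | x != 0] rho.
Variable mu : {measure set E -> \bar R}.
Hypothesis hmu : area_measure [set x : E | rho x = 1] mu.

Let Sigma : set E := [set x : E | rho x = 1].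
Let phi (y : E) : E := (rho y)^-1 *: y.
(** The cone over an area element dA at [x] has volume [<x, nu> dA / (n + 1)], and
    [<x, nu> = 1 / |grad rho x|] by Euler's relation with [rho x = 1]. So the area measure is the
    image of this density under the radial projection. *)
Let g (y : E) : R := if 0 < rho y < 1 then n.+1%:R * enorm (grad rho y) else 0.

Let rho0 : rho 0 = 0. Proof. exact: gauge0. Qed.

Lemma rho_measurable : measurable_fun setT rho.
Proof. by apply: (@measurable_fun_off _ _ 0) => x; exact: rho_cont. Qed.

Lemma enorm_continuous m : continuous (@enorm R m).
Proof.
move=> x; apply: (@continuous_comp _ _ _ (fun x => dot x x) Num.sqrt); last exact: sqrt_continuous.
exact: (@dot_continuous _ _ _ (fun x : 'rV[R]_m => x) (fun x : 'rV[R]_m => x) x cvg_id cvg_id).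
Qed.

Lemma enorm_grad_measurable : measurable_fun setT (fun y : E => enorm (grad rho y)).
Proof.
apply: (@measurable_fun_off _ _ 0) => x x0.
by apply: (continuous_comp (grad_cont srho x0)); exact: enorm_continuous.
Qed.

Lemma radial_proj_measurable : measurable_fun setT phi.
Proof.
apply: measurable_fun_rV => i; apply: (@measurable_fun_off _ _ 0) => x x0.
have -> : (fun y => phi y 0 i) = (fun y => (rho y)^-1) \* (fun y : E => y 0 i).
  by apply/funext => y; rewrite /= mxE.
apply: continuousM; last exact: coord_continuous.
by apply: continuousV; [rewrite gt_eqF// prho|exact: rho_cont].
Qed.

Let mg : measurable_fun setT g.
Proof.
apply: measurable_fun_ifT => //.
  by apply: measurable_and; apply: measurable_fun_ltr => //; exact: rho_measurable.
by apply: measurable_funM => //; exact: enorm_grad_measurable.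
Qed.

Let g0 y : 0 <= g y. Proof. by rewrite /g; case: ifP => // _; rewrite mulr_ge0// sqrtr_ge0. Qed.

Let mphi B : measurable B -> measurable (phi @^-1` B).
Proof. by move=> mB; rewrite -[X in measurable X]setTI; exact: radial_proj_measurable. Qed.

Let stperm_det i b : `|\det (stperm i b : 'M[R]_n.+1)| = 1.
Proof.
have /(congr1 (fun x => `|x|)) := congr1 determinant (@stperm_sqr R n i b).
rewrite det_mulmx det1 normr1 normrM -expr2 => /eqP.
by rewrite sqrp_eq1// => /eqP.
Qed.

(** Within one chart [gram_pchart] gives the area density, and [cone_formula] with weight
    [enorm (grad rho)] on [B] and height [1 / rho (ray Q u)] converts it into a volume integral. *)
Let area_cone i b (B : set E) : measurable B -> B `<=` Sigma -> B `<=` pcone (stperm i b) ->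
  mu B = (\int[lebesgue_rV R n.+1]_(y in phi @^-1` B) (g y)%:E)%E.
Proof.
move=> mB BS BC; set Q : 'M[R]_n.+1 := stperm i b in BC *.
have uQ : Q \in unitmx by exact: stperm_unit.
set X := pchart rho Q; pose A := X @^-1` B.
have mX : measurable_fun setT X.
  apply: measurable_fun_rV => j; apply: continuous_measurable_rV => u.
  have : {for u, continuous (fun u => X u 0 j)}.
    by apply: (@Ck_continuous _ _ _ 0 setT); [exact: Ck_pchart|].
  by [].
have mA : measurable A by rewrite -[X in measurable X]setTI; exact: mX.
have XA : X @` A = B.
  apply/seteqP; split; first by move=> _ [u Au <-].
  move=> x Bx; have : (X @` setT) x.
    by rewrite /X pchart_image//; split; [exact: BS|split => //; exact: BC].
  by move=> [u _ ux]; exists u => //; rewrite /A /= ux.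
have rr u : 0 < rho (ray Q u) by apply: prho; exact: ray_neq0.
pose k (u : 'rV[R]_n) : R := \1_A u * enorm (grad rho (X u)).
pose bb (u : 'rV[R]_n) : R := (rho (ray Q u))^-1.
have X0 u : X u != 0 by apply: (rho_neq0 hrho); exact: pchart_in.
have mk : measurable_fun setT k.
  apply: measurable_funM; first exact: measurable_indic.
  exact: (measurableT_comp enorm_grad_measurable mX).
have mbb : measurable_fun setT bb.
  apply: continuous_measurable_rV => u; apply: continuousV; first by rewrite gt_eqF.
  have : {for u, continuous (fun u => rho (ray Q u))}.
    by apply: (@Ck_continuous _ _ _ 0 setT); [exact: Ck_rho_ray|].
  by [].
rewrite -XA; have [_ /(_ setT X) ->//] := hmu; last exact: pchart_chart.
under eq_integral do rewrite -/X gram_pchart// stperm_det mul1r.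
transitivity (\int[lebesgue_rV R n]_u (k u * bb u ^+ n.+1)%:E)%E.
  rewrite integral_mkcond; apply: eq_integral => u _; rewrite patchE /k indicE.
  by case: ifP => _; rewrite /= ?mul1r ?mul0r.
rewrite XA -cone_formula//; last 2 first.
- by move=> u; rewrite /k mulr_ge0// sqrtr_ge0.
- by move=> u; rewrite invr_gt0.
(* As a signed transposition [Q] preserves Lebesgue measure; it moves the cone of [Q] to the
   half-space [0 < z 0 0] used in [cone_formula]. *)
rewrite [RHS]integral_mkcond [RHS](@ge0_integral_aff _ _ ((-1) ^+ b) 0 (tperm 0 i)); last 3 first.
- by rewrite signr_eq0.
- by apply/(measurable_restrictT _ _).1; [exact: mphi|exact/measurable_EFinP/measurable_funTS].
- by move=> y; rewrite patchE; case: ifP => // _; rewrite lee_fin.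
rewrite normr_sign expr1n mul1e; apply: eq_integral => z _.
rewrite -mul_stperm -/Q; set y := z *m Q.
have zy : y *m invmx Q = z by rewrite /y mulmxK.
rewrite /= -[z 0 0]/((z : E) 0 0); set t := z 0 0.
have -> : t^-1 *: rsubmx (z : 'rV[R]_(1 + n)) = pcoord Q y by rewrite /pcoord zy.
set u := pcoord Q y; rewrite patchE.
have tP : pcone Q y <-> 0 < t by rewrite /pcone /= zy.
have [t0|t0] := ltP 0 t; last first.
  rewrite /=; case: ifP => // /set_mem By; rewrite /g; case: ifP => // /andP[ry _].
  have : pcone Q y.
    by apply/(@pconeZ _ _ Q (rho y)^-1); [rewrite invr_gt0|exact: BC].
  by move=> /tP; rewrite ltNge t0.
have yE : y = t *: ray Q u by rewrite /u [LHS](ray_pcoord uQ (tP.2 t0)) zy.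
have ry : rho y = t * rho (ray Q u) by rewrite yE hrho.
have ry0 : 0 < rho y by rewrite ry mulr_gt0.
have phiy : phi y = X u.
  rewrite /phi ry yE /X /pchart scalerA invfM mulrAC mulVf ?mul1r//.
  by rewrite gt_eqF.
have gy : grad rho y = grad rho (X u).
  by rewrite /X /pchart yE !rho_gradZ ?invr_gt0//; exact: ray_neq0.
have -> : (t < bb u) = (rho y < 1) by rewrite ry /bb -ltr_pdivlMr// div1r.
rewrite /= /g ry0 gy /k indicE.
have -> : (y \in phi @^-1` B) = (u \in A).
  by apply/idP/idP => /set_mem/= h; apply/mem_set; move: h; rewrite /A /= phiy.
by case: ifP => r1; case: ifP => uA; rewrite /= ?mul1r ?mul0r ?mulr0.
Qed.

(** The cones of the charts overlap, so the parts of [B] in successive cones are split off one at a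
    time. *)
Let area_sphere (B : set E) : measurable B -> B `<=` Sigma ->
  mu B = (\int[lebesgue_rV R n.+1]_(y in phi @^-1` B) (g y)%:E)%E.
Proof.
move=> mB BS.
suff H (s : seq ('I_n.+1 * bool)) : forall B : set E, measurable B -> B `<=` Sigma ->
    (forall x, B x -> exists2 q, q \in s & pcone (stperm q.1 q.2) x) ->
    mu B = (\int[lebesgue_rV R n.+1]_(y in phi @^-1` B) (g y)%:E)%E.
  apply: (H (index_enum _)) => // x Bx.
  have [i [b xib]] := pcone_cover (rho_neq0 hrho (BS _ Bx)).
  by exists (i, b) => //; rewrite mem_index_enum.
elim: s => [|q s IH] {mB BS}B mB BS Bs.
  have -> : B = set0 by apply/seteqP; split=> // x /Bs[].
  by rewrite measure0 preimage_set0 integral_set0.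
pose C : set E := pcone (stperm q.1 q.2).
have mC : measurable C by apply: open_measurable_rV; exact: pcone_open.
have -> : mu B = (mu (B `\` C) + mu (B `&` C))%E by exact: measureDI.
rewrite -[in RHS](setUIDK B C) setUC preimage_setU.
rewrite ge0_integral_setU//; last 5 first.
- by apply: mphi; exact: measurableD.
- by apply: mphi; exact: measurableI.
- exact/measurable_EFinP/measurable_funTS.
- by move=> y _; rewrite lee_fin.
- by apply/disj_setPS => y [[_ Cy] [_ /Cy]].
congr (_ + _)%E.
- apply: IH; [exact: measurableD|by move=> x [/BS]|].
  move=> x [Bx Cx]; have [q' + q'x] := Bs _ Bx.
  rewrite inE => /predU1P[q'q|q's]; last by exists q'.
  by case: Cx; rewrite /C -q'q.
- apply: (@area_cone q.1 q.2); first exact: measurableI.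
    by move=> x [/BS].
  by move=> x [].
Qed.

Lemma area_measureE (B : set E) : measurable B ->
  mu B = (\int[lebesgue_rV R n.+1]_(y in phi @^-1` B) (g y)%:E)%E.
Proof.
move=> mB.
have mS : measurable Sigma.
  rewrite (_ : Sigma = setT `&` rho @^-1` [set 1]); last by rewrite setTI.
  exact: rho_measurable.
have -> : mu B = (mu (B `\` Sigma) + mu (B `&` Sigma))%E by exact: measureDI.
rewrite (_ : mu (B `\` Sigma) = 0%E); last first.
  apply: (subset_measure0 (B := ~` Sigma)); [exact: measurableD|exact: measurableC|by move=> x []|].
  exact: hmu.1.
rewrite add0e area_sphere//; last exact: measurableI.
rewrite !(integral_mkcond (phi @^-1` _)); apply: eq_integral => y _; rewrite !patchE.
case: ifPn => [/set_mem[By _]|yB]; first by rewrite mem_set.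
case: ifPn => // /set_mem By; rewrite /g; case: ifP => // /andP[ry _].
exfalso; move/negP: yB; apply; apply/mem_set; split => //.
by rewrite /Sigma /= /phi hrho ?invr_gt0// mulVf// gt_eqF.
Qed.

Variables (F : E -> R) (Omega : set E).
Hypothesis hF : minkowski_norm F.
Hypothesis OmegaE : Omega = [set x | rho x < 1].
Hypothesis bOmega : boundary Omega = [set x | rho x = 1].

(* Polar coordinates: the 0-homogeneous extension of the integrand turns the surface integral into
   a volume integral over Omega. *)
Lemma aniso_integralE (f : E -> R) : continuous f -> (forall x, 0 <= f x) ->
  aniso_integral F Omega mu f =
  Int (fun y => if 0 < rho y < 1 then n.+1%:R * (f (phi y) * F (grad rho y)) else 0).
Proof.
move=> cf f0.
have F0 y : 0 <= F y by exact: gauge_ge0 (minkowski_homogeneous hF) (minkowski_gt0 hF) y.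
pose h (x : E) : R := f x * (F (grad rho x) / enorm (grad rho x)).
have h0 x : 0 <= h x by rewrite /h !mulr_ge0// invr_ge0 sqrtr_ge0.
have mh : measurable_fun setT h.
  apply: (@measurable_fun_off _ _ 0) => x x0; apply: continuousM; first exact: cf.
  apply: continuousM.
    apply: (continuous_comp (grad_cont srho x0)); apply: mink_cont => //.
    exact: (rho_grad_neq0 hrho prho srho).
  apply: continuousV.
    by rewrite gt_eqF// enorm_gt0// (rho_grad_neq0 hrho prho srho).
  by apply: (continuous_comp (grad_cont srho x0)); exact: enorm_continuous.
have mS : measurable Sigma.
  rewrite (_ : Sigma = setT `&` rho @^-1` [set 1]); last by rewrite setTI.
  exact: rho_measurable.
rewrite /aniso_integral /Int /Rintegral bOmega; congr fine.
transitivity (\int[mu]_x ((fun x => (h x)%:E) \_ Sigma) x)%E.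
  rewrite -integral_mkcond; apply: eq_integral => x /set_mem rx.
  have x0 := rho_neq0 hrho rx.
  rewrite (outward_normalE hrho prho srho OmegaE bOmega)// (minkowski_homogeneous hF); last first.
    by rewrite invr_gt0 enorm_gt0// (rho_grad_neq0 hrho prho srho).
  by rewrite /h [X in _ = (_ * X)%:E]mulrC.
rewrite (ge0_integral_image_density radial_proj_measurable mg g0 area_measureE); last 2 first.
- by apply/(measurable_restrictT _ _).1 => //; exact/measurable_EFinP/measurable_funTS.
- by move=> y; rewrite patchE; case: ifP => // _; rewrite lee_fin.
apply: eq_integral => y _; rewrite patchE /g; have [/andP[ry _]|_] := boolP (0 < rho y < 1); last first.
  by rewrite mule0.
have y0 : y != 0 by apply: contraTneq ry => ->; rewrite rho0 ltxx.
rewrite mem_set; last by rewrite /Sigma /= hrho ?invr_gt0// mulVf// gt_eqF.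
rewrite -EFinM /h rho_gradZ ?invr_gt0//; congr (_%:E).
have ep : enorm (grad rho y) != 0 by rewrite gt_eqF// enorm_gt0// (rho_grad_neq0 hrho prho srho).
by field.
Qed.

End AreaMeasure.

(** * Null sets, the divergence theorem and thin shells *)

Section NullSets.
Context {R : realType} {m : nat}.
Notation E := 'rV[R]_m.
Implicit Types (f g : E -> R) (N A : set E).

Lemma lebesgue_rV_nullU A N : measurable A /\ lebesgue_rV R m A = 0%E ->
  measurable N /\ lebesgue_rV R m N = 0%E -> measurable (A `|` N) /\ lebesgue_rV R m (A `|` N) = 0%E.
Proof.
move=> [mA A0] [mN N0]; split; first exact: measurableU.
have H : (lebesgue_rV R m (A `|` N) <= lebesgue_rV R m A + lebesgue_rV R m N)%E by exact: measureU2.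
by apply/eqP; rewrite -measure_le0; apply: le_trans H _; rewrite A0 N0 adde0.
Qed.

Lemma Int_ae f g N : measurable N -> lebesgue_rV R m N = 0%E -> bmeas f -> bmeas g ->
  (forall x, ~ N x -> f x = g x) -> Int f = Int g.
Proof.
move=> mN N0 [mf _] [mg _] fg; rewrite /Int /Rintegral; congr fine.
apply: ae_eq_integral => //; [exact/measurable_EFinP|exact/measurable_EFinP|].
exists N; split => // x /= H; apply: contrapT => Nx; apply: H => _.
by rewrite fg.
Qed.

Lemma bmeas_off f N : measurable N -> bmeas f -> bmeas (fun x => \1_(~` N) x * f x).
Proof.
move=> mN bf; under eq_fun do rewrite mulrC; apply: bmeasM => //.
  by apply: measurable_indic; exact: measurableC.
by exists 1 => x _; rewrite indicE; case: (_ \in _); rewrite ?normr1// normr0.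
Qed.

Lemma Int_off f N : measurable N -> lebesgue_rV R m N = 0%E -> bmeas f ->
  Int (fun x => \1_(~` N) x * f x) = Int f.
Proof.
move=> mN N0 bf; apply: (Int_ae mN N0) => //; first exact: bmeas_off.
by move=> x Nx; rewrite indicE mem_set// mul1r.
Qed.

Lemma le_Int_ae f g N : measurable N -> lebesgue_rV R m N = 0%E -> bmeas f -> bmeas g ->
  (forall x, ~ N x -> f x <= g x) -> Int f <= Int g.
Proof.
move=> mN N0 bf bg fg; rewrite -(Int_off mN N0 bf) -(Int_off mN N0 bg).
apply: le_Int => [| |x]; [exact: bmeas_off|exact: bmeas_off|].
rewrite indicE; have [|] := boolP (x \in ~` N); last by rewrite !mul0r.
by rewrite inE/= => Nx; rewrite !mul1r fg.
Qed.

Lemma lebesgue_rV_open_gt0 (U : set E) x : open U -> U x -> (0 < lebesgue_rV R m U)%E.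
Proof.
move=> oU Ux; have /nbhs_ballP[r /= r0 rU] := open_nbhs_nbhs (conj oU Ux).
pose A (i : 'I_m) : set (measurableTypeR R) := `[x 0 i, x 0 i + r / 2]%classic.
pose B := [set y : E | forall i, A i (y 0 i)].
have mA i : measurable (A i) by exact: measurable_itv.
have mB : measurable B by exact: (@measurable_box _ _ A).
have r2 : 0 < r / 2 by rewrite divr_gt0.
apply: (@lt_le_trans _ _ (lebesgue_rV R m B)).
  rewrite lebesgue_rV_box//.
  have -> : (\prod_(i < m) lebesgue_measure (A i) = \prod_(i < m) (r / 2)%:E)%E.
    apply: eq_bigr => i _; rewrite /A lebesgue_measure_itv/= lte_fin ltrDl r2 -EFinB.
    by congr (_%:E); ring.
  by rewrite prodEFin lte_fin prodr_gt0.
apply: le_measure; rewrite ?inE//; first exact: open_measurable_rV.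
move=> y By; apply: rU; rewrite -ball_normE/= normrV_lt//; apply/forallP => i.
have := By i; rewrite /A /= in_itv/= !mxE => /andP[a b].
rewrite distrC ger0_norm ?subr_ge0// ltrBlDl (le_lt_trans b)// ltrD2l.
by rewrite ltr_pdivrMr// mulr_natr mulr2n ltrDl.
Qed.

Lemma Int_gt0 f N (U : set E) x (c : R) : measurable N -> lebesgue_rV R m N = 0%E ->
  bmeas f -> (forall y, ~ N y -> 0 <= f y) -> open U -> U x -> 0 < c ->
  (forall y, U y -> ~ N y -> c <= f y) -> 0 < Int f.
Proof.
move=> mN N0 bf f0 oU Ux c0 cf.
have /nbhs_ballP[r /= r0 rU] := open_nbhs_nbhs (conj oU Ux).
have oB : open (ball x r) by exact: ball_open.
have mB : measurable (ball x r) by exact: open_measurable_rV.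
have bB : bounded_set (ball x r).
  exists (`|x| + r); split; first exact: num_real.
  move=> M xM y; rewrite -ball_normE/= => xy; rewrite (le_trans _ (ltW xM))//.
  rewrite -[y](subKr x) (le_trans (ler_normB _ _))// lerD2l ltW//.
have bi : bmeas (\1_(ball x r) : E -> R) by exact: bmeas_indic.
apply: (@lt_le_trans _ _ (Int (fun y => c * \1_(ball x r) y))).
  rewrite IntZ// Int_indic// mulr_gt0// /Vol fine_gt0//.
  rewrite (@lebesgue_rV_open_gt0 _ x)//; last exact: ballxx.
  have [M [_ BM]] := bB.
  apply: (@lebesgue_rV_bounded _ _ _ (M + 1)) => // y; apply: BM.
  by rewrite ltrDl.
apply: (le_Int_ae mN N0) => //; first exact: bmeasZ.
move=> y Ny; rewrite indicE; have [|] := boolP (y \in _); last by rewrite mulr0 f0.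
by rewrite inE mulr1 => yB; apply: cf => //; exact: rU.
Qed.

(** Off [N] the functions [df i] are derivatives of Lipschitz functions and hence bounded; on [N]
    nothing is known about their size, so they are set to 0 there by the indicator. *)
Lemma divergence_Int (f df : 'I_m -> E -> R) N (M : R) :
  (forall i x, loclip (f i) x) -> (forall i x, M < `|x| -> f i x = 0) ->
  measurable N -> lebesgue_rV R m N = 0%E -> (forall i, measurable_fun setT (df i)) ->
  (forall i x, ~ N x -> is_derive x (delta_mx 0 i : E) (f i) (df i x)) ->
  bmeas (fun x => \1_(~` N) x * \sum_i df i x) /\ Int (fun x => \1_(~` N) x * \sum_i df i x) = 0.
Proof.
move=> lf f0 mN N0 mdf dfE.
pose g i x := \1_(~` N) x * df i x.
have mg i : measurable_fun setT (g i).
  by apply: measurable_funM => //; apply: measurable_indic; exact: measurableC.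
have bg i : bmeas (g i).
  split => //; have [K [K0 fK]] := loclip_lipschitz (lf i) (f0 i).
  pose v : E := delta_mx 0 i.
  have ub (x : E) d : is_derive x v (f i) d -> `|d| <= K * `|v|.
    move=> dd; rewrite ler_norml; apply/andP; split.
      rewrite lerNl; apply: (@derive_ub _ _ (- f i) x v _ _ (is_deriveN dd)).
      move=> t /andP[t0 _]; rewrite [leLHS](_ : _ = f i x - f i (x + t *: v)); last first.
        by rewrite opprK addrC.
      apply: le_trans (ler_norm _) _; apply: le_trans (fK _ _) _.
      by rewrite opprD addrA subrr add0r normrN normrZ gtr0_norm// mulrCA.
    apply: (@derive_ub _ _ (f i) x v _ _ dd) => t /andP[t0 _].
    apply: le_trans (ler_norm _) _; apply: le_trans (fK _ _) _.
    by rewrite addrAC subrr add0r normrZ gtr0_norm// mulrCA.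
  exists (K * `|v| + `|M|); split => x.
    rewrite /g indicE; have [|_] := boolP (x \in _).
      by rewrite inE/= mul1r => Nx; rewrite (le_trans (ub _ _ (dfE i x Nx)))// lerDl.
    by rewrite mul0r normr0 addr_ge0// mulr_ge0.
  move=> xM; rewrite /g indicE; have [|_] := boolP (x \in _); last by rewrite mul0r.
  rewrite inE/= mul1r => Nx.
  have {}xM : M < `|x|.
    by apply: le_lt_trans xM; rewrite (le_trans (ler_norm M))// lerDr mulr_ge0.
  have -> : df i x = 'D_v (f i) x by have [_ ->] := dfE i x Nx.
  have -> : 'D_v (f i) x = 'D_v (cst 0 : E -> R) x.
    apply: near_eq_derive.
    have oM : open [set y : E | M < `|y|] by apply: open_superlevel; exact: norm_continuous.
    have : \forall y \near x, M < `|y| by exact: open_nbhs_nbhs (conj oM xM).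
    by apply: filterS => y /f0 ->.
  by rewrite derive_cst.
have -> : (fun x => \1_(~` N) x * \sum_i df i x) = (fun x => \sum_i g i x).
  by apply/funext => x; rewrite mulr_sumr.
split; first exact: bmeas_sum.
rewrite Int_sum// big1// => i _.
apply: (@Int_derive0 _ _ (f i) _ (delta_mx 0 i) N M) => //.
  by move=> x; exact: f0.
by move=> x Nx; rewrite /g indicE mem_set// mul1r; exact: dfE.
Qed.

End NullSets.

Lemma measurable_rV_point (R : realType) m (p : 'rV[R]_m) : measurable [set p].
Proof.
apply: closed_measurable_rV.
exact/accessible_closed_set1/hausdorff_accessible/norm_hausdorff.
Qed.

(** * Balls and spheres of a gauge *)

Section LevelSets.
Context {R : realType} {n : nat}.
Notation E := 'rV[R]_n.+1.

Lemma lebesgue_rV_point (p : E) : lebesgue_rV R n.+1 [set p] = 0%E.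
Proof.
rewrite (_ : [set p] = [set x : E | forall i, [set p 0 i] (x 0 i)]); last first.
  by apply/seteqP; split=> [x -> //|x H]; apply/rowP => i; exact: H.
rewrite (@lebesgue_rV_box _ _ (fun i => [set p 0 i])).
  by rewrite big_ord_recl lebesgue_measure_set1 mul0e.
by move=> i; exact: measurable_set1.
Qed.

Variable G : E -> R.
Hypothesis hG : forall (l : R) (x : E), 0 < l -> G (l *: x) = l * G x.
Hypothesis pG : forall x : E, x != 0 -> 0 < G x.
Hypothesis cG : forall x : E, x != 0 -> {for x, continuous G}.
Variable P : E.

Lemma measurable_gauge : measurable_fun setT (fun x : E => G (x - P)).
Proof.
apply: continuous_measurable_rV => x; apply: continuous_comp.
  by apply: continuousB; [exact: cvg_id|exact: cst_continuous].
exact: gauge_continuous.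
Qed.

Lemma measurable_gauge_lt (S : R) : measurable [set x : E | G (x - P) < S].
Proof.
have := measurable_gauge measurableT (measurable_itv `]-oo, S[%R).
by rewrite setTI (_ : _ @^-1` _ = [set x : E | G (x - P) < S])//.
Qed.

Lemma measurable_gauge_eq (S : R) : measurable [set x : E | G (x - P) = S].
Proof.
by have := measurable_gauge measurableT (measurable_set1 S); rewrite setTI.
Qed.

Lemma gauge_lt_bounded (S : R) : exists M : R, forall x : E, G (x - P) < S -> `|x| <= M.
Proof.
have [c [C [c0 C0 H]]] := gauge_bounds hG pG cG.
exists (c^-1 * S + `|P|) => x xS; rewrite -(subrK P x) (le_trans (ler_normD _ _))// lerD2r.
rewrite mulrC ler_pdivlMr// mulrC; apply: le_trans (ltW xS).
by have /andP[] := H (x - P).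
Qed.

Lemma bmeas_gauge_lt (S : R) : bmeas (\1_[set x : E | G (x - P) < S] : E -> R).
Proof.
apply: bmeas_indic; first exact: measurable_gauge_lt.
have [M H] := gauge_lt_bounded S; exists M; split; first exact: num_real.
by move=> t Mt x /= /H xM; rewrite (le_trans xM)// ltW.
Qed.

Lemma vol_gauge_lt (S : R) : 0 < S ->
  Vol [set x : E | G (x - P) < S] = S ^+ n.+1 * Vol [set x : E | G x < 1].
Proof.
move=> S0; rewrite /Vol -(@lebesgue_rV_aff _ _ S P 1%g); last 2 first.
- by rewrite gt_eqF.
- exact: measurable_gauge_lt.
rewrite gtr0_norm// fineM//; last first.
  have mA : measurable (aff S P 1%g @^-1` [set x : E | G (x - P) < S]).
    by rewrite -[X in measurable X]setTI; apply: measurable_aff => //; exact: measurable_gauge_lt.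
  have [M H] := gauge_lt_bounded S.
  rewrite ge0_fin_numE//.
  apply: (@lebesgue_rV_bounded _ _ _ (S^-1 * (M + `|P|))) => // x /H /= xM.
  rewrite mulrC ler_pdivlMr// mulrC.
  have -> : S * `|x| = `|aff S P 1%g x - P|.
    rewrite -[in LHS](gtr0_norm S0) -normrZ; congr (`|_|); apply/rowP => i.
    by rewrite !mxE perm1 addrK.
  by rewrite (le_trans (ler_normB _ _))// lerD2r.
congr (_ * fine (lebesgue_rV R _ _)); apply/seteqP; split=> x /=.
  rewrite (_ : aff _ _ _ _ - P = S *: x) ?hG// ?gtr_pMr//.
  by apply/rowP => i; rewrite !mxE perm1 addrK.
rewrite (_ : aff _ _ _ _ - P = S *: x) ?hG// ?gtr_pMr//.
by apply/rowP => i; rewrite !mxE perm1 addrK.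
Qed.

(** The volume of the ball of radius [s] is a multiple of [s ^ (n + 1)], hence continuous in [s]; a
    sphere of positive measure would make it jump. *)
Lemma gauge_sphere_null (S : R) : 0 < S -> lebesgue_rV R n.+1 [set x : E | G (x - P) = S] = 0%E.
Proof.
move=> S0; set A := [set x : E | G (x - P) = S].
pose B s : set E := [set x : E | G (x - P) < s].
have mA : measurable A by exact: measurable_gauge_eq.
have mB s : measurable (B s) by exact: measurable_gauge_lt.
have fB s : lebesgue_rV R n.+1 (B s) \is a fin_num.
  have [M H] := gauge_lt_bounded s; rewrite ge0_fin_numE//.
  exact: (@lebesgue_rV_bounded _ _ _ M).
have BA s : S < s -> A `<=` B s by move=> Ss x; rewrite /A /B /= => ->.
have fA : lebesgue_rV R n.+1 A \is a fin_num.
  rewrite ge0_fin_numE// (@le_lt_trans _ _ (lebesgue_rV R n.+1 (B (S + 1))))//.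
    by apply: le_measure; rewrite ?inE//; apply: BA; rewrite ltrDl.
  by rewrite -ge0_fin_numE.
pose v := Vol [set x : E | G x < 1].
have key s : S < s -> S ^+ n.+1 * v + Vol A <= s ^+ n.+1 * v.
  move=> Ss; rewrite -!vol_gauge_lt//; last exact: lt_trans Ss.
  have AB : lebesgue_rV R n.+1 (B S `|` A) = (lebesgue_rV R n.+1 (B S) + lebesgue_rV R n.+1 A)%E.
    apply: measureU => //; apply/seteqP; split=> // x [].
    by rewrite /A /B /= => + e; rewrite e ltxx.
  rewrite -lee_fin EFinD /Vol !fineK ?fB// -AB.
  apply: le_measure; rewrite ?inE; [exact: (measurableU _ _ (mB S) mA)|exact: mB|].
  by move=> x [/= xS|/(BA _ Ss)//]; exact: lt_trans Ss.
suff : Vol A <= 0.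
  rewrite /Vol => H; have : (0 <= lebesgue_rV R n.+1 A)%E by [].
  rewrite -(fineK fA) lee_fin => H'; congr (_%:E); apply/eqP.
  by rewrite eq_le H H'.
rewrite leNgt; apply/negP => a0.
have : {for S, continuous (fun s : R => s ^+ n.+1 * v)}.
  by apply: cvgM; [exact: exprn_continuous|exact: cvg_cst].
move=> /cvgrPdist_lt/(_ _ a0)/nbhs_ballP[r /= r0 H].
have r2 : 0 < r / 2 by rewrite divr_gt0.
have /H/= : ball S r (S + r / 2).
  rewrite -ball_normE/= opprD addrA subrr add0r normrN gtr0_norm//.
  by rewrite ltr_pdivrMr// mulr_natr mulr2n ltrDl.
have := key (S + r / 2); rewrite ltrDl => /(_ r2) k1.
rewrite distrC => /(le_lt_trans (ler_norm _)); rewrite ltrBlDr [Vol A + _]addrC => k2.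
by have := le_lt_trans k1 k2; rewrite ltxx.
Qed.

End LevelSets.

(** * Integrals over thin shells *)

Section Shell.
Context {R : realType} {n : nat}.
Notation E := 'rV[R]_n.+1.
Variable G : E -> R.
Hypothesis hG : forall (l : R) (x : E), 0 < l -> G (l *: x) = l * G x.
Hypothesis pG : forall x : E, x != 0 -> 0 < G x.
Hypothesis cG : forall x : E, x != 0 -> {for x, continuous G}.

Definition on_cone (c : R) (h : E -> R) (x : E) : R := if 0 < G x < c then h x else 0.

(** Half-open, so as to be exactly the difference of the cones of heights [1 + d] and [1] and to
    match [dcutoff]. *)
Definition on_shell (d : R) (h : E -> R) (x : E) : R := if 1 <= G x < 1 + d then h x else 0.

Let mG : measurable_fun setT G.
Proof. by apply: continuous_measurable_rV; exact: gauge_continuous. Qed.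

Lemma bmeas_on_cone c (h : E -> R) : measurable_fun setT h ->
  (exists M : R, forall x, 0 < G x < c -> `|h x| <= M) -> bmeas (on_cone c h).
Proof.
move=> mh [M hM]; split.
  by apply: measurable_fun_ifT => //; apply: measurable_and; apply: measurable_fun_ltr.
have [K HK] := gauge_lt_bounded hG pG cG 0 c.
exists (`|M| + `|K|); split => x; rewrite /on_cone; case: ifP => // xc.
- by rewrite (le_trans (hM _ xc))// (le_trans (ler_norm M))// lerDl.
- by rewrite normr0 addr_ge0.
move=> Kx; have xK : `|x| <= K by apply: HK; rewrite subr0; case/andP: xc.
have := le_lt_trans (le_trans xK (ler_norm K)) (le_lt_trans _ Kx).
by rewrite lerDr normr_ge0 => /(_ isT); rewrite ltxx.
Qed.

Lemma on_shellE (d : R) (h : E -> R) (x : E) : 0 <= d -> on_shell d h x = on_cone (1 + d) h x - on_cone 1 h x.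
Proof.
move=> d0; rewrite /on_shell /on_cone.
have [x1|x1] := leP 1 (G x).
  by rewrite (lt_le_trans ltr01 x1) /= subr0.
have x2 : G x < 1 + d by rewrite (lt_le_trans x1)// lerDl.
by rewrite x2 /= !andbT subrr.
Qed.

Lemma Int_on_cone (c : R) (h : E -> R) : 0 < c -> (forall (l : R) (x : E), 0 < l -> h (l *: x) = h x) ->
  measurable_fun setT h -> (exists M : R, forall x, 0 < G x < c -> `|h x| <= M) ->
  Int (on_cone c h) = c ^+ n.+1 * Int (on_cone 1 h).
Proof.
move=> c0 hh mh bh.
have [_ ->] := @Int_aff _ _ c (0 : E) 1%g (on_cone c h) (lt0r_neq0 c0) (bmeas_on_cone mh bh).
rewrite gtr0_norm//; congr (_ * Int _); apply/funext => x /=.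
have -> : aff c 0 1%g x = c *: x by apply/rowP => i; rewrite !mxE perm1 addr0.
by rewrite /on_cone hG// hh// pmulr_rgt0// gtr_pMr.
Qed.

Variables (f w : E -> R) (C B : R).
Hypothesis fC : forall y z, `|f y - f z| <= C * `|y - z|.
Hypothesis C0 : 0 <= C.
Hypothesis mw : measurable_fun setT w.
Hypothesis hw : forall (l : R) (x : E), 0 < l -> w (l *: x) = w x.
Hypothesis w0 : forall x, 0 <= w x.
Hypothesis wB : forall x, 0 < G x -> w x <= B.

Lemma lipschitz_measurable : measurable_fun setT f.
Proof.
by apply: continuous_measurable_rV => x; apply: loclip_continuous; apply: loclip_lip fC.
Qed.

Let radial x := (G x)^-1 *: x.

Let radial_measurable : measurable_fun setT radial.
Proof.
apply: measurable_fun_rV => i; apply: (@measurable_fun_off _ _ 0) => x x0.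
have -> : (fun y => radial y 0 i) = (fun y => (G y)^-1) \* (fun y : E => y 0 i).
  by apply/funext => y; rewrite /= mxE.
apply: continuousM; last exact: coord_continuous.
by apply: continuousV; [rewrite gt_eqF// pG|exact: cG].
Qed.

Let h x := f (radial x) * w x.

Let mh : measurable_fun setT h.
Proof. by apply: measurable_funM => //; apply: (measurableT_comp lipschitz_measurable). Qed.

Let hh (l : R) (x : E) : 0 < l -> h (l *: x) = h x.
Proof.
move=> l0; rewrite /h hw// /radial hG// scalerA invfM mulrAC mulVf ?mul1r//.
by rewrite gt_eqF.
Qed.

Lemma lipschitz_growth x : `|f x| <= `|f 0| + C * `|x|.
Proof.
rewrite -[f x](subrK (f 0)) addrC (le_trans (ler_normD _ _))// lerD2l.
by rewrite (le_trans (fC _ _))// subr0.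
Qed.

Let B0 : 0 <= B.
Proof.
have [x x1] := @sphere_point R n; have x0 := sphere_neq0 x1.
by apply: le_trans (w0 x) (wB _); exact: pG.
Qed.

Let hbound : exists M : R, forall x, 0 < G x -> `|h x| <= M.
Proof.
have [c [C' [c0 _ Hb]]] := gauge_bounds hG pG cG.
exists ((`|f 0| + C * c^-1) * B) => x x0; rewrite /h normrM (ger0_norm (w0 x)).
apply: ler_pM => //; last exact: wB.
apply: (le_trans (lipschitz_growth _)); rewrite lerD2l ler_wpM2l//.
rewrite normrZ gtr0_norm ?invr_gt0// mulrC ler_pdivrMr// mulrC ler_pdivlMr// mulrC.
by have /andP[] := Hb x.
Qed.

Lemma bmeas_radial_cone : bmeas (on_cone 1 h).
Proof.
by apply: bmeas_on_cone => //; have [M HM] := hbound; exists M => x /andP[+ _]; exact: HM.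
Qed.

Let bshell (d : R) (g : E -> R) : 0 <= d -> measurable_fun setT g ->
  (exists M : R, forall x, 0 < G x < 1 + d -> `|g x| <= M) -> bmeas (on_shell d g).
Proof.
move=> d0 mg [M HM]; rewrite (_ : on_shell d g = (fun x => on_cone (1 + d) g x - on_cone 1 g x)).
  apply: bmeasB; apply: bmeas_on_cone => //; exists M => // x /andP[x0 x1]; apply: HM.
  by rewrite x0 (lt_le_trans x1)// lerDl.
by apply/funext => x; exact: on_shellE.
Qed.

Let Int_shell (d : R) (g : E -> R) : 0 <= d -> (forall (l : R) (x : E), 0 < l -> g (l *: x) = g x) ->
  measurable_fun setT g -> (exists M : R, forall x, 0 < G x -> `|g x| <= M) ->
  Int (on_shell d g) = ((1 + d) ^+ n.+1 - 1) * Int (on_cone 1 g).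
Proof.
move=> d0 hg mg [M HM].
have H c : exists M : R, forall x, 0 < G x < c -> `|g x| <= M.
  by exists M => x /andP[+ _]; exact: HM.
rewrite (_ : on_shell d g = (fun x => on_cone (1 + d) g x - on_cone 1 g x)); last first.
  by apply/funext => x; exact: on_shellE.
rewrite IntB; [|exact: bmeas_on_cone|exact: bmeas_on_cone].
by rewrite Int_on_cone// ?mulrBl ?mul1r// ltr_pwDl.
Qed.

Lemma bmeas_shell_product (d c : R) : 0 <= d -> bmeas (on_shell d (fun x => c * (f x * w x))).
Proof.
move=> d0; apply: bshell => //.
  by apply: measurable_funM => //; apply: measurable_funM => //; exact: lipschitz_measurable.
have [M HM] := gauge_lt_bounded hG pG cG 0 (1 + d).
exists (`|c| * ((`|f 0| + C * M) * B)) => x /andP[x0 x1].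
rewrite !normrM ler_wpM2l// ler_pM// ?(ger0_norm (w0 x)) ?wB//.
apply: (le_trans (lipschitz_growth _)); rewrite lerD2l ler_wpM2l// HM// subr0.
by [].
Qed.

Lemma shell_cvg :
  Int (on_shell (harmonic k) (fun x => (harmonic k)^-1 * (f x * w x))) @[k --> \oo] -->
  n.+1%:R * Int (on_cone 1 h).
Proof.
have [c [C' [c0 _ Hb]]] := gauge_bounds hG pG cG.
(* The quotient [((1 + d) ^ (n + 1) - 1) / d] as a geometric sum, which is continuous at 0 with
   value [n + 1]. *)
pose q (d : R) := \sum_(i < n.+1) (1 + d) ^+ i.
have qE (d : R) : (1 + d) ^+ n.+1 - 1 = d * q d by rewrite subrX1 addrAC subrr add0r.
have qc : q (harmonic k) @[k --> \oo] --> (n.+1%:R : R).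
  have -> : n.+1%:R = q 0 :> R.
    rewrite /q addr0; under eq_bigr do rewrite expr1n.
    by rewrite sumr_const card_ord.
  apply: (@cvg_comp _ _ _ (@harmonic R) q _ (nbhs (0 : R)) _ cvg_harmonic).
  have : {for (0 : R), continuous q}; last exact.
  apply: continuous_sumR => i.
  apply: (@continuous_comp _ _ _ (fun d : R => 1 + d) (fun d => d ^+ i)); last exact: exprn_continuous.
  by apply: continuousD; [exact: cst_continuous|exact: cvg_id].
have bw : exists M : R, forall x, 0 < G x -> `|w x| <= M.
  by exists B => x x0; rewrite ger0_norm ?wB.
set K := Int (on_cone 1 h); set K1 := Int (on_cone 1 w).
(* On a shell of width at most 1, [c |x| <= G x <= 2]; hence [|x - radial x| <= (2 / c) d] there. *)
pose D := C * (2 / c).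
have bounds k : let d := harmonic k in
    q d * K - D * (d * q d * K1) <= Int (on_shell d (fun x => d^-1 * (f x * w x))) <=
    q d * K + D * (d * q d * K1).
  move=> d; have d0 : 0 < d by exact: harmonic_gt0.
  have d1 : d <= 1 by rewrite /d /harmonic /= invf_le1// ler1n.
  have dd : d != 0 by rewrite gt_eqF.
  have Eh : q d * K = d^-1 * Int (on_shell d h).
    by rewrite Int_shell//= ?ltW// qE -/K mulrA mulrA mulVf// mul1r.
  have Ew : d * q d * K1 = Int (on_shell d w).
    by rewrite Int_shell//= ?ltW// qE.
  have bh : bmeas (on_shell d h).
    by apply: bshell => //; [exact: ltW|have [M HM] := hbound; exists M => x /andP[+ _]; exact: HM].
  have bww : bmeas (on_shell d w).
    by apply: bshell => //; [exact: ltW|have [M HM] := bw; exists M => x /andP[+ _]; exact: HM].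
  have est x : 1 <= G x < 1 + d -> `|d^-1 * (f x * w x) - d^-1 * h x| <= D * w x.
    move=> /andP[x1 x2]; have x0 : 0 < G x by exact: lt_le_trans x1.
    rewrite -mulrBr /h -mulrBl !normrM (ger0_norm (w0 x)) mulrA ler_wpM2r//.
    rewrite gtr0_norm ?invr_gt0// mulrC ler_pdivrMr//.
    apply: le_trans (fC _ _) _; rewrite /D -mulrA ler_wpM2l//.
    have -> : x - radial x = ((G x - 1) / G x) *: x.
      by rewrite mulrBl mulfV ?gt_eqF// scalerBl scale1r mul1r.
    rewrite normrZ mulrC normrM normfV (gtr0_norm x0) ger0_norm ?subr_ge0//.
    apply: ler_pM => //; first by rewrite mulr_ge0// ?subr_ge0// invr_ge0 ltW.
      rewrite ler_pdivlMr// mulrC; have /andP[+ _] := Hb x => /le_trans; apply.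
      by rewrite (le_trans (ltW x2))// -[2%:R]/(1 + 1 : R) lerD2l.
    rewrite ler_pdivrMr// (@le_trans _ _ d) ?lerBlDl ?(ltW x2)//.
    by rewrite ler_peMr// ltW.
  rewrite Eh Ew -!IntZ//; apply/andP; split.
    rewrite -IntB; [|exact: bmeasZ|exact: bmeasZ].
    apply: le_Int => [| |x]; [by apply: bmeasB; exact: bmeasZ|by apply: bmeas_shell_product; exact: ltW|].
    rewrite /on_shell; case: ifP => [/est|]; last by rewrite !mulr0 subrr.
    by rewrite distrC => /ler_distlDr; rewrite lerBlDr.
  rewrite -IntD; [|exact: bmeasZ|exact: bmeasZ].
  apply: le_Int => [| |x]; [by apply: bmeas_shell_product; exact: ltW|by apply: bmeasD; exact: bmeasZ|].
  rewrite /on_shell; case: ifP => [/est|]; last by rewrite !mulr0 addr0.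
  by move=> /ler_distlDr.
have lim0 : D * (harmonic k * q (harmonic k) * K1) @[k --> \oo] --> (0 : R).
  rewrite -(mulr0 D) -(mul0r K1) -(mul0r n.+1%:R).
  apply: cvgM; first exact: cvg_cst.
  by apply: cvgM; [apply: cvgM; [exact: cvg_harmonic|exact: qc]|exact: cvg_cst].
have limK : q (harmonic k) * K @[k --> \oo] --> n.+1%:R * K by apply: cvgM; [exact: qc|exact: cvg_cst].
apply: (@squeeze_cvgr _ _ _ _ (fun k => q (harmonic k) * K - D * (harmonic k * q (harmonic k) * K1))
  (fun k => q (harmonic k) * K + D * (harmonic k * q (harmonic k) * K1))).
- by apply: nearW => k; exact: bounds.
- by rewrite -[X in _ --> X]subr0; apply: cvgB.
- by rewrite -[X in _ --> X]addr0; apply: cvgD.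
Qed.

End Shell.

(** * The calibration inequality *)

Section Cutoff.
Context {R : realType}.
Implicit Types (d s t S : R).

Lemma max_lip (a s t : R) : `|Num.max a s - Num.max a t| <= `|s - t|.
Proof.
wlog st : s t / t <= s => [H|].
  by case/orP: (le_total s t) => /H //; rewrite distrC [X in _ <= X]distrC.
rewrite !ger0_norm ?subr_ge0 ?ge_max ?le_max ?lexx ?st ?orbT//.
by case: (leP a s) => ?; case: (leP a t) => ?; lra.
Qed.

Lemma min_lip (a s t : R) : `|Num.min a s - Num.min a t| <= `|s - t|.
Proof.
wlog st : s t / t <= s => [H|].
  by case/orP: (le_total s t) => /H //; rewrite distrC [X in _ <= X]distrC.
rewrite !ger0_norm ?subr_ge0 ?le_min ?ge_min ?lexx ?st ?orbT//.
by case: (leP a s) => ?; case: (leP a t) => ?; lra.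
Qed.

(** Composed with [rho] it vanishes on Omega and equals 1 beyond the shell; its slope [1 / d] is the
    factor that turns shell integrals into surface integrals in [shell_cvg]. *)
Definition cutoff d s : R := Num.max 0 (Num.min 1 ((s - 1) / d)).

Lemma cutoff_lip d s t : 0 < d -> `|cutoff d s - cutoff d t| <= d^-1 * `|s - t|.
Proof.
move=> d0; apply: le_trans (max_lip _ _ _) _; apply: le_trans (min_lip _ _ _) _.
rewrite -mulrBl opprB addrA subrK normrM mulrC ler_wpM2r//.
by rewrite gtr0_norm ?invr_gt0.
Qed.

Lemma cutoff_ge0 d s : 0 <= cutoff d s. Proof. by rewrite le_max lexx. Qed.

Lemma cutoff_le1 d s : cutoff d s <= 1.
Proof. by rewrite ge_max ler01 ge_min lexx. Qed.

Lemma cutoff0 d s : 0 < d -> s <= 1 -> cutoff d s = 0.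
Proof.
move=> d0 s1; apply/max_idPl; rewrite ge_min; apply/orP; right.
by rewrite pmulr_lle0 ?invr_gt0// subr_le0.
Qed.

Lemma cutoff1 d s : 0 < d -> 1 + d <= s -> cutoff d s = 1.
Proof.
move=> d0 sd; rewrite /cutoff (min_idPl _); first by apply/max_idPr.
by rewrite ler_pdivlMr// mul1r lerBrDl.
Qed.

Lemma cutoff_mid d s : 0 < d -> 1 <= s -> s <= 1 + d -> cutoff d s = (s - 1) / d.
Proof.
move=> d0 s1 sd; rewrite /cutoff (min_idPr _).
  by apply/max_idPr; rewrite divr_ge0 ?subr_ge0// ltW.
by rewrite ler_pdivrMr// mul1r lerBlDl.
Qed.

Lemma cutoff_gt0 d s : 0 < d -> 1 < s -> 0 < cutoff d s.
Proof. by move=> d0 s1; rewrite lt_max lt_min ltr01 divr_gt0 ?subr_gt0// orbT. Qed.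

Lemma cutoff_anti d d' s : 0 < d -> d <= d' -> cutoff d' s <= cutoff d s.
Proof.
move=> d0 dd; have d'0 := lt_le_trans d0 dd.
have [s1|s1] := leP s 1; first by rewrite !cutoff0.
rewrite /cutoff ge_max le_max lexx /= le_max; apply/orP; right.
rewrite le_min ge_min lexx /= ge_min; apply/orP; right.
apply: ler_wpM2l; first by rewrite subr_ge0 ltW.
by rewrite lef_pV2// posrE.
Qed.

Definition dcutoff d s : R := if 1 <= s < 1 + d then d^-1 else 0.

Lemma is_derive_cutoff d s : 0 < d -> s != 1 -> s != 1 + d ->
  is_derive s 1 (cutoff d) (dcutoff d s).
Proof.
move=> d0 s1 sd; rewrite /dcutoff; have [l1|l1] := ltP s 1 => /=.
  apply: (@near_eq_is_derive _ _ _ (cst 0) _ _ _ _ _ (is_derive_cst _ _ _)).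
  near=> u; rewrite cutoff0//; apply/ltW.
  by near: u; exact: lt_nbhsl.
have {s1}l1 : 1 < s by rewrite lt_neqAle eq_sym s1.
have [l2|l2] := ltP s (1 + d).
  suff H : is_derive s 1 (fun u => (u - 1) * d^-1) d^-1.
    apply: (near_eq_is_derive _ H); near=> u; rewrite cutoff_mid//; apply/ltW; near: u; [exact: lt_nbhsr|exact: lt_nbhsl].
  have -> : (fun u => (u - 1) * d^-1) = (id - cst 1) * cst d^-1 by [].
  apply: is_derive_eq.
  by rewrite scaler0 add0r subr0 /cst /= -[_ *: _]/(_ * _) mulr1.
have {sd}l2 : 1 + d < s by rewrite lt_neqAle eq_sym sd.
apply: (@near_eq_is_derive _ _ _ (cst (1 : R) : R -> R) _ _ _ _ _ (is_derive_cst (1 : R) s 1)).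
near=> u; rewrite cutoff1//; apply/ltW; near: u; exact: lt_nbhsr.
Unshelve. all: by end_near. Qed.

Lemma is_derive_pos_part s : s != 0 -> is_derive s 1 (fun u : R => Num.max 0 u) (if 0 < s then 1 else 0).
Proof.
move=> s0; have [l|l] := ltP 0 s.
  apply: (@near_eq_is_derive _ _ _ id _ _ _ _ _ (is_derive_id _ _)).
  near=> u; apply/esym/max_idPr/ltW; near: u; exact: lt_nbhsr.
have {s0}l : s < 0 by rewrite lt_neqAle s0.
apply: (@near_eq_is_derive _ _ _ (cst 0) _ _ _ _ _ (is_derive_cst _ _ _)).
near=> u; apply/esym/max_idPl/ltW; near: u; exact: lt_nbhsl.
Unshelve. all: by end_near. Qed.

(* Multiplying x - P by [shrink S (F^0 (x - P))] retracts it towards P by the Wulff ball of radius S. *)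
Definition shrink S t : R := 1 - S / Num.max S t.

Lemma shrink_lip S s t : 0 < S -> `|shrink S s - shrink S t| <= S^-1 * `|s - t|.
Proof.
move=> S0; rewrite /shrink.
have [a0 aS] : 0 < Num.max S s /\ S <= Num.max S s by rewrite lt_max S0 le_max lexx.
have [b0 bS] : 0 < Num.max S t /\ S <= Num.max S t by rewrite lt_max S0 le_max lexx.
apply: le_trans (ler_wpM2l _ (max_lip S s t)); last by rewrite invr_ge0 ltW.
set a := Num.max S s in a0 aS *; set b := Num.max S t in b0 bS *.
have -> : 1 - S / a - (1 - S / b) = S / (a * b) * (a - b).
  by field; rewrite !gt_eqF.
rewrite normrM ler_wpM2r// gtr0_norm ?divr_gt0 ?mulr_gt0//.
rewrite ler_pdivrMr ?mulr_gt0// mulrC ler_pdivlMr//.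
by rewrite ler_pM// ltW.
Qed.

Lemma shrink0 S t : 0 < S -> t <= S -> shrink S t = 0.
Proof. by move=> S0 tS; rewrite /shrink (max_idPl tS) divff ?subrr// gt_eqF. Qed.

Lemma shrinkE S t : S <= t -> shrink S t = 1 - S / t.
Proof. by move=> tS; rewrite /shrink (max_idPr tS). Qed.

Lemma shrink_ge0 S t : 0 < S -> 0 <= shrink S t.
Proof.
move=> S0; have [tS|/ltW St] := leP t S; first by rewrite shrink0.
by rewrite shrinkE// subr_ge0 ler_pdivrMr ?mul1r// (lt_le_trans S0).
Qed.

Lemma shrink_le1 S t : 0 < S -> shrink S t <= 1.
Proof. by move=> S0; rewrite /shrink gerBl divr_ge0 ?ltW// lt_max S0. Qed.

Lemma shrink_mul S t : 0 < S -> shrink S t * t = Num.max 0 (t - S).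
Proof.
move=> S0; have [tS|St] := leP t S.
  by rewrite shrink0// mul0r (max_idPl _)// subr_le0.
rewrite shrinkE ?ltW// mulrBl mul1r divfK ?gt_eqF ?(lt_trans S0)//.
by rewrite (max_idPr _)// subr_ge0 ltW.
Qed.

Lemma is_derive_shrink S t : 0 < S -> t != S ->
  is_derive t 1 (shrink S) (if S < t then S / t ^+ 2 else 0).
Proof.
move=> S0 tS; have [l|l] := ltP S t.
  have t0 := lt_trans S0 l.
  suff H : is_derive t 1 (fun u => 1 - S * u^-1) (S / t ^+ 2).
    by apply: (near_eq_is_derive _ H); near=> u; rewrite shrinkE//; apply/ltW; near: u; exact: lt_nbhsr.
  have -> : (fun u => 1 - S * u^-1) = cst 1 - cst S * (fun u : R => u^-1) by [].
  have H : is_derive t 1 (fun u : R => u^-1) (- t ^- 2 *: 1).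
    by apply: is_deriveV; rewrite gt_eqF.
  apply: is_derive_eq.
  by rewrite scaler0 addr0 /cst /= sub0r -[_ *: _]/(_ * _) -[_ *: 1]/(_ * 1) mulr1 mulrN opprK.
have {tS}l : t < S by rewrite lt_neqAle tS.
apply: (@near_eq_is_derive _ _ _ (cst 0) _ _ _ _ _ (is_derive_cst _ _ _)).
near=> u; rewrite shrink0//; apply/ltW; near: u; exact: lt_nbhsl.
Unshelve. all: by end_near. Qed.

End Cutoff.

Lemma is_derive_mul (R : realType) (V : normedModType R) (f g : V -> R) (x v : V) (df dg : R) :
  is_derive x v f df -> is_derive x v g dg ->
  is_derive x v (fun y => f y * g y) (df * g x + f x * dg).
Proof.
move=> Hf Hg; have -> : df * g x + f x * dg = f x *: dg + g x *: df.
  by rewrite addrC [df * _]mulrC.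
exact: is_deriveM.
Qed.

(** * The two divergence estimates and their defects *)

Section Calibration.
Context {R : realType} {n : nat}.
Notation E := 'rV[R]_n.+1.
Variable rho : E -> R.
Hypothesis hrho : forall (l : R) (x : E), 0 < l -> rho (l *: x) = l * rho x.
Hypothesis prho : forall x : E, x != 0 -> 0 < rho x.
Hypothesis srho : smooth_on [set x : E | x != 0] rho.
Variable F : E -> R.
Hypothesis hF : minkowski_norm F.
Variables (P : E) (S : R).
Hypothesis S0 : 0 < S.
Implicit Types (x y v : E) (d : R).

Let W (x : E) : R := dual_norm F (x - P).
Let p (x : E) : E := grad rho x.
Let Nf (x : E) : E := gfield rho F x.
Let leg (x : E) : E := legendre F (x - P).
Let phi (x : E) : R := Num.max 0 (S - W x).
Let psi (x : E) : R := Num.max 0 (W x - S).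

(** Up to the factor [n + 1] this is the density of [d mu_F] on the cone: the Euclidean length of
    the gradient cancels in [F(nu) |grad rho|]. *)
Definition aniso_density (x : E) : R := F (grad rho x).
Local Notation w := aniso_density.

Let hW (l : R) x : 0 < l -> dual_norm F (l *: x) = l * dual_norm F x. Proof. exact: dual_homog. Qed.
Let pW x : x != 0 -> 0 < dual_norm F x. Proof. exact: dual_gt0. Qed.
Let cW x : x != 0 -> {for x, continuous (dual_norm F)}. Proof. by move=> _; exact: dual_continuous. Qed.
Let cr x : x != 0 -> {for x, continuous rho}. Proof. exact: rho_cont. Qed.
Let p0 x : x != 0 -> p x != 0. Proof. by move=> x0; exact: (rho_grad_neq0 hrho prho srho). Qed.

Lemma density_gradZ (l : R) x : 0 < l -> w (l *: x) = w x.
Proof.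
move=> l0; have [->|x0] := eqVneq x 0; first by rewrite scaler0.
by rewrite /w rho_gradZ.
Qed.

Lemma density_ge0 x : 0 <= w x.
Proof. exact: gauge_ge0 (minkowski_homogeneous hF) (minkowski_gt0 hF) _. Qed.

Lemma density_continuous x : x != 0 -> {for x, continuous w}.
Proof.
by move=> x0; apply: (continuous_comp (grad_cont srho x0)); apply: mink_cont => //; exact: p0.
Qed.

Lemma density_measurable : measurable_fun setT w.
Proof. by apply: (@measurable_fun_off _ _ 0) => x; exact: density_continuous. Qed.

Lemma density_bound : exists B : R, forall x, 0 < rho x -> w x <= B.
Proof.
have [x0 _ H] := @sphere_max R n w density_continuous.
exists (w x0) => x rx; have xn0 : x != 0 by apply: contraTneq rx => ->; rewrite gauge0// ltxx.
have nx : 0 < `|x| by rewrite normr_gt0.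
rewrite -(@density_gradZ `|x|^-1) ?invr_gt0//; apply: H.
by rewrite normrZ normfV normr_id mulVf// gt_eqF.
Qed.

Let mrho : measurable_fun setT rho. Proof. exact: rho_measurable. Qed.
Let mW : measurable_fun setT W. Proof. exact: measurable_gauge. Qed.

Let mp i : measurable_fun setT (fun x => p x 0 i).
Proof.
by apply: (@measurable_fun_off _ _ 0) => x x0; exact: (Ck_continuous (Ck_grad_coord srho 0 i)).
Qed.

Let mleg i : measurable_fun setT (fun x => leg x 0 i).
Proof.
apply: (@measurable_fun_off _ _ P) => x xP.
have c1 : {for x, continuous leg}.
  apply: (@continuous_comp _ _ _ (fun y => y - P) (legendre F)).
    by apply: continuousB; [exact: cvg_id|exact: cst_continuous].
  by apply: legendre_continuous; rewrite // subr_eq0.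
by move/continuous_rV : c1; exact.
Qed.

Let mN i : measurable_fun setT (fun x => Nf x 0 i).
Proof.
by apply: (@measurable_fun_off _ _ 0) => x x0; exact: (Ck_continuous (Ck_gfield hrho prho srho hF 0 i)).
Qed.

Let cdN i x : x != 0 -> {for x, continuous ('D_(delta_mx 0 i) (fun y => Nf y 0 i))}.
Proof.
move=> x0; have [_ /(_ (delta_mx 0 i))[_ c]] := Ck_gfield hrho prho srho hF 1 i.
exact: (c.1 x x0).
Qed.

Lemma gdiv_continuous x : x != 0 -> {for x, continuous (gdiv rho F)}.
Proof. by move=> x0; apply: continuous_sumR => i; exact: cdN. Qed.

Let mcoord i : measurable_fun setT (fun x => (x - P) 0 i).
Proof.
apply: continuous_measurable_rV => x.
have -> : (fun y => (y - P) 0 i) = (fun y : E => y 0 i - P 0 i) by apply/funext => y; rewrite !mxE.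
by apply: continuousB; [exact: coord_continuous|exact: cst_continuous].
Qed.

Lemma gauge_translate_lip : exists C : R, 0 < C /\ forall x y, `|W x - W y| <= C * `|x - y|.
Proof.
have [C [C0 HC]] := dual_lip hF; exists C; split => // x y.
by apply: le_trans (HC _ _) _; rewrite opprB addrA subrK.
Qed.

Let lipW x : loclip W x.
Proof. by have [C [_ HC]] := gauge_translate_lip; exact: loclip_lip HC. Qed.

Let crho : continuous rho. Proof. exact: gauge_continuous. Qed.

Let cWt : continuous W. Proof. by move=> x; exact: loclip_continuous. Qed.

Let small_ball : exists2 r : R, 0 < r & forall y, ball (0 : E) r y -> rho y <= 1.
Proof.
have h0 : [set y : E | rho y < 1] 0 by rewrite /= gauge0.
have /nbhs_ballP[r r0 rB] := open_nbhs_nbhs (conj (open_sublevel 1 crho) h0).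
by exists r => // y /rB/ltW.
Qed.

Lemma loclip_cutoff d x : 0 < d -> loclip (fun y => cutoff d (rho y)) x.
Proof.
(* Smoothness of [rho] is available only off the origin, but the cutoff vanishes on a whole ball
   around it. *)
move=> d0; have [->|x0] := eqVneq x 0.
  have [r r0 rB] := small_ball.
  by apply: (loclip_near r0 _ (loclip_cst 0 _)) => y /rB y1; rewrite cutoff0.
apply: (@loclip_lipcomp _ _ (cutoff d) d^-1); first by move=> a b; exact: cutoff_lip.
exact: (Ck1_loclip (open_neq0 0) (srho 1)).
Qed.

(* The truncated vector fields below are differentiable off this null set. *)
Let N0 d : set E := [set 0] `|` [set P] `|` [set x | rho x = 1] `|` [set x | rho x = 1 + d]
  `|` [set x | W x = S].

Let level_measurable (f : E -> R) c : measurable_fun setT f -> measurable [set x | f x = c].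
Proof. by move=> mf; have := mf measurableT _ (measurable_set1 c); rewrite setTI. Qed.

Let mN0 d : measurable (N0 d).
Proof.
by repeat apply: measurableU; by [exact: measurable_rV_point|exact: level_measurable].
Qed.

Let N00 d : 0 < d -> lebesgue_rV R n.+1 (N0 d) = 0%E.
Proof.
have rs c : 0 < c -> lebesgue_rV R n.+1 [set x | rho x = c] = 0%E.
  move=> c0; rewrite -(gauge_sphere_null hrho prho cr 0 c0); congr (lebesgue_rV _ _ _).
  by apply/seteqP; split=> x /=; rewrite subr0.
move=> d0; suff [] : measurable (N0 d) /\ lebesgue_rV R n.+1 (N0 d) = 0%E by [].
apply: lebesgue_rV_nullU; last by split; [exact: level_measurable|exact: (gauge_sphere_null hW pW cW)].
apply: lebesgue_rV_nullU; last by split; [exact: level_measurable|apply: rs; rewrite addr_gt0].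
apply: lebesgue_rV_nullU; last by split; [exact: level_measurable|exact: rs].
by apply: lebesgue_rV_nullU; split; by [exact: measurable_rV_point|exact: lebesgue_rV_point].
Qed.

Let outN d x : ~ N0 d x -> [/\ x != 0, x != P, rho x != 1, rho x != 1 + d & W x != S].
Proof.
move=> H; split; apply/eqP => e; apply: H; rewrite /N0.
- by do 4 left.
- by do 3 left; right.
- by do 2 left; right.
- by left; right.
- by right.
Qed.

Let D_rho x i : x != 0 -> is_derive x (delta_mx 0 i : E) rho (p x 0 i).
Proof.
move=> x0; have dr := rho_diff srho x0.
rewrite -(dot_delta (p x) i) dotC -derive_grad//; exact/derivableP/diff_derivable.
Qed.

Let D_cut d x i : 0 < d -> x != 0 -> rho x != 1 -> rho x != 1 + d ->
  is_derive x (delta_mx 0 i : E) (fun y => cutoff d (rho y)) (dcutoff d (rho x) * p x 0 i).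
Proof. by move=> d0 x0 r1 rd; apply: is_derive_comp1; [exact: is_derive_cutoff|exact: D_rho]. Qed.

Let D_W x i : x != P -> is_derive x (delta_mx 0 i : E) W (leg x 0 i).
Proof.
move=> xP; have z0 : x - P != 0 by rewrite subr_eq0.
have [dG gG] := dual_diff hF z0.
have dh : is_derive x (delta_mx 0 i : E) (fun y : E => y - P) (delta_mx 0 i).
  by apply: is_derive_affine => h; rewrite -addrA addrC.
have dh' : derivable (fun y : E => y - P) x (delta_mx 0 i) by case: dh.
apply: (@eq_rect _ _ (fun d => is_derive x (delta_mx 0 i : E) W d)
  (@is_derive_comp R E R n.+1 (dual_norm F) (fun y : E => y - P) x (delta_mx 0 i) dG dh')).
by rewrite diff_grad// gG; have [_ ->] := dh; rewrite dotC dot_delta.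
Qed.

Let D_coord x i : is_derive x (delta_mx 0 i : E) (fun y => (y - P) 0 i) 1.
Proof. apply: is_derive_affine => h; rewrite !mxE !eqxx -addrA addrC; congr (_ + _). Qed.

Let D_N x i : x != 0 ->
  is_derive x (delta_mx 0 i : E) (fun y => Nf y 0 i) ('D_(delta_mx 0 i) (fun y => Nf y 0 i) x).
Proof.
by move=> x0; apply/derivableP/diff_derivable; exact: (gfield_coord_diff hrho prho srho hF).
Qed.

(* The excess of the divergence of (S - W)_+ N over its lower bound - 1_(W < S). *)
Definition excess x : R :=
  phi x * gdiv rho F x + (W x < S)%R%:R * (1 - dot (leg x) (Nf x)).

Let field_dot x : x != 0 -> dot (p x) (Nf x) = w x.
Proof. by move=> x0; rewrite /Nf /gfield mink_euler//; exact: p0. Qed.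

Let shell_dcutoff d (f : E -> R) x :
  on_shell rho d (fun y => d^-1 * (f y * w y)) x = dcutoff d (rho x) * (f x * w x).
Proof. by rewrite /on_shell /dcutoff; case: ifP => _; rewrite ?mul0r. Qed.

Let mcut d : 0 < d -> measurable_fun setT (fun x => cutoff d (rho x)).
Proof.
by move=> d0; apply: continuous_measurable_rV => x; apply: loclip_continuous; exact: loclip_cutoff.
Qed.

Let mdcut d : measurable_fun setT (fun x => dcutoff d (rho x)).
Proof.
apply: measurable_fun_ifT => //; apply: measurable_and.
  exact: measurable_fun_ler.
exact: measurable_fun_ltr.
Qed.

Let mphi : measurable_fun setT phi.
Proof. by apply: measurable_maxr => //; exact: measurable_funB. Qed.

Let lip_phi C : (forall x y, `|W x - W y| <= C * `|x - y|) -> forall x y, `|phi x - phi y| <= C * `|x - y|.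
Proof.
move=> HC x y; apply: le_trans (max_lip _ _ _) _; apply: le_trans (HC x y).
by rewrite opprB addrC addrA subrK distrC.
Qed.

Let lip_psi C : (forall x y, `|W x - W y| <= C * `|x - y|) -> forall x y, `|psi x - psi y| <= C * `|x - y|.
Proof.
move=> HC x y; apply: le_trans (max_lip _ _ _) _; apply: le_trans (HC x y).
by rewrite opprB addrA subrK.
Qed.

Lemma excess_ge0 x : (forall y, y != 0 -> 0 <= gdiv rho F y) -> x != 0 -> 0 <= excess x.
Proof.
move=> gd x0; rewrite addr_ge0// mulr_ge0//; first by rewrite le_max lexx.
  exact: gd.
by rewrite subr_ge0; apply: legendre_grad_le => //; exact: p0.
Qed.

Let indW : bmeas (fun x => (W x < S)%R%:R : R).
Proof.
rewrite (_ : (fun x => _) = \1_[set x | W x < S]); first exact: (bmeas_gauge_lt hW pW cW).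
by apply/funext => x; rewrite (indic_bool _ (fun x => W x < S)).
Qed.

(* The divergence theorem for the field [cutoff d rho * (S - W)_+ * N] with [N = gfield rho F]. *)
Lemma divergence_outer d : 0 < d ->
  bmeas (fun x => \1_(~` N0 d) x * (cutoff d (rho x) * excess x)) /\
  Int (on_shell rho d (fun x => d^-1 * (phi x * w x))) +
    Int (fun x => \1_(~` N0 d) x * (cutoff d (rho x) * excess x)) =
  Int (fun x => cutoff d (rho x) * (W x < S)%R%:R).
Proof.
move=> d0; have [C [C0 HC]] := gauge_translate_lip; have [B HB] := density_bound.
pose dphi x : R := (if 0 < S - W x then 1 else 0).
pose f (i : 'I_n.+1) x := cutoff d (rho x) * phi x * Nf x 0 i.
pose df (i : 'I_n.+1) x :=
  (dcutoff d (rho x) * p x 0 i * phi x + cutoff d (rho x) * (dphi x * (0 - leg x 0 i))) * Nf x 0 i +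
  cutoff d (rho x) * phi x * 'D_(delta_mx 0 i) (fun y => Nf y 0 i) x.
have [M HM] := gauge_lt_bounded hW pW cW P S.
have [] := @divergence_Int _ _ f df (N0 d) M.
(* The field N is controlled only off the origin; the cutoff kills it near 0. *)
- move=> i x; have [->|x0] := eqVneq x 0.
    have [r r0 rB] := small_ball.
    by apply: (loclip_near r0 _ (loclip_cst 0 _)) => y /rB y1; rewrite /f cutoff0 ?mul0r.
  apply: loclipM.
    apply: loclipM; first exact: loclip_cutoff.
    by apply: loclip_lip; exact: lip_phi HC.
  exact: (Ck1_loclip (open_neq0 0) (Ck_gfield hrho prho srho hF 1 i)).
- move=> i x Mx; rewrite /f /phi (max_idPl _) ?mulr0 ?mul0r// subr_le0 leNgt; apply/negP => /HM.
  by rewrite leNgt Mx.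
- exact: mN0.
- exact: N00.
- move=> i; have mD : measurable_fun setT ('D_(delta_mx 0 i) (fun y => Nf y 0 i)).
    by apply: (@measurable_fun_off _ _ 0) => x; exact: cdN.
  have mdphi : measurable_fun setT dphi.
    by apply: measurable_fun_ifT => //; apply: measurable_fun_ltr => //; exact: measurable_funB.
  apply: measurable_funD; apply: measurable_funM => //; last first.
    by apply: measurable_funM => //; exact: mcut.
  apply: measurable_funD; last first.
    apply: measurable_funM; first exact: mcut.
    by apply: measurable_funM => //; apply: measurable_funB.
  by apply: measurable_funM => //; apply: measurable_funM.
- move=> i x /outN[x0 xP r1 rd WS].
  apply: is_derive_mul; last exact: D_N.
  apply: is_derive_mul; first exact: D_cut.
  apply: (@is_derive_comp1 _ _ (fun u => Num.max 0 u) (fun y => S - W y)).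
    by apply: is_derive_pos_part; rewrite subr_eq0 eq_sym.
  have -> : (fun y => S - W y) = cst S - W by [].
  by apply: is_deriveB; exact: D_W.
(* The derivative of the cutoff pairs with N to the shell term, since [<D rho, N> = F(D rho)]; the
   other two terms give [-<DW, N>] and [div N], and subtracting the indicator of [W < S] completes
   them to the excess. *)
have sumE x : x != 0 -> \sum_i df i x =
    on_shell rho d (fun x => d^-1 * (phi x * w x)) x + cutoff d (rho x) * excess x -
    cutoff d (rho x) * (W x < S)%R%:R.
  move=> x0; rewrite shell_dcutoff -(field_dot x0) /excess /gdiv !dotE.
  have dphiE : dphi x = (W x < S)%R%:R by rewrite /dphi subr_gt0; case: ifP.
  have -> : \sum_i df i x = dcutoff d (rho x) * phi x * (\sum_i p x 0 i * Nf x 0 i) -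
      cutoff d (rho x) * (W x < S)%R%:R * (\sum_i leg x 0 i * Nf x 0 i) +
      cutoff d (rho x) * phi x * \sum_i 'D_(delta_mx 0 i) (fun y => Nf y 0 i) x.
    rewrite !mulr_sumr -sumrB -big_split/=; apply: eq_bigr => i _.
    by rewrite /df dphiE; ring.
  by ring.
set T := (fun x => \1_(~` N0 d) x * \sum_i df i x) => bT IT.
set A := on_shell rho d _.
pose Bf x := cutoff d (rho x) * (W x < S)%R%:R.
have bA : bmeas A.
  exact: (bmeas_shell_product hrho prho cr (lip_phi HC) (ltW C0) density_measurable density_ge0 HB _ (ltW d0)).
have bB : bmeas Bf.
  have -> : Bf = (fun x => (W x < S)%R%:R * cutoff d (rho x)) by apply/funext => x; exact: mulrC.
  apply: bmeasM; [exact: indW|exact: mcut|].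
  by exists 1 => x _; rewrite ger0_norm ?cutoff_ge0 ?cutoff_le1.
have EE : (fun x => \1_(~` N0 d) x * (cutoff d (rho x) * excess x)) =
    (fun x => T x - \1_(~` N0 d) x * A x + \1_(~` N0 d) x * Bf x).
  apply/funext => x; rewrite /T indicE; have [|_] := boolP (x \in _); last by rewrite !mul0r subrr addr0.
  by rewrite inE/= => /outN[x0 _ _ _ _]; rewrite sumE// /A /Bf; ring.
have b1 : bmeas (fun x => \1_(~` N0 d) x * A x) by exact: bmeas_off.
have b2 : bmeas (fun x => \1_(~` N0 d) x * Bf x) by exact: bmeas_off.
rewrite EE; split; first by apply: bmeasD => //; exact: bmeasB.
rewrite IntD//; last exact: bmeasB.
rewrite IntB// IT (Int_off _ (N00 d0) bA)// (Int_off _ (N00 d0) bB)//.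
by rewrite sub0r addrA subrr add0r.
Qed.

Let mW_shrink : measurable_fun setT (fun x => shrink S (W x)).
Proof.
apply: continuous_measurable_rV => x; apply: loclip_continuous.
by apply: (loclip_lipcomp (L := S^-1)) => // a b; exact: shrink_lip.
Qed.

(* The divergence theorem for the field [(1 - cutoff d rho) * (1 - S / W)_+ * (x - P)], combined
   with <x - P, D rho> <= W F(D rho). *)
Lemma divergence_inner d : 0 < d ->
  bmeas (fun x => (1 - cutoff d (rho x)) * ((S < W x)%R%:R + n%:R * shrink S (W x))) /\
  Int (fun x => (1 - cutoff d (rho x)) * ((S < W x)%R%:R + n%:R * shrink S (W x))) <=
  Int (on_shell rho d (fun x => d^-1 * (psi x * w x))).
Proof.
move=> d0; have [C [C0 HC]] := gauge_translate_lip; have [B HB] := density_bound.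
pose k x := shrink S (W x).
pose dk x : R := if S < W x then S / W x ^+ 2 else 0.
pose f (i : 'I_n.+1) x := (1 - cutoff d (rho x)) * k x * (x - P) 0 i.
pose df (i : 'I_n.+1) x :=
  ((0 - dcutoff d (rho x) * p x 0 i) * k x + (1 - cutoff d (rho x)) * (dk x * leg x 0 i)) * (x - P) 0 i +
  (1 - cutoff d (rho x)) * k x * 1.
have [M HM] := gauge_lt_bounded hrho prho cr 0 (1 + d).
have far x : M < `|x| -> cutoff d (rho x) = 1.
  move=> Mx; apply: cutoff1 => //; rewrite leNgt; apply/negP => rx.
  by have := HM x; rewrite subr0 => /(_ rx); rewrite leNgt Mx.
have [] := @divergence_Int _ _ f df (N0 d) M.
- move=> i x; apply: loclipM; first apply: loclipM.
  + apply: loclipD; first exact: loclip_cst.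
    apply: (@loclip_lipcomp _ _ (fun t => - t) 1); last exact: loclip_cutoff.
    by move=> a b; rewrite -opprD normrN mul1r.
  + by apply: (loclip_lipcomp (L := S^-1)) => // a b; exact: shrink_lip.
  + have -> : (fun y => (y - P) 0 i) = (fun y : E => y 0 i + (- P 0 i)).
      by apply/funext => y; rewrite !mxE.
    by apply: loclipD; [exact: loclip_coord|exact: loclip_cst].
- by move=> i x /far e; rewrite /f e subrr !mul0r.
- exact: mN0.
- exact: N00.
- move=> i.
  have mdk : measurable_fun setT dk.
    apply: measurable_fun_ifT => //; first exact: measurable_fun_ltr.
    apply: measurable_funM => //.
    exact: (measurableT_comp (@measurable_invr R) (measurable_funX 2 mW)).
  have m1 : measurable_fun setT (fun x => 1 - cutoff d (rho x)).
    by apply: measurable_funB => //; exact: mcut.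
  apply: measurable_funD; apply: measurable_funM => //; last by apply: measurable_funM.
  apply: measurable_funD; apply: measurable_funM => //; last by apply: measurable_funM.
  by apply: measurable_funB => //; apply: measurable_funM.
- move=> i x /outN[x0 xP r1 rd WS].
  apply: is_derive_mul; last exact: D_coord.
  apply: is_derive_mul.
    have -> : (fun y => 1 - cutoff d (rho y)) = cst 1 - (fun y => cutoff d (rho y)) by [].
    by apply: is_deriveB; exact: D_cut.
  by apply: is_derive_comp1; [exact: is_derive_shrink|exact: D_W].
set T := (fun x => \1_(~` N0 d) x * \sum_i df i x) => bT IT.
set A := on_shell rho d _.
pose Cf x := (1 - cutoff d (rho x)) * ((S < W x)%R%:R + n%:R * shrink S (W x)).
have bA : bmeas A.
  exact: (bmeas_shell_product hrho prho cr (lip_psi HC) (ltW C0) density_measurable density_ge0 HB _ (ltW d0)).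
have mind : measurable_fun setT (fun x => (S < W x)%R%:R : R).
  rewrite (_ : (fun x => _) = (fun x => if S < W x then 1 else 0 : R)).
    by apply: measurable_fun_ifT => //; exact: measurable_fun_ltr.
  by apply/funext => x; case: ifP.
have bC : bmeas Cf.
  apply: bmeasM.
  - split; first by apply: measurable_funB => //; exact: mcut.
    exists (1 + `|M|); split => x.
      rewrite ger0_norm ?subr_ge0 ?cutoff_le1//.
      have := cutoff_ge0 d (rho x); have := normr_ge0 M; lra.
    move=> xM; rewrite far ?subrr//; apply: le_lt_trans xM.
    by rewrite (le_trans (ler_norm M))// lerDr.
  - by apply: measurable_funD => //; exact: measurable_funM.
  - exists (1 + n%:R) => x _; rewrite ger0_norm; last by rewrite addr_ge0// mulr_ge0// shrink_ge0.
    apply: lerD; first by case: (S < W x).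
    by rewrite ler_piMr// shrink_le1.
rewrite -/Cf; split => //.
(* The divergence [T] has integral 0, so a pointwise comparison of [Cf - T] with the shell term
   suffices. *)
have TE x : ~ N0 d x -> Cf x - T x <= A x.
  move=> Nx; have [x0 xP _ _ WS] := outN Nx.
  rewrite /T indicE mem_set// mul1r /A shell_dcutoff.
  have -> : \sum_i df i x = - (dcutoff d (rho x) * k x * (\sum_i (x - P) 0 i * p x 0 i)) +
      (1 - cutoff d (rho x)) * dk x * (\sum_i (x - P) 0 i * leg x 0 i) +
      (1 - cutoff d (rho x)) * k x * n.+1%:R.
    rewrite !mulr_sumr -sumrN -!big_split/= -[X in _ + X * _]mulr1 -mulrA.
    rewrite (_ : 1 * n.+1%:R = \sum_(i < n.+1) (1 : R)); last by rewrite sumr_const card_ord mul1r.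
    by rewrite mulr_sumr -big_split/=; apply: eq_bigr => i _; rewrite /df; ring.
  rewrite -!dotE.
  have -> : dot (x - P) (leg x) = W x by have [_ ->] := legendreP hF (x - P).
  (* For [W > S] the divergence of [(1 - S / W) (x - P)] is [S / W + (n + 1) (1 - S / W)], that is,
     [1 + n (1 - S / W)]. *)
  have CE : Cf x = (1 - cutoff d (rho x)) * (dk x * W x + n.+1%:R * k x).
    rewrite /Cf; congr (_ * _); rewrite /dk -/(k x).
    have [l|l] := ltP S (W x).
      have W0 := lt_trans S0 l.
      rewrite /k shrinkE ?ltW//= -natr1; field.
      by rewrite gt_eqF.
    by rewrite /k shrink0// !mulr0 mul0r.
  rewrite CE.
  have le1 : dot (x - P) (p x) <= W x * w x by exact: dual_le.
  have k0 : 0 <= k x by exact: shrink_ge0.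
  have dc0 : 0 <= dcutoff d (rho x) by rewrite /dcutoff; case: ifP => // _; rewrite invr_ge0 ltW.
  have -> : psi x = k x * W x by rewrite /psi /k shrink_mul.
  rewrite (_ : _ - _ = dcutoff d (rho x) * (k x * dot (x - P) (p x))); last by ring.
  by rewrite -mulrA ler_wpM2l// ler_wpM2l.
have -> : Int Cf = Int (fun x => Cf x - T x) by rewrite IntB// IT subr0.
by apply: (le_Int_ae (mN0 d) (N00 d0)) => //; exact: bmeasB.
Qed.

(* The integral of f over Sigma with respect to d mu_F, see [aniso_integralE]. *)
Definition sphere_average (f : E -> R) : R :=
  n.+1%:R * Int (on_cone rho 1 (fun x => f ((rho x)^-1 *: x) * w x)).
Local Notation K := sphere_average.

(** The width is frozen at 1: cutoffs increase as [d] decreases, so this value bounds the excess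
    term from below for all [d <= 1] and survives the limit. *)
Definition outer_defect : R := Int (fun x => \1_(~` N0 1) x * (cutoff 1 (rho x) * excess x)).

(** The surplus of the divergence [1 + n (1 - S / W)] over 1, integrated over the part of Omega
    outside the Wulff ball. *)
Definition inner_defect : R := n%:R * Int (fun x => (rho x < 1)%R%:R * shrink S (W x)).

Let indrho : bmeas (fun x => (rho x < 1)%R%:R : R).
Proof.
rewrite (_ : (fun x => _) = \1_[set x : E | rho (x - 0) < 1]); first exact: (bmeas_gauge_lt hrho prho cr).
by apply/funext => x; rewrite (indic_bool _ (fun x => rho (x - 0) < 1)) subr0.
Qed.

Let mbool (f g : E -> R) : measurable_fun setT f -> measurable_fun setT g ->
  measurable_fun setT (fun x => (f x <= g x)%R%:R : R) /\ measurable_fun setT (fun x => (f x < g x)%R%:R : R).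
Proof.
move=> mf mg; split.
  rewrite (_ : (fun x => _) = (fun x => if f x <= g x then 1 else 0 : R)).
    by apply: measurable_fun_ifT => //; exact: measurable_fun_ler.
  by apply/funext => x; case: ifP.
rewrite (_ : (fun x => _) = (fun x => if f x < g x then 1 else 0 : R)).
  by apply: measurable_fun_ifT => //; exact: measurable_fun_ltr.
by apply/funext => x; case: ifP.
Qed.

Let bmeas_bool (f g : E -> R) (b : E -> bool) : bmeas f -> measurable_fun setT (fun x => (b x)%:R : R) ->
  bmeas (fun x => f x * (b x)%:R).
Proof. by move=> bf mb; apply: bmeasM => //; exists 1 => x _; case: (b x); rewrite ?normr1 ?normr0. Qed.

(** The limit of [divergence_outer] along [d = 1 / (k + 1)]: the shell term tends to the surface
    term, while the defect and the volume bound do not depend on [d]. *)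
Lemma calibration_outer : (forall y, y != 0 -> 0 <= gdiv rho F y) ->
  K phi + outer_defect <= Int (fun x => (W x < S)%R%:R * (1 <= rho x)%R%:R).
Proof.
move=> gd; have [C [C0 HC]] := gauge_translate_lip; have [B HB] := density_bound.
rewrite -lerBrDr; set V := Int _.
have bV : bmeas (fun x => (W x < S)%R%:R * (1 <= rho x)%R%:R).
  by apply: bmeas_bool => //; have [] := @mbool (cst 1) rho (measurable_cst _) mrho.
apply: (cvgr_to_le (shell_cvg hrho prho cr (lip_phi HC) (ltW C0) density_measurable density_gradZ
  density_ge0 HB)).
apply: nearW => k; set d : R := harmonic k.
  have d0 : 0 < d by exact: harmonic_gt0.
  have d1 : d <= 1 by rewrite /d /harmonic /= invf_le1// ler1n.
  have [bE HE] := divergence_outer d0; have [b1 _] := divergence_outer ltr01.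
  have [mU U0] : measurable (N0 d `|` N0 1) /\ lebesgue_rV R n.+1 (N0 d `|` N0 1) = 0%E.
    by apply: lebesgue_rV_nullU; split; by [exact: mN0|exact: N00].
  have c1 : outer_defect <= Int (fun x => \1_(~` N0 d) x * (cutoff d (rho x) * excess x)).
    apply: (le_Int_ae mU U0) => // x Nx.
    have Nd : ~ N0 d x by move=> h; apply: Nx; left.
    have N1 : ~ N0 1 x by move=> h; apply: Nx; right.
    have [x0 _ _ _ _] := outN N1.
    rewrite !indicE !mem_set// !mul1r ler_wpM2r//; first exact: excess_ge0.
    exact: cutoff_anti.
  have c2 : Int (fun x => cutoff d (rho x) * (W x < S)%R%:R) <= V.
    apply: le_Int => [|//|x].
      have -> : (fun x => cutoff d (rho x) * (W x < S)%R%:R) = (fun x => (W x < S)%R%:R * cutoff d (rho x)).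
        by apply/funext => x; exact: mulrC.
      apply: bmeasM; [exact: indW|exact: mcut|].
      by exists 1 => x _; rewrite ger0_norm ?cutoff_ge0 ?cutoff_le1.
    rewrite mulrC ler_wpM2l//; have [r1|r1] := leP 1 (rho x); first exact: cutoff_le1.
    by rewrite cutoff0// ltW.
by rewrite lerBrDr; apply: le_trans c2; rewrite -HE lerD2l.
Qed.

(** Since [1 - cutoff d rho] dominates the indicator of [rho < 1] for every [d], the left side of
    [divergence_inner] has a lower bound independent of [d]. *)
Lemma calibration_inner :
  Int (fun x => (rho x < 1)%R%:R * (S < W x)%R%:R) + inner_defect <= K psi.
Proof.
have [C [C0 HC]] := gauge_translate_lip; have [B HB] := density_bound.
have bS : bmeas (fun x => (rho x < 1)%R%:R * (S < W x)%R%:R).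
  by apply: bmeas_bool => //; have [] := @mbool (cst S) W (measurable_cst _) mW.
have bk : bmeas (fun x => (rho x < 1)%R%:R * shrink S (W x)).
  apply: bmeasM => //; exists 1 => x _; rewrite ger0_norm ?shrink_ge0//.
  exact: shrink_le1.
rewrite /inner_defect -IntZ// -IntD//; last exact: bmeasZ.
apply: (cvgr_to_ge (shell_cvg hrho prho cr (lip_psi HC) (ltW C0) density_measurable density_gradZ
  density_ge0 HB)).
apply: nearW => k; set d : R := harmonic k.
  have d0 : 0 < d by exact: harmonic_gt0.
  have [bC HC'] := divergence_inner d0.
  apply: le_trans HC'; apply: le_Int => [|//|x]; first by apply: bmeasD => //; exact: bmeasZ.
  rewrite mulrCA -mulrDr ler_wpM2r//.
    by rewrite addr_ge0// mulr_ge0// shrink_ge0.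
  by have [r1|r1] := ltP (rho x) 1; [rewrite cutoff0 ?subr0// ltW|rewrite subr_ge0 cutoff_le1].
Qed.

Lemma calibration_ineq : (forall y, y != 0 -> 0 <= gdiv rho F y) ->
  S * K (fun=> 1) + Vol [set x | rho x < 1] - S ^+ n.+1 * Vol (wulff_domain F) +
    outer_defect + inner_defect <= K W.
Proof.
move=> gd; have [C [C0 HC]] := gauge_translate_lip; have [B HB] := density_bound.
have bc (f : E -> R) (C' : R) : 0 <= C' -> (forall x y, `|f x - f y| <= C' * `|x - y|) ->
    bmeas (on_cone rho 1 (fun x => f ((rho x)^-1 *: x) * w x)).
  by move=> C'0 HC'; exact: (bmeas_radial_cone hrho prho cr HC' C'0 density_measurable density_ge0 HB).
(* Integrate [W = S + (W - S)_+ - (S - W)_+]. *)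
have KW : K W = S * K (fun=> 1) + K psi - K phi.
  rewrite /K mulrCA -mulrDr -mulrBr; congr (_ * _).
  have b1 : bmeas (on_cone rho 1 (fun x => 1 * w x)).
    by apply: (bc (fun=> 1) 0) => // x y; rewrite subrr normr0 mul0r.
  have b2 := bc psi C (ltW C0) (lip_psi HC).
  have b3 := bc phi C (ltW C0) (lip_phi HC).
  rewrite -IntZ// -IntD//; last exact: bmeasZ.
  rewrite -IntB//; last by apply: bmeasD => //; exact: bmeasZ.
  congr Int; apply/funext => x; rewrite /on_cone; case: ifP => _; last by rewrite mulr0 addr0 subr0.
  rewrite mulrA mulr1 -mulrDl -mulrBl; congr (_ * _); rewrite /psi /phi.
  set t := W _; case: (leP S t) => St.
    rewrite (max_idPr _) ?subr_ge0// (max_idPl _) ?subr_le0//; ring.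
  rewrite (max_idPl _) ?subr_le0 ?ltW// (max_idPr _) ?subr_ge0 ?ltW//; ring.
have := calibration_outer gd; have := calibration_inner.
set V2 := Int _; set V1 := Int _.
(* The difference of the volumes of two sets is that of their set differences; the sphere [W = S]
   belongs to neither strict inequality but is null. *)
have : Vol [set x | rho x < 1] - S ^+ n.+1 * Vol (wulff_domain F) = V2 - V1; last by lra.
have -> : Vol [set x | rho x < 1] = Int (fun x => (rho x < 1)%R%:R).
  have -> : [set x | rho x < 1] = [set x : E | rho (x - 0) < 1].
    by apply/seteqP; split=> x /=; rewrite subr0.
  rewrite -Int_indic; last exact: (measurable_gauge_lt hrho prho cr).
  by congr Int; apply/funext => x; rewrite (indic_bool _ (fun x => rho (x - 0) < 1)) subr0.
have -> : S ^+ n.+1 * Vol (wulff_domain F) = Int (fun x => (W x < S)%R%:R).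
  rewrite -(vol_gauge_lt hW pW cW P S0) -Int_indic; last exact: (measurable_gauge_lt hW pW cW).
  by congr Int; apply/funext => x; rewrite (indic_bool _ (fun x => W x < S)).
have bS : bmeas (fun x => (rho x < 1)%R%:R * (S < W x)%R%:R).
  by apply: bmeas_bool => //; have [] := @mbool (cst S) W (measurable_cst _) mW.
have bV : bmeas (fun x => (W x < S)%R%:R * (1 <= rho x)%R%:R).
  by apply: bmeas_bool => //; have [] := @mbool (cst 1) rho (measurable_cst _) mrho.
rewrite -!IntB//; apply: (Int_ae (mN0 1) (N00 ltr01)); [exact: bmeasB|exact: bmeasB|].
move=> x /outN[_ _ _ _ WS].
have -> : (S < W x) = ~~ (W x < S) by rewrite -leNgt le_eqVlt eq_sym (negbTE WS).
have -> : (1 <= rho x) = ~~ (rho x < 1) by rewrite leNgt.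
by case: (rho x < 1); case: (W x < S); rewrite /= ?mulr0 ?mulr1 ?subrr ?subr0.
Qed.

Lemma outer_defect_ge0 : (forall y, y != 0 -> 0 <= gdiv rho F y) -> 0 <= outer_defect.
Proof.
move=> gd; apply: Int_ge0 => x; rewrite indicE; have [|_] := boolP (x \in _); last by rewrite mul0r.
by rewrite inE mul1r => /outN[x0 _ _ _ _]; rewrite mulr_ge0 ?cutoff_ge0// excess_ge0.
Qed.

Lemma inner_defect_ge0 : 0 <= inner_defect.
Proof. by rewrite mulr_ge0//; apply: Int_ge0 => x; rewrite mulr_ge0// shrink_ge0. Qed.

(** A point of Omega with [W > S] would have a neighbourhood on which [shrink] is bounded below. The
    factor [n] in the defect has to be positive for this to count. *)
Lemma inner_defect_eq0 : (0 < n)%N -> inner_defect <= 0 -> forall x, rho x < 1 -> W x <= S.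
Proof.
move=> n0 id x rx; rewrite leNgt; apply/negP => Wx.
(* A level strictly between [S] and [W x], so that [shrink] is at least [1 - S / s > 0] on an open
   set around [x]. *)
pose s := (S + W x) / 2.
have [Ss sW] : S < s /\ s < W x by rewrite /s; split; lra.
pose U := [set y | rho y < 1] `&` [set y | s < W y].
have oU : open U by apply: openI; [exact: open_sublevel|exact: open_superlevel].
have s0 := lt_trans S0 Ss.
have bk : bmeas (fun x => (rho x < 1)%R%:R * shrink S (W x)).
  apply: bmeasM => //; exists 1 => y _; rewrite ger0_norm ?shrink_ge0//.
  exact: shrink_le1.
have : 0 < Int (fun x => (rho x < 1)%R%:R * shrink S (W x)).
  apply: (@Int_gt0 _ _ _ set0 U x (1 - S / s)) => //.
  - by move=> y _; rewrite mulr_ge0// shrink_ge0.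
  - by rewrite subr_gt0 ltr_pdivrMr// mul1r.
  move=> y [/= -> sy] _; rewrite mul1r shrinkE; last by apply/ltW/(lt_trans Ss).
  by rewrite lerD2l lerN2 ler_pM2l// lef_pV2 ?posrE ?(lt_trans s0 sy)// ltW.
by rewrite ltNge => /negP; apply; move: id; rewrite /inner_defect pmulr_rle0// ltr0n.
Qed.

Lemma outer_defect_eq0 : (0 < n)%N -> (forall y, y != 0 -> 0 <= gdiv rho F y) ->
  outer_defect <= 0 -> forall x, W x < S -> rho x <= 1.
Proof.
move=> n0 gd od x Wx; rewrite leNgt; apply/negP => rx.
pose U := [set y | W y < S] `&` [set y | 1 < rho y].
have oU : open U by apply: openI; [exact: open_sublevel|exact: open_superlevel].
have Ux : U x by split.
have U0 y : U y -> y != 0 by move=> [_ /= ry]; apply: contraTneq ry => ->; rewrite gauge0// ltr10.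
have phi0 y : 0 <= phi y by rewrite le_max lexx.
have le1 y : y != 0 -> 0 <= 1 - dot (leg y) (Nf y).
  by move=> y0; rewrite subr_ge0; apply: legendre_grad_le => //; exact: p0.
have zero y : U y -> y != P -> excess y = 0.
  move=> Uy yP; have y0 := U0 _ Uy; apply/eqP; rewrite eq_le excess_ge0// andbT leNgt.
  apply/negP => ey; have [/= Wy ry] := Uy.
  (* On [U] the indicator in [excess] equals 1; with it replaced by 1 the integrand is continuous at
     [y], hence exceeds [g y / 2] on a neighbourhood. *)
  pose g z := cutoff 1 (rho z) * (phi z * gdiv rho F z + (1 - dot (leg z) (Nf z))).
  have gE z : W z < S -> g z = cutoff 1 (rho z) * excess z by move=> Wz; rewrite /excess Wz mul1r.
  have gy : 0 < g y by rewrite gE// mulr_gt0// cutoff_gt0.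
  have cg : {for y, continuous g}.
    apply: continuousM; first by apply: loclip_continuous; exact: loclip_cutoff.
    apply: continuousD.
      apply: continuousM; last exact: gdiv_continuous.
      have [C [C0 HC]] := gauge_translate_lip.
      by apply: loclip_continuous; apply: loclip_lip; exact: lip_phi HC.
    apply: continuousB; first exact: cst_continuous.
    apply: dot_continuous.
      apply: (@continuous_comp _ _ _ (fun y => y - P) (legendre F)).
        by apply: continuousB; [exact: cvg_id|exact: cst_continuous].
      by apply: legendre_continuous; rewrite // subr_eq0.
    apply/continuous_rV => i; exact: (Ck_continuous (Ck_gfield hrho prho srho hF 0 i)).
  pose V := [set z | U z /\ g y / 2 < g z]°.
  have Vy : V y.
    rewrite /V /interior /=; apply: filterI; first exact: open_nbhs_nbhs.
    by apply: (cvgr_gt _ cg); rewrite ltr_pdivrMr// mulr_natr mulr2n ltrDl.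
  have [bE _] := divergence_outer ltr01.
  have : 0 < outer_defect.
    apply: (@Int_gt0 _ _ _ (N0 1) V y (g y / 2)) => //.
    - exact: N00.
    - move=> z Nz; have [z0 _ _ _ _] := outN Nz.
      rewrite indicE (mem_set (Nz : (~` N0 1) z)) mul1r; apply: mulr_ge0; first exact: cutoff_ge0.
      exact: (excess_ge0 gd z0).
    - exact: open_interior.
    - by rewrite divr_gt0.
    move=> z /interior_subset [[Wz _] gz] Nz.
    rewrite indicE (mem_set (Nz : (~` N0 1) z)) mul1r -(gE z Wz); exact: ltW gz.
  by rewrite ltNge od.
(* A nonempty open set has positive measure, so it is not reduced to the point [P]. *)
have [y [Uy yP]] : exists y, U y /\ y != P.
  apply: contrapT => H; have := lebesgue_rV_open_gt0 oU Ux.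
  suff -> : U = [set x] by rewrite lebesgue_rV_point ltxx.
  have UP z : U z -> z = P by move=> Uz; apply/eqP/negPn/negP => zP; apply: H; exists z.
  by apply/seteqP; split=> z => [/UP ->|-> //]; rewrite (UP _ Ux).
(* Both terms of the excess are nonnegative, hence both vanish; the second one is the equality case
   of duality and determines N. *)
have NE z : U z -> z != P -> Nf z = (W z)^-1 *: (z - P) /\ phi z * gdiv rho F z = 0.
  move=> Uz zP; have z0 := U0 _ Uz; have [/= Wz rz] := Uz.
  have := zero _ Uz zP; rewrite /excess Wz mul1r => /eqP.
  rewrite paddr_eq0 ?le1//; last by rewrite mulr_ge0// gd.
  move=> /andP[/eqP -> /eqP/subr0_eq e]; split => //.
  by apply: legendre_grad_eq => //; [rewrite subr_eq0|exact: p0].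
have Wy0 : 0 < W y by apply: pW; rewrite subr_eq0.
(* The divergence of [(x - P) / W] is [(n + 1) / W - <DW, x - P> / W ^ 2], and [<DW, x - P> = W]. *)
have gE : gdiv rho F y = n%:R / W y.
  rewrite /gdiv; transitivity (\sum_(i < n.+1) (- (W y) ^- 2 * (leg y 0 i * (y - P) 0 i) + (W y)^-1)).
    apply: eq_bigr => i _.
    rewrite (@near_eq_derive _ _ _ _ (fun z => (W z)^-1 * (z - P) 0 i)).
      have H1 : is_derive y (delta_mx 0 i : E) (fun z => (W z)^-1) (- (W y) ^- 2 * leg y 0 i).
        apply: (@is_derive_comp1 _ _ GRing.inv W); last exact: D_W.
        by apply: is_derive_eq; [apply: is_deriveV; rewrite gt_eqF|rewrite -[_ *: 1]/(_ * 1) mulr1].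
      have [_ ->] := is_derive_mul H1 (D_coord y i).
      by rewrite mulr1 mulrA.
    have : \forall z \near y, U z /\ z != P.
      by apply: filterI; [exact: open_nbhs_nbhs|exact: (open_nbhs_nbhs (conj (open_neq0 P) yP))].
    by apply: filterS => z [Uz zP]; have [e _] := NE _ Uz zP; rewrite -/(Nf z) e mxE.
  rewrite big_split/= -mulr_sumr sumr_const card_ord -mulr_natr -dotE dotC.
  have -> : dot (y - P) (leg y) = W y by have [_ ->] := legendreP hF (y - P).
  by rewrite mulrSr -mulr_natr; field; rewrite gt_eqF.
have [_] := NE _ Uy yP; apply/eqP; rewrite gt_eqF// gE; have [/= Wy _] := Uy.
by rewrite mulr_gt0 ?divr_gt0 ?ltr0n// lt_max subr_gt0 Wy orbT.
Qed.

End Calibration.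

(** * Optimal radius and the equality case *)

(** If [g x > 1], points of the ray from [q] just before [x] have [f < 1] and [g > 1]; if [g x < 1],
    points just behind [x] have [f > 1] and [g < 1]. Homogeneity is asked of [f] only along this
    ray, so the two gauges may have different centres. *)
Lemma radial_level (R : realType) n (f g : 'rV[R]_n.+1 -> R) (q x : 'rV[R]_n.+1) :
  (forall t : R, 0 < t -> f (q + t *: (x - q)) = t * f x) -> continuous g -> f x = 1 ->
  (forall y, f y < 1 -> g y <= 1) -> (forall y, g y < 1 -> f y <= 1) -> g x = 1.
Proof.
move=> hf cg fx fg gf; pose gam (t : R) := g (q + t *: (x - q)).
have gam1 : gam 1 = g x by rewrite /gam scale1r addrC subrK.
have cgam : {for (1 : R), continuous gam}.
  apply: (@continuous_comp _ _ _ (fun t : R => q + t *: (x - q)) g); last exact: cg.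
  apply: continuousD; first exact: cst_continuous.
  by apply: continuousZl; exact: cvg_id.
apply/eqP; rewrite eq_le; apply/andP; split; rewrite leNgt; apply/negP => gx.
  have : \forall t \near (1 : R), 1 < gam t by apply: (cvgr_gt _ cgam); rewrite gam1.
  move=> /nbhs_ballP[r /= r0 H].
  (* The bound [1 / 2] keeps [t] positive, as the homogeneity of [f] requires. *)
  pose t : R := 1 - Num.min (r / 2) (1 / 2).
  have [t0 t1 tr] : [/\ 0 < t, t < 1 & 1 - t < r].
    by rewrite /t; case: (leP (r / 2) (1 / 2)) => ?; split; lra.
  have /H : ball (1 : R) r t by rewrite -ball_normE/= ger0_norm ?subr_ge0 ?ltW.
  rewrite /gam ltNge => /negP; apply; apply: fg.
  by rewrite hf// fx mulr1.
have : \forall t \near (1 : R), gam t < 1 by apply: (cvgr_lt _ cgam); rewrite gam1.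
move=> /nbhs_ballP[r /= r0 H]; pose t : R := 1 + r / 2.
have [t1 tr] : 1 < t /\ t - 1 < r by rewrite /t; split; lra.
have /H : ball (1 : R) r t by rewrite -ball_normE/= distrC ger0_norm ?subr_ge0 ?ltW.
rewrite /gam => /gf; rewrite hf ?(lt_trans ltr01)// fx mulr1.
by rewrite leNgt t1.
Qed.

(* Bernoulli's inequality for [a / s]. *)
Lemma power_tangent_le (R : realFieldType) n (a s : R) : 0 <= a -> 0 <= s ->
  n.+1%:R * s ^+ n * a <= a ^+ n.+1 + n%:R * s ^+ n.+1.
Proof.
move=> a0 s0; elim: n => [|k IH]; first by rewrite expr0 mulr1 mul1r expr1 mul0r addr0.
have H := ler_wpM2r a0 IH.
have sq : 0 <= k.+1%:R * s ^+ k * (a - s) ^+ 2 by rewrite mulr_ge0 ?sqr_ge0// mulr_ge0// exprn_ge0.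
rewrite -subr_ge0; move: H; rewrite -subr_ge0 => H; apply: le_trans (addr_ge0 H sq) _.
rewrite le_eqVlt; apply/orP; left; apply/eqP.
by rewrite (exprS a k.+1) !(exprS s) -!(natr1 k.+1) -!(natr1 k) ; ring.
Qed.

Section OptimalRadius.
Context {R : realType}.
Variables (n : nat) (m l : R).
Hypotheses (n0 : (0 < n)%N) (m0 : 0 < m) (l0 : 0 < l).

Definition optimal_radius : R := (m / (n.+1%:R * l)) `^ n%:R^-1.
Local Notation S := optimal_radius.

Lemma optimal_radius_gt0 : 0 < S.
Proof. by rewrite powR_gt0// divr_gt0// mulr_gt0. Qed.

Lemma optimal_radiusX : n.+1%:R * l * S ^+ n = m.
Proof.
have h : 0 <= m / (n.+1%:R * l) by rewrite divr_ge0 ?mulr_ge0// ltW.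
rewrite -powR_mulrn ?ltW ?optimal_radius_gt0// /S -powRrM mulVf ?pnatr_eq0 ?lt0n_neq0//.
by rewrite powRr1// mulrC divfK// mulf_neq0// gt_eqF.
Qed.

(** By [optimal_radiusX], [S ^ (n + 1) * l] is [S * m / (n + 1)], so the value is
    [n / (n + 1) * (S * m)]; expanding the powers in [S] gives the constant of the theorem. *)
Lemma optimal_value :
  n%:R / (n.+1%:R `^ (1 + n%:R^-1)) * l `^ (- n%:R^-1) * m `^ (1 + n%:R^-1) =
  S * m - S ^+ n.+1 * l.
Proof.
have N0 : 0 < n.+1%:R :> R by [].
have SE : S = m `^ n%:R^-1 / n.+1%:R `^ n%:R^-1 * l `^ (- n%:R^-1).
  rewrite /S invfM mulrA powRM; [|by rewrite divr_ge0// ltW|by rewrite invr_ge0 ltW].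
  rewrite powRM ?invr_ge0 ?ltW//.
  rewrite -(powR_inv1 (ltW N0)) -(powR_inv1 (ltW l0)) -!powRrM !mulN1r.
  by rewrite (powRN n.+1%:R).
have pD x : 0 < x -> x `^ (1 + n%:R^-1) = x * x `^ n%:R^-1 :> R.
  by move=> x0; rewrite powRD ?powRr1 ?ltW//; apply/implyP => _; rewrite gt_eqF.
rewrite !pD//.
have -> : S ^+ n.+1 * l = S * m / n.+1%:R.
  by rewrite -[in RHS]optimal_radiusX exprS; field; rewrite gt_eqF.
have -> : S * m - S * m / n.+1%:R = n%:R / n.+1%:R * (S * m).
  have -> : (n%:R : R) = n.+1%:R - 1 by rewrite -natr1 addrK.
  by field; rewrite gt_eqF.
rewrite SE; field.
by rewrite !gt_eqF// powR_gt0.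
Qed.

(** [power_tangent_le] at the point [S], multiplied by [l], with [(n + 1) l S ^ n] replaced by [m].
    It is used for the radius of a Wulff shape in the converse of the equality case. *)
Lemma optimal_value_ge (a : R) : 0 <= a -> a * m - a ^+ n.+1 * l <= S * m - S ^+ n.+1 * l.
Proof.
move=> a0; have S0 := ltW optimal_radius_gt0; have H := power_tangent_le n a0 S0.
have := ler_wpM2l (ltW l0) H; have := optimal_radiusX; generalize S => s <-.
rewrite -!(natr1 n) !exprS -subr_ge0 => H'; rewrite -subr_ge0.
by apply: le_trans H' _; rewrite le_eqVlt; apply/orP; left; apply/eqP; ring.
Qed.

End OptimalRadius.

(** * Anisotropic surface integrals as cone integrals *)

Section AnisoAverage.
Context {R : realType} {n : nat}.
Notation E := 'rV[R]_n.+1.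
Variable rho : E -> R.
Hypothesis hrho : forall (l : R) (x : E), 0 < l -> rho (l *: x) = l * rho x.
Hypothesis prho : forall x : E, x != 0 -> 0 < rho x.
Hypothesis srho : smooth_on [set x : E | x != 0] rho.
Variable F : E -> R.
Hypothesis hF : minkowski_norm F.

Let cr x : x != 0 -> {for x, continuous rho}. Proof. exact: rho_cont. Qed.

Lemma bmeas_average (f : E -> R) (C : R) : 0 <= C -> (forall x y, `|f x - f y| <= C * `|x - y|) ->
  bmeas (on_cone rho 1 (fun x => f ((rho x)^-1 *: x) * aniso_density rho F x)).
Proof.
move=> C0 HC; have [B HB] := density_bound hrho prho srho hF.
exact: (bmeas_radial_cone hrho prho cr HC C0 (density_measurable hrho prho srho hF)
  (density_ge0 rho hF) HB).
Qed.

Lemma aniso_integral_average (mu : {measure set E -> \bar R}) (Omega : set E) (f : E -> R) (C : R) :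
  area_measure [set x : E | rho x = 1] mu -> Omega = [set x | rho x < 1] ->
  boundary Omega = [set x | rho x = 1] -> 0 <= C -> (forall x y, `|f x - f y| <= C * `|x - y|) ->
  (forall x, 0 <= f x) -> aniso_integral F Omega mu f = sphere_average rho F f.
Proof.
move=> hmu OE bO C0 HC f0.
have cf : continuous f by move=> x; apply: loclip_continuous; exact: loclip_lip HC.
rewrite (aniso_integralE hrho prho srho hmu hF OE bO cf f0) /sphere_average -IntZ; last exact: bmeas_average HC.
congr Int; apply/funext => x; rewrite /on_cone; case: ifP => // _; by rewrite mulr0.
Qed.

Lemma sphere_average_cst (c : R) : sphere_average rho F (fun=> c) = c * sphere_average rho F (fun=> 1).
Proof.
rewrite /sphere_average mulrCA; congr (_ * _); rewrite -IntZ; last first.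
  by apply: (@bmeas_average (fun=> 1) 0) => // x y; rewrite subrr normr0 mul0r.
congr Int; apply/funext => x; rewrite /on_cone; case: ifP => _; last by rewrite mulr0.
by rewrite mul1r.
Qed.

(** By 0-homogeneity the density is bounded below by its minimum over the sup-norm sphere, which is
    positive. *)
Lemma sphere_average_gt0 : 0 < sphere_average rho F (fun=> 1).
Proof.
have cw (x : E) : x != 0 -> {for x, continuous (fun x => - aniso_density rho F x)}.
  by move=> x0; apply: continuousN; exact: density_continuous.
have [z z1 Hz] := @sphere_max R n _ cw.
have wz : 0 < aniso_density rho F z.
  apply: (minkowski_gt0 hF); apply: (rho_grad_neq0 hrho prho srho); exact: sphere_neq0 z1.
have wx x : 0 < rho x -> aniso_density rho F z <= aniso_density rho F x.
  move=> rx; have x0 : x != 0 by apply: contraTneq rx => ->; rewrite gauge0// ltxx.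
  have nx : 0 < `|x| by rewrite normr_gt0.
  rewrite -(@density_gradZ _ _ rho hrho srho F `|x|^-1 x) ?invr_gt0//.
  rewrite -lerN2; apply: Hz.
  by rewrite normrZ normfV normr_id mulVf// gt_eqF.
pose U := [set x : E | x != 0] `&` [set x | rho x < 1].
have oU : open U.
  by apply: openI; [exact: open_neq0|apply: open_sublevel; exact: gauge_continuous].
have z0 := sphere_neq0 z1; have rz : 0 < rho z by exact: prho.
pose t := (2 * rho z)^-1; have t0 : 0 < t by rewrite invr_gt0 mulr_gt0.
have Uz : U (t *: z).
  split => /=; first by rewrite scaler_eq0 negb_or z0 gt_eqF.
  rewrite hrho// /t invfM -mulrA mulVf ?gt_eqF// mulr1 invf_lt1 ?ltr1n//.
rewrite mulr_gt0//; apply: (@Int_gt0 _ _ _ set0 U (t *: z) (aniso_density rho F z)) => //.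
- by apply: (@bmeas_average (fun=> 1) 0) => // x y; rewrite subrr normr0 mul0r.
- by move=> y _; rewrite /on_cone; case: ifP => // _; rewrite mul1r; exact: density_ge0.
- move=> y [/= y0 y1] _; rewrite /on_cone prho// y1 /= mul1r; apply: wx; exact: prho.
Qed.

End AnisoAverage.

Lemma vol_wulff_domain_gt0 (R : realType) n (F : 'rV[R]_n.+1 -> R) : minkowski_norm F ->
  0 < Vol (wulff_domain F).
Proof.
move=> hF.
have hW (l : R) x : 0 < l -> dual_norm F (l *: x) = l * dual_norm F x by exact: dual_homog.
have pW x : x != 0 -> 0 < dual_norm F x by exact: dual_gt0.
have cW x : x != 0 -> {for x, continuous (dual_norm F)} by move=> _; exact: dual_continuous.
have oW : open (wulff_domain F) by apply: open_sublevel; exact: dual_continuous.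
rewrite /Vol fine_gt0// (@lebesgue_rV_open_gt0 _ _ _ 0)//=; last by rewrite /wulff_domain /= dual0.
have [M HM] := gauge_lt_bounded hW pW cW 0 1.
apply: (@lebesgue_rV_bounded _ _ _ M) => [|x xW]; first exact: open_measurable_rV.
by apply: HM; rewrite subr0.
Qed.

Lemma wulff_rescaling (R : realType) n (F : 'rV[R]_n.+1 -> R) (a : R) (P : 'rV[R]_n.+1) :
  minkowski_norm F -> 0 < a ->
  [set a *: w + P | w in wulff_shape F] = [set x | dual_norm F (x - P) = a].
Proof.
move=> hF a0; apply/seteqP; split=> x.
  by move=> [w /= w1 <-]; rewrite addrK dual_homog// w1 mulr1.
move=> /= xa; exists (a^-1 *: (x - P)); last by rewrite scalerA mulfV ?gt_eqF// scale1r subrK.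
by rewrite /wulff_shape /= dual_homog ?invr_gt0// xa mulVf// gt_eqF.
Qed.

Theorem theorem1p1 (R : realType) (n : nat) (F : 'rV[R]_n.+1 -> R)
    (Omega Sigma : set 'rV[R]_n.+1)
    (mu : {measure set 'rV[R]_n.+1 -> \bar R}) :
  (1 <= n)%N ->
  minkowski_norm F ->
  bounded_domain Omega ->
  Sigma = boundary Omega ->
  smooth_closed_hypersurface Sigma ->
  star_shaped 0 Sigma ->
  F_mean_convex F Omega ->
  area_measure Sigma mu ->
  forall P : 'rV[R]_n.+1,
    let lhs := aniso_integral F Omega mu (fun x => dual_norm F (x - P)) in
    let rhs :=
      n%:R / (n.+1%:R `^ (1 + n%:R^-1)) * Vol (wulff_domain F) `^ (- n%:R^-1)
        * aniso_perimeter F Omega mu `^ (1 + n%:R^-1) + Vol Omega in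
    rhs <= lhs /\
    (lhs = rhs <->
     exists2 a : R, 0 < a & Sigma = [set a *: w + P | w in wulff_shape F]).
Proof.
move=> n1 hF [oO _ bO] SE _ /star_shaped_gauge[rho [hrho prho srho Srho]] mc hmu P lhs rhs.
have bOmega : boundary Omega = [set x | rho x = 1] by rewrite -SE.
(* The hypotheses describe Sigma only as a boundary; [gauge_domain] shows that [Omega] is the side
   on which the gauge is small. *)
have OmegaE : Omega = [set x | rho x < 1].
  rewrite (@gauge_domain _ _ rho 0 Omega hrho prho oO bO).
    by apply/seteqP; split=> x /=; rewrite subr0.
  by rewrite bOmega; apply/seteqP; split=> x /=; rewrite subr0.
have hmu' : area_measure [set x | rho x = 1] mu by rewrite -Srho.
pose W x := dual_norm F (x - P).
have gd := gdiv_ge0 hrho prho srho OmegaE bOmega hF mc.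
have [C [C0 HC]] := gauge_translate_lip hF P.
have lhsE : lhs = sphere_average rho F W.
  apply: (aniso_integral_average hrho prho srho hF hmu' OmegaE bOmega (ltW C0) HC).
  by move=> x; exact: dual_ge0.
set m := sphere_average rho F (fun=> 1); set l := Vol (wulff_domain F).
have perE : aniso_perimeter F Omega mu = m.
  apply: (@aniso_integral_average _ _ rho hrho prho srho F hF mu Omega (fun=> 1) 0) => //.
  by move=> x y; rewrite subrr normr0 mul0r.
have m0 : 0 < m by exact: sphere_average_gt0.
have l0 : 0 < l by exact: vol_wulff_domain_gt0.
pose S := optimal_radius n m l.
have S0 : 0 < S by exact: optimal_radius_gt0.
have rhsE : rhs = S * m - S ^+ n.+1 * l + Vol Omega by rewrite /rhs perE optimal_value.
have main := calibration_ineq hrho prho srho hF P S0 gd.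
rewrite -/m -/l -OmegaE -/W -lhsE in main.
have od0 := outer_defect_ge0 hrho prho srho hF P S gd.
have id0 := inner_defect_ge0 rho F P S0.
have le_rhs : rhs <= lhs by rewrite rhsE; lra.
split => //; split => [e|[a a0 Sa]].
  (* At equality the calibration bound leaves no room for either of the two nonnegative defects. *)
  have od : outer_defect rho F P S <= 0 by move: main; rewrite e rhsE; lra.
  have idf : inner_defect rho F P S <= 0 by move: main; rewrite e rhsE; lra.
  have inW := inner_defect_eq0 hrho prho srho hF S0 n1 idf.
  have inO := outer_defect_eq0 hrho prho srho hF S0 n1 gd od.
  exists S => //; rewrite wulff_rescaling// Srho.
  pose g x := S^-1 * dual_norm F (x - P).
  have cg : continuous g.
    move=> x; suff : {for x, continuous g} by [].
    apply: continuousM; first exact: cst_continuous.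
    by apply: loclip_continuous; exact: loclip_lip HC.
  have crho : continuous rho by apply: gauge_continuous => // x; exact: rho_cont.
  have gS x : (g x < 1) = (dual_norm F (x - P) < S) by rewrite /g mulrC ltr_pdivrMr// mul1r.
  have gS' x : (g x <= 1) = (dual_norm F (x - P) <= S) by rewrite /g mulrC ler_pdivrMr// mul1r.
  have gS1 x : g x = 1 <-> dual_norm F (x - P) = S.
    rewrite /g mulrC; split=> [|->]; last by rewrite mulfV// gt_eqF.
    by move=> /(congr1 (fun t => t * S)); rewrite divfK ?mul1r// gt_eqF.
  (* The two inclusions exchange the roles of the gauges: rays start at the origin for [rho] and at
     [P] for [g]. *)
  apply/seteqP; split=> x /= hx.
    apply/gS1; apply: (@radial_level _ _ rho g 0 x) => //.
    - by move=> t t0; rewrite add0r subr0 hrho.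
    - by move=> y /inW; rewrite gS'.
    - by move=> y; rewrite gS => /inO.
  apply: (@radial_level _ _ g rho P x) => //.
  - by move=> t t0; rewrite /g addrAC subrr add0r dual_homog// mulrCA.
  - by apply/gS1.
  - by move=> y; rewrite gS => /inO.
  - by move=> y /inW; rewrite gS'.
(* Only [lhs <= rhs] remains. With [lhs = a * m] and [Vol Omega = a ^ (n + 1) * l] it says that the
   radius [a] does no better than the maximizer [S]; the perimeter of the Wulff shape is not
   computed. *)
apply/eqP; rewrite eq_le le_rhs andbT.
rewrite wulff_rescaling// in Sa.
have lhsa : lhs = a * m.
  rewrite lhsE -sphere_average_cst//; congr (_ * Int _); apply/funext => x.
  rewrite /on_cone; case: ifP => // /andP[rx _]; congr (_ * _).
  have : Sigma ((rho x)^-1 *: x) by rewrite Srho /= hrho ?invr_gt0// mulVf// gt_eqF.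
  by rewrite Sa.
have hW (t : R) x : 0 < t -> a^-1 * dual_norm F (t *: x) = t * (a^-1 * dual_norm F x).
  by move=> t0; rewrite dual_homog// mulrCA.
have pW x : x != 0 -> 0 < a^-1 * dual_norm F x by move=> x0; rewrite mulr_gt0 ?invr_gt0// dual_gt0.
(* The dual norm centred at [P] and divided by [a] is a second gauge with unit sphere Sigma, so
   [gauge_domain] identifies [Omega] with a Wulff ball. *)
have VO : Vol Omega = a ^+ n.+1 * l.
  rewrite (@gauge_domain _ _ (fun x => a^-1 * dual_norm F x) P Omega hW pW oO bO).
    rewrite -(@vol_gauge_lt _ _ (dual_norm F) _ _ _ P a)//.
    - congr Vol; apply/seteqP; split=> x /=; by rewrite mulrC ltr_pdivrMr// mul1r.
    - by move=> t x; exact: dual_homog.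
    - by move=> x; exact: dual_gt0.
    - by move=> x _; exact: dual_continuous.
  rewrite -SE Sa; apply/seteqP; split=> x /=.
    by move=> ->; rewrite mulVf// gt_eqF.
  by move=> /(congr1 (fun t => a * t)); rewrite mulr1 mulrA mulfV ?mul1r// gt_eqF.
rewrite rhsE lhsa VO; have := optimal_value_ge n1 m0 l0 (ltW a0); rewrite -/S.
lra.
Qed.
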